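(* For every positive integer $n$, \begin{align*} s_{14}(n) &= \frac{3}{7}\, \rho_6^*(n) + \frac{216}{7}\, \tau_{7,3,\chi_{-3}}(n),\\ s_{18}(n) &= \frac{27}{809}\, \rho_8^*(n) + \frac{24 \times 1728}{809}\left( 27\, \tau_{9,3,\chi_{-3};1}(n) + \tau_{9,3,\chi_{-3};2}(n)\right),\\ s_{22}(n) &= \frac{3}{1847}\, \rho_{10}^*(n) + \frac{81\times 748}{9235} \left( \tau_{11,3,\chi_{-3};1}(n) + 9\, \tau_{11,3,\chi_{-3};2}(n) \right). \end{align*}
   Context: For a positive integer $k$, let $F_k(x_1,\ldots,x_{2k}) = \sum_{j=1}^k \left(x_{2j-1}^2 + x_{2j-1}x_{2j} + x_{2j}^2\right)$ and let $s_{2k}(n) = \mathrm{card}\{(x_1,\ldots,x_{2k})\in\mathbb{Z}^{2k} : F_k(x_1,\ldots,x_{2k}) = n\}$. For positive even integers $\ell$, define $$\rho_\ell^*(n) = \sum_{d\mid n} \left(3^{\ell/2}\left(\frac{n/d}{3}\right) + (-1)^{\ell/2} \left(\frac{d}{3}\right)\right) d^\ell,$$ where the sum is over positive divisors $d$ of $n$ and $\left(\frac{\cdot}{3}\right)$ is the Legendre symbol modulo $3$. Let $\chi_{-3} = \left(\frac{-3}{\cdot}\right)$, the primitive quadratic Dirichlet character modulo $3$. Let $q=e^{2\pi i z}$ with $\mathrm{Im}(z)>0$, $\eta(z) = q^{1/24}\prod_{n\ge 1}(1-q^n)$, and $E_4(z) = 1+240\sum_{n\ge1}\sigma_3(n)q^n$,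 where $\sigma_3(n)=\sum_{d\mid n}d^3$. The numbers $\tau_{\ast}(n)$ are the Fourier coefficients of the following cusp forms of level $3$ and character $\chi_{-3}$: - Weight $7$: $\Delta_{7,3,\chi_{-3}}(z) = \sum_{n\ge1}\tau_{7,3,\chi_{-3}}(n)q^n = \frac{1}{240}\left(E_4(z)-E_4(3z)\right)\eta^9(z)\eta^{-3}(3z)$, the unique normalized newform of weight $7$, level $3$, character $\chi_{-3}$. - Weight $9$: $\sum_{n\ge1}\tau_{9,3,\chi_{-3};1}(n)q^n = \eta^3(z)\eta^{15}(3z)$ and $\sum_{n\ge1}\tau_{9,3,\chi_{-3};2}(n)q^n = \eta^{15}(z)\eta^{3}(3z)$. - Weight $11$: $\sum_{n\ge1}\tau_{11,3,\chi_{-3};1}(n)q^n = E_4(z)\Delta_{7,3,\chi_{-3}}(z)$ and $\sum_{n\ge1}\tau_{11,3,\chi_{-3};2}(n)q^n = E_4(3z)\Delta_{7,3,\chi_{-3}}(z)$. *)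

(* Defs.v *)
From HB Require Import structures.
From mathcomp Require Import all_boot all_order all_algebra.
From mathcomp Require Import finmap complex.
From mathcomp Require Import all_classical all_reals all_analysis.

Set Implicit Arguments.
Unset Strict Implicit.
Unset Printing Implicit Defensive.

Import Order.TTheory GRing.Theory Num.Theory.
Import numFieldNormedType.Exports.

Local Open Scope classical_set_scope.
Local Open Scope ring_scope.
Local Open Scope complex_scope.

(* The topology of R[i] is that of its norm. *)
HB.instance Definition _ (R : realType) := NormedModule.copy R[i] R[i]^o.

(* The variables are numbered from 0: x_(2j-1) and x_(2j), 1 <= j <= k, are
   the entries 2j and 2j+1, 0 <= j < k, of x. *)
Definition qform (k : nat) (x : (k.*2).-tuple int) : int :=
  \sum_(j < k) (x`_j.*2 ^+ 2 + x`_j.*2 * x`_(j.*2).+1 + x`_(j.*2).+1 ^+ 2).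

(* [nrep k n] is s_(2k)(n). The form is positive definite, so the set is
   finite and [fset_set] does not return its default value. *)
Definition nrep (k n : nat) : nat :=
  #|` fset_set [set x : (k.*2).-tuple int | qform x = n%:Z] |.

(* For p an odd prime. *)
Definition legendre (p a : nat) : int :=
  if (p %| a)%N then 0
  else if [exists x : 'I_p, x ^ 2 == a %[mod p]] then 1 else -1.

(* For l even. *)
Definition rho (l n : nat) : int :=
  \sum_(d <- divisors n)
    (3 ^+ l./2 * legendre 3 (n %/ d) + (-1) ^+ l./2 * legendre 3 d) * d%:Z ^+ l.

Definition sigma (k n : nat) : nat := (\sum_(d <- divisors n) d ^ k)%N.

Section ModularForms.
Variable R : realType.
Implicit Types z : R[i].

Definition cexp z : R[i] :=
  let: x +i* y := z in (expR x)%:C * (cos y +i* sin y).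

(* [qpow a z] is q^a = exp (2 pi i a z); this fixes the branch of q^(1/24). *)
Definition qpow (a : R) z : R[i] := cexp ((2 * pi * a)%:C * 'i * z).

Definition q z : R[i] := qpow 1 z.

Definition eta z : R[i] :=
  qpow 24^-1 z * lim (\prod_(1 <= n < N.+1) (1 - q z ^+ n) @[N --> \oo]).

Definition E4 z : R[i] :=
  1 + 240 * lim (\sum_(1 <= n < N.+1) (sigma 3 n)%:R * q z ^+ n @[N --> \oo]).

Definition Delta7 z : R[i] :=
  240^-1 * (E4 z - E4 (3 * z)) * eta z ^+ 9 * eta (3 * z) ^- 3.

(* tau(1), tau(2), ... are the Fourier coefficients of the cusp form f on the
   upper half-plane; the value tau(0) plays no role. *)
Definition fourier_coefs (f : R[i] -> R[i]) (tau : nat -> R[i]) : Prop :=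
  forall z, 0 < complex.Im z ->
    \sum_(1 <= n < N.+1) tau n * q z ^+ n @[N --> \oo] --> f z.

End ModularForms.

(* Main.v *)
From HB Require Import structures.
Require Import Defs.
From mathcomp Require Import all_boot all_order all_algebra.
From mathcomp Require Import complex finmap.
From mathcomp Require Import all_classical all_reals all_analysis.
From mathcomp Require Import ring lra zify.

Set Implicit Arguments.
Unset Strict Implicit.
Unset Printing Implicit Defensive.

Import Order.TTheory GRing.Theory Num.Theory.
Import numFieldNormedType.Exports.

Local Open Scope ring_scope.

(** Let a be the theta series of the form x^2 + x y + y^2.  The number of
    representations of n by F_k is the n-th coefficient of a^k, so the three
    formulas express a^7, a^9 and a^11 through Eisenstein series and cusp
    forms.  Put B = eta(z)^9 / eta(3z)^3 and C = eta(3z)^9 / eta(z)^3.  Modular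
    forms of level 3 are polynomials in a, B and C, which are tied by
    a^3 = B + 27 C, and the formulas become polynomial identities once every
    series in them is written through a, B and C.  All of this is carried out
    with formal power series in q.

    The Eisenstein series of odd weight k + 1 are the derivatives of order
    k - 1 of the Weierstrass function at the points of order 3.  In the
    variable E = e^u of the curve C^* / q^Z, the Weierstrass function is, up to
    a multiple of E_2, a term free of q plus the Lambert series [Aplus], and
    its derivatives of odd order at E = w, a cube root of unity, are the sums
    of chi(d) d^k.  For the curve C^* / q^(3Z) at the point q they are the sums of
    chi(n/d) d^k.  The differential equation of the Weierstrass function makes
    the higher derivatives polynomials in the first three, which are a^2, B (or
    C) and a B (or a C) up to constants.  This is where [eis_chi6E],
    [eis_chi'6E] and their companions for 8 and 10 come from, and
    [weight7_algebra], [weight9_algebra], [weight11_algebra] then conclude.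

    The differential equation, and the heat equation that governs the
    dependence on q, say that the square of a Lambert series is again a
    combination of Lambert series.  Both are instances of one identity between
    finite sums over the solutions of a x + b y = n, which is proved by
    Liouville's substitution a x + b y = (a - b) x + b (x + y): the lemma
    [liouville].

    Evaluated at the points of order 3, the heat equation gives the derivatives
    of a, B and C with respect to log q.  Those of B and C are logarithmic
    derivatives of eta products, whence [cub_B_prod] and [cub_C_prod].  That a,
    defined as a Lambert series, is the theta series of the hexagonal lattice
    ([hexagonal_lambert]) follows from Jacobi's triple product by summing the
    cube of a theta function over the cube roots of unity.

    It remains to compare with the functions of z.  A power series is
    determined by its values at q in the real interval (0, 1), which are the
    values on the imaginary axis.  There all series converge absolutely,
    evaluation is a ring morphism, and the value of the formal product is the
    limit of the finite products ([einf_cvg]); so the Fourier coefficients in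
    the statement are the coefficients of a C B, C^2 B, B^2 C, E_4(z) a C B and
    E_4(3z) a C B ([fourier_uniq]). *)

(** * Formal power series *)

(** A record around the coefficient function, so that it can carry the Cauchy
    product as its ring structure. *)
Record fps (R : Type) := Fps { fcoef :> nat -> R }.

Lemma fpsP (R : Type) (f g : fps R) : (forall n, f n = g n) -> f = g.
Proof. by case: f g => [f] [g] /= fg; congr Fps; apply: funext. Qed.

HB.instance Definition _ (R : Type) := gen_eqMixin (fps R).
HB.instance Definition _ (R : Type) := gen_choiceMixin (fps R).

Section FpsRing.
Variable R : comNzRingType.
Implicit Types f g h : fps R.

Definition fps0 : fps R := Fps (fun=> 0).
Definition fps_opp f : fps R := Fps (fun n => - f n).
Definition fps_add f g : fps R := Fps (fun n => f n + g n).

Lemma fps_addA : associative fps_add.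
Proof. by move=> f g h; apply: fpsP => n /=; rewrite addrA. Qed.
Lemma fps_addC : commutative fps_add.
Proof. by move=> f g; apply: fpsP => n /=; rewrite addrC. Qed.
Lemma fps_add0 : left_id fps0 fps_add.
Proof. by move=> f; apply: fpsP => n /=; rewrite add0r. Qed.
Lemma fps_addN : left_inverse fps0 fps_opp fps_add.
Proof. by move=> f; apply: fpsP => n /=; rewrite addNr. Qed.

HB.instance Definition _ :=
  GRing.isZmodule.Build (fps R) fps_addA fps_addC fps_add0 fps_addN.

Definition fps1 : fps R := Fps (fun n => (n == 0)%:R).
Definition fps_mul f g : fps R :=
  Fps (fun n => \sum_(i < n.+1) f i * g (n - i)%N).

Let trunc N f : {poly R} := \poly_(i < N) f i.

Let coef_trunc N f n : (n < N)%N -> (trunc N f)`_n = f n.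
Proof. by move=> nN; rewrite coef_poly nN. Qed.

(* Below order N the product is that of truncations, which makes the ring
   axioms those of polynomials. *)
Let fps_mulE N f g n (p q : {poly R}) : (n < N)%N ->
    (forall i, (i < N)%N -> p`_i = f i) -> (forall i, (i < N)%N -> q`_i = g i) ->
  fps_mul f g n = (p * q)`_n.
Proof.
move=> nN pf qg; rewrite coefM /=; apply: eq_bigr => i _.
by rewrite pf ?qg //; apply: leq_trans nN; rewrite ltnS ?leq_subr // -ltnS.
Qed.

Let fps_mulC : commutative fps_mul.
Proof.
move=> f g; apply: fpsP => n.
have tr h i : (i < n.+1)%N -> (trunc n.+1 h)`_i = h i by exact: coef_trunc.
by rewrite (fps_mulE (ltnSn n) (tr f) (tr g)) mulrC -(fps_mulE _ (tr g) (tr f)).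
Qed.

Let fps_mulA : associative fps_mul.
Proof.
move=> f g h; apply: fpsP => n.
have tr k i : (i < n.+1)%N -> (trunc n.+1 k)`_i = k i by exact: coef_trunc.
have trM k l i : (i < n.+1)%N ->
    (trunc n.+1 k * trunc n.+1 l)`_i = fps_mul k l i.
  by move=> iN; rewrite -(fps_mulE iN (tr k) (tr l)).
by rewrite (fps_mulE (ltnSn n) (tr f) (trM g h)) mulrA
     -(fps_mulE _ (trM f g) (tr h)).
Qed.

Let fps_mul1 : left_id fps1 fps_mul.
Proof.
move=> f; apply: fpsP => n /=; rewrite big_ord_recl /= mul1r subn0 big1 ?addr0 //.
by move=> i _; rewrite mul0r.
Qed.

Let fps_mulDl : left_distributive fps_mul fps_add.
Proof.
move=> f g h; apply: fpsP => n /=; rewrite -big_split /=.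
by apply: eq_bigr => i _; rewrite mulrDl.
Qed.

Let fps1_neq0 : fps1 != fps0.
Proof. by apply/eqP => /(congr1 (fun f => fcoef f 0)) /eqP; rewrite oner_eq0. Qed.

HB.instance Definition _ := GRing.Zmodule_isComNzRing.Build (fps R)
  fps_mulA fps_mulC fps_mul1 fps_mulDl fps1_neq0.

Lemma fps0E n : (0 : fps R) n = 0. Proof. by []. Qed.
Lemma fps1E n : (1 : fps R) n = (n == 0)%:R. Proof. by []. Qed.
Lemma fpsDE f g n : (f + g) n = f n + g n. Proof. by []. Qed.
Lemma fpsNE f n : (- f) n = - f n. Proof. by []. Qed.
Lemma fpsBE f g n : (f - g) n = f n - g n. Proof. by []. Qed.
Lemma fpsME f g n : (f * g) n = \sum_(i < n.+1) f i * g (n - i)%N.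
Proof. by []. Qed.
Lemma fpsME0 f g : (f * g) 0%N = f 0%N * g 0%N.
Proof. by rewrite fpsME big_ord1. Qed.
Lemma fpsMnE f m n : (f *+ m) n = f n *+ m.
Proof. by elim: m => [|m IH]; rewrite ?mulr0n // !mulrS fpsDE IH. Qed.
Lemma fpsXE0 f m : (f ^+ m) 0%N = f 0%N ^+ m.
Proof. by elim: m => [|m IH]; rewrite ?expr0 // !exprS fpsME0 IH. Qed.
Lemma fps_sumE (I : Type) (r : seq I) (P : pred I) (F : I -> fps R) n :
  (\sum_(i <- r | P i) F i) n = \sum_(i <- r | P i) F i n.
Proof. by elim/big_rec2: _ => [|i y1 y2 _ <-]. Qed.
Lemma fps_natM m f n : (m%:R * f) n = f n *+ m.
Proof. by rewrite mulr_natl fpsMnE. Qed.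

Definition fconst (c : R) : fps R := Fps (fun n => c *+ (n == 0)%N).

Lemma fconstE c n : fconst c n = c *+ (n == 0%N). Proof. by []. Qed.

Lemma fconstM c f n : (fconst c * f) n = c * f n.
Proof.
rewrite fpsME big_ord_recl /= subn0 big1 ?addr0 ?mulr1n //.
by move=> i _; rewrite /= mulr0n mul0r.
Qed.

Fact fconst_additive : zmod_morphism fconst.
Proof. by move=> c d; apply: fpsP => n /=; rewrite mulrnBl. Qed.
Fact fconst_monoid : monoid_morphism fconst.
Proof.
split=> [|c d]; apply: fpsP => n; rewrite ?fconstM //.
by rewrite !fconstE mulrnAr.
Qed.
HB.instance Definition _ :=
  GRing.isZmodMorphism.Build R (fps R) fconst fconst_additive.
HB.instance Definition _ :=
  GRing.isMonoidMorphism.Build R (fps R) fconst fconst_monoid.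

Definition fX m : fps R := Fps (fun n => (n == m)%:R).

Lemma fXE m n : fX m n = (n == m)%:R. Proof. by []. Qed.

Lemma fXM m f n : (fX m * f) n = if (m <= n)%N then f (n - m)%N else 0.
Proof.
rewrite fpsME; case: leqP => [mn|nm].
  rewrite (bigD1 (Ordinal (mn : (m < n.+1)%N))) //= eqxx mul1r big1 ?addr0 //.
  by move=> i; rewrite -val_eqE /= => /negPf ->; rewrite mul0r.
rewrite big1 // => i _ /=; case: eqP => [im|]; rewrite ?mul0r //.
by move: (ltn_ord i); rewrite im ltnS leqNgt nm.
Qed.

Lemma fX0 : fX 0 = 1. Proof. by apply: fpsP => n. Qed.

Lemma fXD m k : fX (m + k)%N = fX m * fX k.
Proof.
apply: fpsP => n; rewrite fXM !fXE; case: leqP => mn.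
  by congr (_%:R); lia.
by case: eqP => // nmk; lia.
Qed.

Lemma fX_exp m k : fX m ^+ k = fX (m * k)%N.
Proof.
elim: k => [|k IH]; first by rewrite muln0 expr0 fX0.
by rewrite exprS IH -fXD mulnS.
Qed.

(** The Euler operator q d/dq. *)
Definition eulerD f : fps R := Fps (fun n => f n *+ n).

Fact eulerD_additive : zmod_morphism eulerD.
Proof. by move=> f g; apply: fpsP => n /=; rewrite mulrnBl. Qed.
HB.instance Definition _ :=
  GRing.isZmodMorphism.Build (fps R) (fps R) eulerD eulerD_additive.

Lemma eulerDE f n : eulerD f n = f n *+ n. Proof. by []. Qed.

Lemma eulerDD : {morph eulerD : f g / f + g}. Proof. exact: raddfD. Qed.
Lemma eulerDB : {morph eulerD : f g / f - g}. Proof. exact: raddfB. Qed.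

Lemma eulerDM f g : eulerD (f * g) = eulerD f * g + f * eulerD g.
Proof.
apply: fpsP => n; rewrite eulerDE fpsDE !fpsME /= -sumrMnl -big_split /=.
apply: eq_bigr => i _; rewrite mulrnAl mulrnAr -mulrnDr subnKC //.
by rewrite -ltnS.
Qed.

Lemma eulerD_const c : eulerD (fconst c) = 0.
Proof. by apply: fpsP => -[|n]; rewrite /= ?mulr0n ?mul0rn. Qed.

Lemma eulerD1 : eulerD 1 = 0. Proof. by apply: fpsP => -[|n] //=; rewrite mul0rn. Qed.

Lemma eulerDn m : eulerD m%:R = 0. Proof. by rewrite raddfMn /= eulerD1 mul0rn. Qed.

Lemma eulerD_fX m : eulerD (fX m) = fX m *+ m.
Proof.
by apply: fpsP => n; rewrite fpsMnE /=; case: (n =P m) => [->|]; rewrite ?mul0rn.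
Qed.

Lemma eulerDX f m : eulerD (f ^+ m) = f ^+ m.-1 * eulerD f *+ m.
Proof.
elim: m => [|m IH]; first by rewrite expr0 eulerD1 mulr0n.
rewrite exprS eulerDM IH [LHS]/= mulrS mulrnAr mulrA; case: m {IH} => [|m].
  by rewrite !expr0 mulr0n mulrC.
by rewrite -exprS mulrC.
Qed.

Definition fderiv f : fps R := Fps (fun n => f n.+1 *+ n.+1).

Fact fderiv_additive : zmod_morphism fderiv.
Proof. by move=> f g; apply: fpsP => n /=; rewrite mulrnBl. Qed.
HB.instance Definition _ :=
  GRing.isZmodMorphism.Build (fps R) (fps R) fderiv fderiv_additive.

Lemma fX1_fderiv f : fX 1 * fderiv f = eulerD f.
Proof. by apply: fpsP => -[|n]; rewrite fXM //= subn1. Qed.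

Lemma fX_inj m : injective ( *%R (fX m)).
Proof.
move=> f g fg; apply: fpsP => n; move/(congr1 (fun h => fcoef h (n + m))): fg.
by rewrite !fXM leq_addl addnK.
Qed.

Lemma fderivM f g : fderiv (f * g) = fderiv f * g + f * fderiv g.
Proof.
apply: (@fX_inj 1); rewrite mulrDr mulrA mulrCA !fX1_fderiv.
exact: eulerDM.
Qed.

Lemma fderiv1 : fderiv 1 = 0. Proof. by apply: fpsP => n /=; rewrite mul0rn. Qed.

(** The substitution q -> q^m. *)
Definition dilate m f : fps R := Fps (fun n => f (n %/ m)%N *+ (m %| n)%N).

Fact dilate_additive m : zmod_morphism (dilate m).
Proof. by move=> f g; apply: fpsP => n /=; rewrite mulrnBl. Qed.
HB.instance Definition _ m :=
  GRing.isZmodMorphism.Build (fps R) (fps R) (dilate m) (dilate_additive m).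

End FpsRing.

Section Dilate.
Variable R : comNzRingType.
Implicit Types f g : fps R.

Lemma dilateE m f n : dilate m f n = f (n %/ m)%N *+ (m %| n)%N.
Proof. by []. Qed.

Lemma dilate_const m c : (0 < m)%N -> dilate m (fconst c) = fconst c :> fps R.
Proof.
move=> m0; apply: fpsP => n; rewrite dilateE !fconstE -mulrnA mulnb; congr (_ *+ nat_of_bool _).
case: n => [|n]; first by rewrite div0n dvdn0.
apply/negbTE; rewrite negb_and -implybE; apply/implyP => /eqP H.
by apply/negP => /divnK; rewrite H mul0n.
Qed.

Lemma dilate0E m f : dilate m f 0%N = f 0%N.
Proof. by rewrite dilateE div0n dvdn0. Qed.

Lemma dilateME m f n : (0 < m)%N -> dilate m f (m * n)%N = f n.
Proof. by move=> m0; rewrite dilateE dvdn_mulr // mulKn. Qed.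

Lemma dilateM m f g : (0 < m)%N -> dilate m (f * g) = dilate m f * dilate m g.
Proof.
move=> m0; apply: fpsP => n; rewrite dilateE.
have [/dvdnP[k ->]|ndiv] := boolP (m %| n)%N; last first.
  rewrite mulr0n fpsME big1 // => i _; rewrite !dilateE.
  have [mi|] := boolP (m %| i)%N; last by rewrite mulr0n mul0r.
  have [mni|] := boolP (m %| n - i)%N; last by rewrite mulr0n mulr0.
  by case/negP: ndiv; rewrite -(@subnK i n) ?dvdn_add // -ltnS.
rewrite mulnK // !fpsME [RHS](bigID (fun i : 'I__ => m %| i)%N) /=.
rewrite [X in _ = _ + X]big1 ?addr0; last first.
  by move=> i /negPf mi; rewrite mi mulr0n mul0r.
have hP (j : 'I_k.+1) : (j * m < (k * m).+1)%N by rewrite ltnS leq_mul // -ltnS.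
have hP' (i : 'I_(k * m).+1) : (i %/ m < k.+1)%N.
  by rewrite ltnS -[X in (_ <= X)%N](mulnK k m0) leq_div2r // -ltnS.
rewrite mulr1n [RHS](reindex_onto (fun j : 'I_k.+1 => Ordinal (hP j)) (fun i => Ordinal (hP' i))) /=.
  apply: eq_big => [j|j _]; first by rewrite dvdn_mull //= -val_eqE /= mulnK ?eqxx.
  by rewrite dvdn_mull // -mulnBl dvdn_mull // !mulnK.
by move=> i mi; apply: val_inj; rewrite /= divnK.
Qed.

Lemma dilateX m f k : (0 < m)%N -> dilate m (f ^+ k) = dilate m f ^+ k.
Proof.
move=> m0; elim: k => [|k IH]; last by rewrite !exprS dilateM ?IH.
by rewrite !expr0 -[1](rmorph1 (@fconst R)) dilate_const.
Qed.

Lemma dilate_nat m k : (0 < m)%N -> dilate m k%:R = k%:R :> fps R.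
Proof. by move=> m0; rewrite -(rmorph_nat (@fconst R)) dilate_const. Qed.

Lemma eulerD_dilate m f : eulerD (dilate m f) = dilate m (eulerD f) *+ m.
Proof.
apply: fpsP => n; rewrite fpsMnE eulerDE !dilateE eulerDE.
case: (boolP (m %| n)%N) => mn; last by rewrite !mulr0n !mul0rn.
by rewrite !mulr1n -mulrnA divnK.
Qed.
End Dilate.

Section Map.
Variables (R S : comNzRingType) (phi : {rmorphism R -> S}).
Implicit Types f g : fps R.

Definition fmap f : fps S := Fps (fun n => phi (f n)).

Lemma fmapE f n : fmap f n = phi (f n). Proof. by []. Qed.

Fact fmap_additive : zmod_morphism fmap.
Proof. by move=> f g; apply: fpsP => n /=; rewrite raddfB. Qed.
Fact fmap_monoid : monoid_morphism fmap.
Proof.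
split=> [|f g]; apply: fpsP => n; rewrite fmapE ?fps1E ?rmorph_nat //.
by rewrite !fpsME rmorph_sum; apply: eq_bigr => i _; rewrite rmorphM.
Qed.
HB.instance Definition _ :=
  GRing.isZmodMorphism.Build (fps R) (fps S) fmap fmap_additive.
HB.instance Definition _ :=
  GRing.isMonoidMorphism.Build (fps R) (fps S) fmap fmap_monoid.

Lemma fmapD : {morph fmap : f g / f + g}. Proof. exact: rmorphD. Qed.
Lemma fmapB : {morph fmap : f g / f - g}. Proof. exact: rmorphB. Qed.
Lemma fmapM : {morph fmap : f g / f * g}. Proof. exact: rmorphM. Qed.
Lemma fmap1 : fmap 1 = 1. Proof. exact: rmorph1. Qed.
Lemma fmap_nat n : fmap n%:R = n%:R. Proof. exact: rmorph_nat. Qed.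
Lemma fmapX n : {morph fmap : f / f ^+ n}. Proof. exact: rmorphXn. Qed.

Lemma fmap_eulerD f : fmap (eulerD f) = eulerD (fmap f).
Proof. by apply: fpsP => n /=; rewrite raddfMn. Qed.

Lemma fmap_fX m : fmap (fX R m) = fX S m.
Proof. by apply: fpsP => n /=; rewrite rmorph_nat. Qed.

Lemma fmap_const c : fmap (fconst c) = fconst (phi c).
Proof. by apply: fpsP => n /=; rewrite raddfMn. Qed.

Lemma fmap_dilate m f : fmap (dilate m f) = dilate m (fmap f).
Proof. by apply: fpsP => n /=; rewrite raddfMn. Qed.
End Map.

(** ** Congruence modulo a power of the variable *)

Definition fcong (R : Type) N (f g : fps R) := forall n, (n < N)%N -> f n = g n.

Section Cong.
Variable R : comNzRingType.
Implicit Types f g h : fps R.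

Lemma fcong_eq f g : (forall N, fcong N f g) -> f = g.
Proof. by move=> fg; apply: fpsP => n; apply: (fg n.+1). Qed.

Lemma fcong_sym N f g : fcong N f g -> fcong N g f.
Proof. by move=> fg n nN; rewrite fg. Qed.

Lemma fcong_trans N g f h : fcong N f g -> fcong N g h -> fcong N f h.
Proof. by move=> fg gh n nN; rewrite fg ?gh. Qed.

Lemma fcong_le N M f g : (M <= N)%N -> fcong N f g -> fcong M f g.
Proof. by move=> MN fg n nM; apply: fg; apply: leq_trans MN. Qed.

(** A coefficient of a product involves only earlier coefficients of the
    factors; this is what lets infinite products be handled through finite
    ones. *)
Lemma fcongM N f f' g g' : fcong N f f' -> fcong N g g' -> fcong N (f * g) (f' * g').
Proof.
move=> ff gg n nN; rewrite !fpsME; apply: eq_bigr => i _.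
by rewrite ff ?gg //; apply: leq_trans nN; rewrite ltnS ?leq_subr // -ltnS.
Qed.

Lemma fcongN N f f' : fcong N f f' -> fcong N (- f) (- f').
Proof. by move=> ff n nN; rewrite !fpsNE ff. Qed.

Lemma fcong_sum N (I : Type) (r : seq I) (P : pred I) (F G : I -> fps R) :
    (forall i, P i -> fcong N (F i) (G i)) ->
  fcong N (\sum_(i <- r | P i) F i) (\sum_(i <- r | P i) G i).
Proof. by move=> FG n nN; rewrite !fps_sumE; apply: eq_bigr => i /FG; apply. Qed.

Lemma fcong_eulerD N f f' : fcong N f f' -> fcong N (eulerD f) (eulerD f').
Proof. by move=> ff n nN; rewrite !eulerDE ff. Qed.

Lemma fcong_fXM N m f g : fcong N f g -> fcong (m + N) (fX R m * f) (fX R m * g).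
Proof.
move=> fg n nN; rewrite !fXM; case: leqP => // mn; apply: fg.
by rewrite ltn_subLR.
Qed.

(** A series vanishing at the origin has powers vanishing to high order, so
    its geometric series makes sense. *)
Lemma expf_low f n k : f 0%N = 0 -> (n < k)%N -> (f ^+ k) n = 0.
Proof.
move=> f0; elim: k n => [|k IH] n //; rewrite ltnS => nk.
rewrite exprS fpsME big_ord_recl f0 mul0r add0r big1 // => i _.
by rewrite lift0 IH ?mulr0 //; have := ltn_ord i; lia.
Qed.

Lemma fps_inv f c : c * f 0%N = 1 -> exists g, f * g = 1.
Proof.
move=> cf0; pose h := 1 - fconst c * f.
have h0 : h 0%N = 0 by rewrite fpsBE fconstM cf0 subrr.
pose G N := \sum_(k < N) h ^+ k.
pose g := Fps (fun n => G n.+1 n).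
have gG N : fcong N g (G N).
  move=> n nN; rewrite /g /= /G !fps_sumE -(subnKC nN) big_split_ord /=.
  by rewrite [X in _ + X]big1 ?addr0 // => i _; rewrite expf_low ?leq_addr.
exists (fconst c * g); rewrite mulrA [f * _]mulrC.
apply: fcong_eq => N; apply: (@fcong_trans N ((1 - h) * G N)).
  by apply: fcongM (gG N); rewrite /h opprB addrC subrK.
have -> : (1 - h) * G N = 1 - h ^+ N.
  rewrite -[X in _ = X - _](expr1n _ N) subrXX; congr (_ * _).
  by apply: eq_bigr => i _; rewrite expr1n mul1r.
by move=> n nN; rewrite fpsBE expf_low ?subr0.
Qed.

End Cong.

(** ** Torsion-free coefficients *)

Definition torsion_free (R : nmodType) :=
  forall (x : R) n, (0 < n)%N -> x *+ n = 0 -> x = 0.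

Lemma torsion_free_num (F : numFieldType) : torsion_free F.
Proof.
by move=> x n n0 /eqP; rewrite -mulr_natr mulf_eq0 pnatr_eq0 gtn_eqF // orbF => /eqP.
Qed.

Lemma torsion_free_fps (R : comNzRingType) : torsion_free R -> torsion_free (fps R).
Proof.
move=> tf x n n0 xn; apply: fpsP => k; apply: (tf _ n n0).
by rewrite -fpsMnE xn.
Qed.

Section Torsion.
Variables (R : comNzRingType) (tf : torsion_free R).

(** Identities are proved after multiplication by a common denominator, which
    this lemma cancels. *)
Lemma natmul_inj n : (0 < n)%N -> injective (fun x : R => n%:R * x).
Proof.
move=> n0 x y /= /eqP; rewrite -subr_eq0 -mulrBr mulr_natl => /eqP /(tf n0) /eqP.
by rewrite subr_eq0 => /eqP.
Qed.

(** The coefficient of q^n in D f = f M, where M has constant term m, is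
    (n - m) f_n plus earlier coefficients, so only f_m is free. *)
Lemma ode_eq0 (f M : fps R) m :
  eulerD f = f * M -> M 0%N = m%:R -> f m = 0 -> f = 0.
Proof.
move=> Df M0 fm; apply: fpsP; elim/ltn_ind => n IH.
have := congr1 (fun g => fcoef g n) Df; rewrite /= big_ord_recr /= subnn M0.
rewrite big1 ?add0r; last by move=> i _; rewrite IH ?mul0r.
rewrite mulr_natr; have [nm|mn|-> //] := ltngtP n m => /esym e.
  have: f n *+ (m - n) = 0 by rewrite mulrnBr 1?ltnW // e subrr.
  by apply: tf; rewrite subn_gt0.
have: f n *+ (n - m) = 0 by rewrite mulrnBr 1?ltnW // e subrr.
by apply: tf; rewrite subn_gt0.
Qed.

(** The way in which products are identified with Lambert series: both sides
    satisfy the same first-order equation. *)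
Lemma ode_uniq (f g M : fps R) m :
    eulerD f = f * M -> eulerD g = g * M -> M 0%N = m%:R -> f m = g m -> f = g.
Proof.
move=> Df Dg M0 fg; apply/eqP; rewrite -subr_eq0; apply/eqP.
apply: (ode_eq0 _ M0); last by rewrite fpsBE fg subrr.
by rewrite raddfB /= Df Dg mulrBl.
Qed.
End Torsion.

(** * Lambert series *)

(** The double series of the terms g d x q^(d x), d and x positive. *)
Definition lamb (R : nmodType) (g : nat -> nat -> R) : fps R :=
  Fps (fun n => if n == 0%N then 0 else \sum_(d <- divisors n) g d (n %/ d)%N).

Section Lambert.
Variable R : comNzRingType.
Implicit Types g h : nat -> nat -> R.

Lemma lamb0E g : lamb g 0%N = 0. Proof. by []. Qed.

Lemma lambE g n : (0 < n)%N -> lamb g n = \sum_(d <- divisors n) g d (n %/ d)%N.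
Proof. by rewrite lt0n /= => /negPf ->. Qed.

Lemma sum_divisorsC (V : nmodType) (g : nat -> nat -> V) n : (0 < n)%N ->
  \sum_(d <- divisors n) g d (n %/ d)%N = \sum_(d <- divisors n) g (n %/ d)%N d.
Proof.
move=> n0; have inv d : d \in divisors n -> (n %/ (n %/ d))%N = d.
  by rewrite -dvdn_divisors // => dn; rewrite divnA // mulKn.
transitivity (\sum_(d <- [seq (n %/ d)%N | d <- divisors n]) g d (n %/ d)%N).
  apply: perm_big; apply: uniq_perm; rewrite ?divisors_uniq //.
    rewrite map_inj_in_uniq ?divisors_uniq // => d e dn en /(congr1 (divn n)).
    by rewrite !inv.
  move=> d; apply/idP/mapP => [dn|[e en ->]].
    by exists (n %/ d)%N; rewrite ?inv // -dvdn_divisors // dvdn_div // dvdn_divisors.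
  by rewrite -dvdn_divisors // dvdn_div // dvdn_divisors.
by rewrite big_map !big_seq; apply: eq_bigr => d dn; rewrite inv.
Qed.

Lemma eq_lamb g h :
    (forall d x, (0 < d)%N -> (0 < x)%N -> g d x = h d x) -> lamb g = lamb h.
Proof.
move=> gh; apply: fpsP => n; rewrite /=; case: eqVneq => // n0.
rewrite !big_seq; apply: eq_bigr => d; move: n0; rewrite -lt0n => n0.
rewrite -dvdn_divisors // => dn; have d0 := dvdn_gt0 n0 dn.
by apply: gh => //; rewrite divn_gt0 // dvdn_leq.
Qed.

Lemma lambD g h : lamb g + lamb h = lamb (fun d x => g d x + h d x).
Proof.
by apply: fpsP => n /=; case: eqP => _; rewrite ?addr0 // big_split.
Qed.

Lemma lambN g : - lamb g = lamb (fun d x => - g d x).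
Proof. by apply: fpsP => n /=; case: eqP => _; rewrite ?oppr0 // sumrN. Qed.

Lemma lambZ c g : fconst c * lamb g = lamb (fun d x => c * g d x).
Proof.
by apply: fpsP => n; rewrite fconstM /=; case: eqP => _; rewrite ?mulr0 // mulr_sumr.
Qed.

Lemma lambMn g m : lamb g *+ m = lamb (fun d x => g d x *+ m).
Proof.
by apply: fpsP => n; rewrite fpsMnE /=; case: eqP => _; rewrite ?mul0rn // sumrMnl.
Qed.

Lemma eulerD_lamb g : eulerD (lamb g) = lamb (fun d x => g d x *+ (d * x)).
Proof.
apply: fpsP => n; rewrite /=; case: eqVneq => [_|n0]; first by rewrite mul0rn.
rewrite -sumrMnl !big_seq; apply: eq_bigr => d; rewrite -dvdn_divisors ?lt0n // => dn.
by rewrite mulnC divnK.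
Qed.

Lemma lambC g : lamb g = lamb (fun d x => g x d).
Proof.
apply: fpsP => n; rewrite /=; case: eqVneq => // n0.
by rewrite (sum_divisorsC g) // lt0n.
Qed.

Lemma fmap_lamb (S : comNzRingType) (phi : {rmorphism R -> S}) g :
  fmap phi (lamb g) = lamb (fun d x => phi (g d x)).
Proof. by apply: fpsP => n /=; case: eqP => _; rewrite ?rmorph0 // rmorph_sum. Qed.

End Lambert.

(** * Products of Lambert series *)

(** The pairs (a, x), (b, y) of positive integers with a x + b y = n, which
    index the n-th coefficient of a product of two Lambert series. *)
Definition quads (n : nat) : seq ((nat * nat) * (nat * nat)) :=
  let A := [seq (a, x) | a <- iota 1 n, x <- iota 1 n] in
  [seq t <- [seq (p, r) | p <- A, r <- A]
     | (t.1.1 * t.1.2 + t.2.1 * t.2.2 == n)%N].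

Lemma mem_quads n a x b y : ((a, x), (b, y)) \in quads n =
  [&& 0 < a, 0 < x, 0 < b, 0 < y & a * x + b * y == n]%N.
Proof.
rewrite mem_filter /=.
have [<-|] := eqVneq; last by rewrite !andbF.
rewrite /= andbT; apply/allpairsP/and4P => [[[[a' x'] [b' y']] /= []]|[a0 x0 b0 y0]].
  move=> /allpairsP[[? ?] /= [+ + [-> ->]]] /allpairsP[[? ?] /= [+ + [-> ->]]].
  by rewrite !mem_iota => /andP[? _] /andP[? _] /andP[? _] /andP[? _] [-> -> -> ->].
exists ((a, x), (b, y)) => /=; split => //; apply/allpairsP.
  by exists (a, x); rewrite !mem_iota /=; split => //; nia.
by exists (b, y); rewrite !mem_iota /=; split => //; nia.
Qed.

Lemma quads_uniq n : uniq (quads n).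
Proof.
by rewrite filter_uniq // !allpairs_uniq ?iota_uniq // => -[? ?] [? ?] _ _.
Qed.

Section QuadSums.
Variable V : nmodType.
Implicit Types (P Q : nat -> nat -> nat -> nat -> bool).
Implicit Types (h : nat -> nat -> nat -> nat -> V).

Definition qsum n P h :=
  \sum_(t <- quads n | P t.1.1 t.2.1 t.1.2 t.2.2) h t.1.1 t.2.1 t.1.2 t.2.2.

Lemma eq_qsum n P h h' :
    (forall a b x y, (0 < a)%N -> (0 < b)%N -> (0 < x)%N -> (0 < y)%N ->
       (a * x + b * y)%N = n -> P a b x y -> h a b x y = h' a b x y) ->
  qsum n P h = qsum n P h'.
Proof.
move=> hh'; rewrite /qsum big_seq_cond [RHS]big_seq_cond; apply: eq_bigr => -[[a x] [b y]] /=.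
by rewrite mem_quads => /andP[/and5P[a0 x0 b0 y0 /eqP e] p]; apply: hh'.
Qed.

Lemma qsumD n P h h' :
  qsum n P (fun a b x y => h a b x y + h' a b x y) = qsum n P h + qsum n P h'.
Proof. exact: big_split. Qed.

Lemma qsumID n P Q h : qsum n P h =
  qsum n (fun a b x y => P a b x y && Q a b x y) h +
  qsum n (fun a b x y => P a b x y && ~~ Q a b x y) h.
Proof. exact: (bigID (fun t : (nat * nat) * (nat * nat) => Q t.1.1 t.2.1 t.1.2 t.2.2)). Qed.

Lemma eq_qsuml n P Q h : (forall a b x y, P a b x y = Q a b x y) ->
  qsum n P h = qsum n Q h.
Proof. by move=> PQ; apply: eq_bigl => t. Qed.

(* The maps below are stated on the pairs ((a, x), (b, y)). *)
Lemma qsum_reindex n P Q h h' (phi psi : (nat * nat) * (nat * nat) -> (nat * nat) * (nat * nat)) :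
    (forall t, t \in quads n -> Q t.1.1 t.2.1 t.1.2 t.2.2 ->
      let t' := phi t in
      [/\ t' \in quads n, P t'.1.1 t'.2.1 t'.1.2 t'.2.2, psi t' = t &
          h t'.1.1 t'.2.1 t'.1.2 t'.2.2 = h' t.1.1 t.2.1 t.1.2 t.2.2]) ->
    (forall t, t \in quads n -> P t.1.1 t.2.1 t.1.2 t.2.2 ->
      let t' := psi t in
      [/\ t' \in quads n, Q t'.1.1 t'.2.1 t'.1.2 t'.2.2 & phi t' = t]) ->
  qsum n P h = qsum n Q h'.
Proof.
move=> H1 H2; rewrite /qsum -big_filter -[RHS]big_filter.
set sP := seq.filter _ _; set sQ := seq.filter _ _.
have mP t : t \in sP = P t.1.1 t.2.1 t.1.2 t.2.2 && (t \in quads n).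
  by rewrite mem_filter.
have mQ t : t \in sQ = Q t.1.1 t.2.1 t.1.2 t.2.2 && (t \in quads n).
  by rewrite mem_filter.
rewrite (perm_big (map phi sQ)) ?big_map /=.
  by apply: eq_big_seq => t; rewrite mQ => /andP[q tn]; have [] := H1 t tn q.
have uP : uniq sP by rewrite /sP filter_uniq ?quads_uniq.
have uQ : uniq sQ by rewrite /sQ filter_uniq ?quads_uniq.
apply: uniq_perm => //; first rewrite map_inj_in_uniq //.
  move=> s t; rewrite !mQ => /andP[qs sn] /andP[qt tn].
  have [_ _ es _] := H1 s sn qs; have [_ _ et _] := H1 t tn qt => e.
  by rewrite -es -et e.
move=> t; apply/idP/mapP => [|[s]]; rewrite ?mP ?mQ.
  move=> /andP[p tn]; have [sn q e] := H2 t tn p.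
  by exists (psi t); rewrite ?mQ ?q.
by move=> /andP[q sn] ->; have [-> ->] := H1 s sn q.
Qed.

Lemma qsum_swap n P h :
  qsum n P h = qsum n (fun a b x y => P b a y x) (fun a b x y => h b a y x).
Proof.
pose sw (t : (nat * nat) * (nat * nat)) := (t.2, t.1).
apply: (@qsum_reindex _ _ _ _ _ sw sw) => -[[a x] [b y]]; rewrite !mem_quads /=;
  by move=> /and5P[a0 x0 b0 y0 /eqP e] p; split=> //; rewrite mem_quads; lia.
Qed.

(** Liouville's substitution, a x + b y = (a - b) x + b (x + y). *)
Lemma qsum_shift n h :
  qsum n (fun a b _ _ => b < a)%N h =
  qsum n (fun _ _ x y => x < y)%N (fun a b x y => h (a + b)%N b x (y - x)%N).
Proof.
pose phi (t : (nat * nat) * (nat * nat)) :=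
  ((t.1.1 + t.2.1, t.1.2), (t.2.1, t.2.2 - t.1.2))%N.
pose psi (t : (nat * nat) * (nat * nat)) :=
  ((t.1.1 - t.2.1, t.1.2), (t.2.1, t.2.2 + t.1.2))%N.
apply: (@qsum_reindex _ _ _ _ _ phi psi) => -[[a x] [b y]];
  rewrite !mem_quads /= => /and5P[a0 x0 b0 y0 /eqP e] p; rewrite /phi /psi /=.
  split=> //; first by rewrite mem_quads; nia.
    by lia.
  by congr ((_, _), (_, _)); lia.
split; first by rewrite mem_quads; nia.
  by lia.
by congr ((_, _), (_, _)); lia.
Qed.

Lemma qsum_shift_inv n h :
  qsum n (fun _ _ x y => x < y)%N h =
  qsum n (fun a b _ _ => b < a)%N (fun a b x y => h (a - b)%N b x (x + y)%N).
Proof.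
rewrite qsum_shift; apply: eq_qsum => a b x y a0 b0 x0 y0 _ xy.
by rewrite addnK subnKC // ltnW.
Qed.

(** The same substitution with the roles of (a, b) and (x, y) exchanged. *)
Lemma qsum_coshift n h :
  qsum n (fun _ _ x y => y < x)%N h =
  qsum n (fun a b _ _ => a < b)%N (fun a b x y => h a (b - a)%N (x + y)%N y).
Proof.
pose phi (t : (nat * nat) * (nat * nat)) :=
  ((t.1.1, t.1.2 + t.2.2), (t.2.1 - t.1.1, t.2.2))%N.
pose psi (t : (nat * nat) * (nat * nat)) :=
  ((t.1.1, t.1.2 - t.2.2), (t.2.1 + t.1.1, t.2.2))%N.
apply: (@qsum_reindex _ _ _ _ _ phi psi) => -[[a x] [b y]];
  rewrite !mem_quads /= => /and5P[a0 x0 b0 y0 /eqP e] p; rewrite /phi /psi /=.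
  split=> //; first by rewrite mem_quads; nia.
    by lia.
  by congr ((_, _), (_, _)); lia.
split; first by rewrite mem_quads; nia.
  by lia.
by congr ((_, _), (_, _)); lia.
Qed.

Lemma qsum_trichotomy n (s t : nat -> nat -> nat -> nat -> nat) h :
  qsum n (fun _ _ _ _ => true) h =
  qsum n (fun a b x y => s a b x y < t a b x y)%N h +
  qsum n (fun a b x y => t a b x y < s a b x y)%N h +
  qsum n (fun a b x y => s a b x y == t a b x y) h.
Proof.
rewrite (qsumID n _ (fun a b x y => s a b x y == t a b x y)) addrC; congr (_ + _).
rewrite (qsumID n _ (fun a b x y => s a b x y < t a b x y)%N); congr (_ + _);
by apply: eq_qsuml => a b x y /=; lia.
Qed.

End QuadSums.

Lemma qsum_mulr (K : pzSemiRingType) n P (h : nat -> nat -> nat -> nat -> K) c :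
  c * qsum n P h = qsum n P (fun a b x y => c * h a b x y).
Proof. exact: mulr_sumr. Qed.

Lemma qsumN (K : zmodType) n P (h : nat -> nat -> nat -> nat -> K) :
  qsum n P (fun a b x y => - h a b x y) = - qsum n P h.
Proof. exact: sumrN. Qed.

(** Think of u a x and v a x as the values at (a, x) and at (- a, - x) of a
    character in a supported on a residue class in x, and of kappa as the
    indicator of the differences of that class; w is a weight which is even or
    odd according to the sign eps.  The weight c collects the values of w that
    the substitutions produce in the three regions a > b, a < b and a = b. *)
Section Liouville.
Variables (K : comNzRingType) (u v : nat -> nat -> K) (kappa : nat -> K).
Variables (delta : nat -> nat -> K) (w c : nat -> nat -> K) (eps : K).
Hypothesis uu : forall a b x y, (0 < x)%N -> (0 < y)%N ->
  u a x * u b (x + y)%N = u (a + b)%N x * kappa y.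
Hypothesis vv : forall a b x y, (0 < x)%N -> (0 < y)%N ->
  v a x * v b (x + y)%N = v (a + b)%N x * kappa y.
Hypothesis uv : forall a b x y, (0 < x)%N -> (0 < y)%N ->
  u (a + b)%N x * v b y = u a x * kappa (x + y)%N.
Hypothesis vu : forall a b x y, (0 < x)%N -> (0 < y)%N ->
  v (a + b)%N x * u b y = v a x * kappa (x + y)%N.
Hypothesis u_shift : forall a x y, (0 < x)%N -> (0 < y)%N ->
  u a (x + y)%N * kappa y = u a x * kappa y.
Hypothesis v_shift : forall a x y, (0 < x)%N -> (0 < y)%N ->
  v a (x + y)%N * kappa y = v a x * kappa y.
Hypothesis uu_diag : forall a b x, (0 < x)%N -> u a x * u b x = u (a + b)%N x.
Hypothesis vv_diag : forall a b x, (0 < x)%N -> v a x * v b x = v (a + b)%N x.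
Hypothesis uv_diag : forall a x y, (0 < x)%N -> (0 < y)%N ->
  u a x * v a y = delta x y.
Hypothesis wC : forall a b, w a b = w b a.
Hypothesis eps2 : eps * eps = 1.
Hypothesis c_gt : forall a b, (0 < b < a)%N ->
  c a b = w (a - b)%N b + eps * w (a + b)%N b.
Hypothesis c_lt : forall a b, (0 < a < b)%N ->
  c a b = eps * w (a + b)%N b - eps * w b (b - a)%N.
Hypothesis c_eq : forall a, (0 < a)%N -> c a a = eps * w (a + a)%N a.

Let f a x := u a x + v a x.

Let all (_ _ _ _ : nat) := true.
Let diagx (_ _ x y : nat) := x == y.
Let diaga (a b _ _ : nat) := a == b.

(* In a product of two values of the same sign, x < y and y < x are exchanged by
   symmetry, and the substitution applies in either case; x = y stays over. *)
Let split_same (r : nat -> nat -> K) n :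
    (forall a b x y, (0 < x)%N -> (0 < y)%N ->
       r a x * r b (x + y)%N = r (a + b)%N x * kappa y) ->
    (forall a b x, (0 < x)%N -> r a x * r b x = r (a + b)%N x) ->
  qsum n all (fun a b x y => w a b * (r a x * r b y)) =
  2 * qsum n (fun a b _ _ => b < a)%N (fun a b x y => w (a - b)%N b * (r a x * kappa y))
  + qsum n diagx (fun a b x y => w a b * r (a + b)%N x).
Proof.
move=> rr rd; rewrite (qsum_trichotomy n (fun _ _ x _ => x) (fun _ _ _ y => y)).
congr (_ + _); last first.
  by apply: eq_qsum => a b x y _ _ x0 _ _ /eqP <-; rewrite rd.
rewrite [X in _ + X]qsum_swap mulr_natl mulr2n.
have <- : qsum n (fun _ _ x y => x < y)%N (fun a b x y => w a b * (r a x * r b y)) =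
    qsum n (fun a b _ _ => b < a)%N (fun a b x y => w (a - b)%N b * (r a x * kappa y)).
  rewrite qsum_shift_inv; apply: eq_qsum => a b x y a0 b0 x0 y0 _ ab.
  by rewrite rr // subnK // ltnW.
congr (_ + _); apply: eq_qsum => a b x y _ _ _ _ _ _.
by rewrite wC [r b y * _]mulrC.
Qed.

(* For opposite signs it is a and b that are compared, since the difference of the
   two is then the coordinate that the substitution leaves in the character. *)
Let split_mixed n :
  qsum n all (fun a b x y => w a b * (u a x * v b y)) =
  qsum n (fun _ _ x y => x < y)%N (fun a b x y => w (a + b)%N b * (f a x * kappa y))
  + qsum n diaga (fun a b x y => w a a * delta x y).
Proof.
rewrite (qsum_trichotomy n (fun _ b _ _ => b) (fun a _ _ _ => a)).
congr (_ + _); last first.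
  rewrite (@eq_qsuml _ n _ diaga) => [|a b x y]; last exact: eq_sym.
  by apply: eq_qsum => a b x y _ _ x0 y0 _ /eqP <-; rewrite uv_diag.
rewrite [X in _ + X]qsum_swap !qsum_shift -qsumD.
apply: eq_qsum => a b x y a0 b0 x0 y0 _ xy.
have yx0 : (0 < y - x)%N by rewrite subn_gt0.
rewrite uv // [u b _ * _]mulrC vu // subnKC 1?ltnW // [w b _]wC /f.
by rewrite mulrDl mulrDr.
Qed.

(** Each product splits into the four sign combinations.  The substitution
    turns the two coordinates of the character into one and the difference
    class kappa, up to the diagonals x = y and a = b; so the square of a sum
    over (a, x) is linear in such sums, up to a sum against kappa. *)
Lemma liouville n :
  qsum n all (fun a b x y =>
    w a b * ((u a x + eps * v a x) * (u b y + eps * v b y))) =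
  2 * qsum n all (fun a b x y => c a b * (f a x * kappa y))
  - 2 * eps * qsum n diagx (fun a b x y => w (a + b)%N b * (f a x * kappa x))
  + qsum n diagx (fun a b x y => w a b * f (a + b)%N x)
  + 2 * eps * qsum n diaga (fun a b x y => w a a * delta x y).
Proof.
pose W1 := qsum n (fun a b _ _ => b < a)%N
  (fun a b x y => w (a - b)%N b * (f a x * kappa y)).
pose W2 := qsum n (fun _ _ x y => x < y)%N
  (fun a b x y => w (a + b)%N b * (f a x * kappa y)).
have -> : qsum n all (fun a b x y =>
    w a b * ((u a x + eps * v a x) * (u b y + eps * v b y))) =
  2 * W1 + qsum n diagx (fun a b x y => w a b * f (a + b)%N x)
  + 2 * eps * (W2 + qsum n diaga (fun a b x y => w a a * delta x y)).
  rewrite -split_mixed.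
  transitivity (qsum n all (fun a b x y => w a b * (u a x * u b y))
     + qsum n all (fun a b x y => w a b * (v a x * v b y))
     + (eps * qsum n all (fun a b x y => w a b * (u a x * v b y))
       + eps * qsum n all (fun a b x y => w a b * (v a x * u b y)))).
    rewrite !qsum_mulr -!qsumD; apply: eq_qsum => a b x y _ _ _ _ _ _.
    rewrite -[w a b * (v a x * v b y)]mul1r -eps2; ring.
  rewrite (split_same n uu uu_diag) (split_same n vv vv_diag).
  have -> : qsum n all (fun a b x y => w a b * (v a x * u b y)) =
            qsum n all (fun a b x y => w a b * (u a x * v b y)).
    rewrite qsum_swap; apply: eq_qsum => a b x y _ _ _ _ _ _.
    by rewrite wC [v b y * _]mulrC.
  have -> : W1 = qsum n (fun a b _ _ => b < a)%N
      (fun a b x y => w (a - b)%N b * (u a x * kappa y)) +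
    qsum n (fun a b _ _ => b < a)%N
      (fun a b x y => w (a - b)%N b * (v a x * kappa y)).
    rewrite -qsumD; apply: eq_qsum => a b x y _ _ _ _ _ _.
    by rewrite /f mulrDl mulrDr.
  have -> : qsum n diagx (fun a b x y => w a b * f (a + b)%N x) =
      qsum n diagx (fun a b x y => w a b * u (a + b)%N x)
      + qsum n diagx (fun a b x y => w a b * v (a + b)%N x).
    by rewrite -qsumD; apply: eq_qsum => a b x y _ _ _ _ _ _; rewrite mulrDr.
  ring.
have W2E : qsum n all (fun a b x y => w (a + b)%N b * (f a x * kappa y)) =
    W2 + qsum n (fun a b _ _ => a < b)%N
           (fun a b x y => w b (b - a)%N * (f a x * kappa y))
    + qsum n diagx (fun a b x y => w (a + b)%N b * (f a x * kappa x)).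
  rewrite (qsum_trichotomy n (fun _ _ x _ => x) (fun _ _ _ y => y)).
  congr (_ + _ + _).
    rewrite qsum_coshift; apply: eq_qsum => a b x y a0 b0 x0 y0 _ ab.
    by rewrite subnKC 1?ltnW // /f mulrDl u_shift // v_shift // -mulrDl.
  by apply: eq_qsum => a b x y _ _ _ _ _ /eqP ->.
have cE : qsum n all (fun a b x y => c a b * (f a x * kappa y)) =
    eps * qsum n all (fun a b x y => w (a + b)%N b * (f a x * kappa y)) + W1
    - eps * qsum n (fun a b _ _ => a < b)%N
           (fun a b x y => w b (b - a)%N * (f a x * kappa y)).
  rewrite [in LHS](qsum_trichotomy n (fun _ b _ _ => b) (fun a _ _ _ => a)).
  rewrite [in RHS](qsum_trichotomy n (fun _ b _ _ => b) (fun a _ _ _ => a)).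
  set G1 := (X in _ = eps * (X + _ + _) + _ - _).
  set G2 := (X in _ = eps * (_ + X + _) + _ - _).
  set G3 := (X in _ = eps * (_ + _ + X) + _ - _).
  set G4 := (X in _ = _ - eps * X).
  transitivity ((eps * G1 + W1) + (eps * G2 - eps * G4) + eps * G3); last by ring.
  congr (_ + _ + _).
  - rewrite /W1 qsum_mulr -qsumD; apply: eq_qsum => a b x y a0 b0 _ _ _ ab.
    by rewrite c_gt ?b0 //; ring.
  - rewrite !qsum_mulr -qsumN -qsumD; apply: eq_qsum => a b x y a0 b0 _ _ _ ab.
    by rewrite c_lt ?a0 //; ring.
  rewrite qsum_mulr; apply: eq_qsum => a b x y a0 _ _ _ _ /eqP ->.
  by rewrite c_eq //; ring.
rewrite cE W2E; ring.
Qed.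

End Liouville.

Section QuadDiagonals.
Variable V : nmodType.
Implicit Types h : nat -> nat -> nat -> nat -> V.

Let qsum_seq n P h (I : eqType) (s : seq I) (phi : I -> (nat * nat) * (nat * nat)) :
    uniq s -> {in s &, injective phi} ->
    (forall t, reflect (exists2 i, i \in s & t = phi i)
                 ((t \in quads n) && P t.1.1 t.2.1 t.1.2 t.2.2)) ->
  qsum n P h = \sum_(i <- s)
    h (phi i).1.1 (phi i).2.1 (phi i).1.2 (phi i).2.2.
Proof.
move=> us phi_inj sP; rewrite /qsum -big_filter (perm_big (map phi s)) ?big_map //.
apply: uniq_perm; rewrite ?map_inj_in_uniq //.
  by rewrite filter_uniq ?quads_uniq.
by move=> t; rewrite mem_filter andbC; apply/sP/mapP.
Qed.

Lemma qsum_diagx n h : (0 < n)%N ->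
  qsum n (fun _ _ x y => x == y) h =
  \sum_(d <- divisors n) \sum_(1 <= a < d) h a (d - a)%N (n %/ d)%N (n %/ d)%N.
Proof.
move=> n0; rewrite -(big_allpairs_dep (h := pair) (r2 := fun d => index_iota 1 d)
  (F := fun p => h p.2 (p.1 - p.2)%N (n %/ p.1)%N (n %/ p.1)%N)) /=.
set s := flatten _.
have sE d a : (d, a) \in s = [&& d %| n, 0 < a & a < d]%N.
  apply/allpairsPdep/idP => [[d' [a' []]]|/and3P[dn a0 ad]].
    by rewrite -dvdn_divisors // mem_index_iota => dn /andP[? ?] [-> ->]; apply/and3P.
  by exists d, a; rewrite -dvdn_divisors // mem_index_iota a0 ad.
pose phi (p : nat * nat) := ((p.2, n %/ p.1)%N, (p.1 - p.2, n %/ p.1)%N).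
apply: (@qsum_seq _ _ _ _ _ phi) => [||[[a x] [b y]]].
- apply: allpairs_uniq_dep; rewrite ?divisors_uniq //.
    by move=> d _; apply: iota_uniq.
  by move=> [d a] [e b] _ _ /= [-> ->].
- move=> [d a] [e b]; rewrite !sE => /and3P[_ _ ad] /and3P[_ _ be] [] /= <- _ eq_ad _.
  by congr (_, _); lia.
rewrite mem_quads; apply: (iffP andP) => /= [[/and5P[a0 x0 b0 y0 /eqP e] /eqP xy]|].
  exists ((a + b)%N, a).
    by rewrite sE a0 -addn1 leq_add2l b0 -e -xy -mulnDl dvdn_mulr.
  by rewrite /phi /= -e -xy -mulnDl mulKn ?addn_gt0 ?a0 // addKn.
move=> [[d a'] + [-> -> -> ->]]; rewrite sE => /and3P[dn a0 ad] /=.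
have d0 := dvdn_gt0 n0 dn.
rewrite a0 divn_gt0 // dvdn_leq //= subn_gt0 ad -mulnDl subnKC 1?ltnW //.
by rewrite mulnC divnK ?eqxx.
Qed.

Lemma qsum_diaga n h : (0 < n)%N ->
  qsum n (fun a b _ _ => a == b) h =
  \sum_(d <- divisors n) \sum_(1 <= x < n %/ d) h d d x (n %/ d - x)%N.
Proof.
move=> n0; rewrite -(big_allpairs_dep (h := pair) (r2 := fun d => index_iota 1 (n %/ d)%N)
  (F := fun p => h p.1 p.1 p.2 (n %/ p.1 - p.2)%N)) /=.
set s := flatten _.
have sE d a : (d, a) \in s = [&& d %| n, 0 < a & a < n %/ d]%N.
  apply/allpairsPdep/idP => [[d' [a' []]]|/and3P[dn a0 ad]].
    by rewrite -dvdn_divisors // mem_index_iota => dn /andP[? ?] [-> ->]; apply/and3P.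
  by exists d, a; rewrite -dvdn_divisors // mem_index_iota a0 ad.
pose phi (p : nat * nat) := ((p.1, p.2)%N, (p.1, n %/ p.1 - p.2)%N).
apply: (@qsum_seq _ _ _ _ _ phi) => [||[[a x] [b y]]].
- apply: allpairs_uniq_dep; rewrite ?divisors_uniq //.
    by move=> d _; apply: iota_uniq.
  by move=> [d a] [e b] _ _ /= [-> ->].
- by move=> [d a] [e b] _ _ [] /= -> -> _.
rewrite mem_quads; apply: (iffP andP) => /= [[/and5P[a0 x0 b0 y0 /eqP e] /eqP xy]|].
  exists (a, x).
    by rewrite sE x0 -e -xy -mulnDr dvdn_mulr // mulKn // -addn1 leq_add2l.
  by rewrite /phi /= -e -xy -mulnDr mulKn // addKn.
move=> [[d a'] + [-> -> -> ->]]; rewrite sE => /and3P[dn a0 ad] /=.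
have d0 := dvdn_gt0 n0 dn.
by rewrite d0 a0 subn_gt0 ad -mulnDr subnKC 1?ltnW // mulnC divnK ?eqxx.
Qed.

End QuadDiagonals.

Section LambertProduct.
Variable K : comNzRingType.
Implicit Types g h : nat -> nat -> K.

Let pairs n := [seq (a, x) | a <- iota 1 n, x <- iota 1 n].

Let lamb_pairs g n i : (i <= n)%N ->
  lamb g i = \sum_(p <- pairs n | (p.1 * p.2 == i)%N) g p.1 p.2.
Proof.
move=> i_n; have [->|i0] := posnP i.
  rewrite lamb0E big_seq_cond big1 // => -[a x] /andP[/allpairsP[[? ?] /= [+ + [-> ->]]]].
  by rewrite !mem_iota => /andP[? _] /andP[? _] /eqP; nia.
rewrite lambE // -[RHS]big_filter.
pose phi d := (d, i %/ d)%N.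
rewrite (perm_big (map phi (divisors i))) ?big_map //=.
apply: uniq_perm.
- rewrite filter_uniq // allpairs_uniq ?iota_uniq // => -[? ?] [? ?] _ _ /=.
  by move=> [-> ->].
- by rewrite map_inj_uniq ?divisors_uniq // => d e [].
move=> [a x]; rewrite mem_filter /=; apply/andP/mapP => /= [[/eqP e]|[d]].
  have [a0 x0] : (0 < a)%N /\ (0 < x)%N by split; lia.
  by move=> _; exists a; rewrite /phi -e ?mulKn // -dvdn_divisors ?dvdn_mulr // e.
rewrite -dvdn_divisors // => di [-> ->]; rewrite mulnC divnK ?eqxx //; split=> //.
have d0 := dvdn_gt0 i0 di.
have ? : (i %/ d <= i)%N by apply: leq_div.
have ? : (0 < i %/ d)%N by rewrite divn_gt0 // dvdn_leq.
have ? : (d <= i)%N by rewrite dvdn_leq.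
by apply/allpairsP; exists (d, i %/ d)%N; rewrite !mem_iota /=; split => //; lia.
Qed.

Lemma lambM g h n : (lamb g * lamb h) n =
  qsum n (fun _ _ _ _ => true) (fun a b x y => g a x * h b y).
Proof.
rewrite fpsME /qsum /quads [RHS]big_filter_cond [RHS]big_mkcond.
rewrite big_allpairs_dep.
pose G (p r : nat * nat) i :=
  (g p.1 p.2 * h r.1 r.2) *+ ((p.1 * p.2 == i) && (r.1 * r.2 == n - i))%N.
transitivity (\sum_(i < n.+1) \sum_(p <- pairs n) \sum_(r <- pairs n) G p r i).
  apply: eq_bigr => i _; have i_n : (i <= n)%N by rewrite -ltnS.
  rewrite (lamb_pairs _ i_n) (lamb_pairs _ (leq_subr i n)) big_distrl /= big_mkcond.
  apply: eq_bigr => p _; rewrite /G; case: eqP => _; last first.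
    by rewrite big1 // => r _; rewrite mulr0n.
  rewrite big_distrr /= big_mkcond; apply: eq_bigr => r _.
  by case: eqP; rewrite ?mulr1n ?mulr0n.
rewrite exchange_big; apply: eq_bigr => p _; rewrite exchange_big.
apply: eq_bigr => r _ /=; rewrite /G; have [e|e] := eqVneq.
  have lt : (p.1 * p.2 < n.+1)%N by rewrite -e ltnS leq_addr.
  rewrite (bigD1 (Ordinal lt)) //= eqxx -{1}e addKn eqxx mulr1n big1 ?addr0 //.
  by move=> i; rewrite -val_eqE /= eq_sym => /negPf ->.
rewrite big1 // => i _; case: eqP => [pi|]; last by rewrite mulr0n.
case: eqP => [ri|]; last by rewrite mulr0n.
by case/eqP: e; rewrite ri pi subnKC // -ltnS.
Qed.

End LambertProduct.

(** * Squares of the Lambert series of elliptic functions *)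

Lemma sum_nat_id d : (2 * \sum_(1 <= a < d) a = d * d.-1)%N.
Proof.
elim: d => [|[|d] IH]; [by rewrite big_geq|by rewrite big_geq|].
by rewrite big_nat_recr //= mulnDr IH; nia.
Qed.

Lemma sum_nat_mulC d : (6 * \sum_(1 <= a < d) a * (d - a) = d ^ 3 - d)%N.
Proof.
elim: d => [|[|d] IH]; [by rewrite big_geq|by rewrite big_geq|].
rewrite big_nat_recr //= (eq_big_nat _ _ (F2 := fun a => a * (d.+1 - a) + a)%N).
  rewrite big_split /=; have := sum_nat_id d.+1; move: IH => /=.
  move: (\sum_(1 <= a < d.+1) a)%N (\sum_(1 <= a < d.+1) a * (d.+1 - a))%N => s t.
  by rewrite /= subSnn muln1 !expnS expn0; nia.
by move=> a /andP[a0 ad]; rewrite subSn 1?ltnW // mulnS addnC.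
Qed.

Section Dilate.
Variable R : comNzRingType.

Lemma dilate_lamb m (g : nat -> nat -> R) : (0 < m)%N ->
  dilate m (lamb g) = lamb (fun d x => g d (x %/ m)%N *+ (m %| x)%N).
Proof.
move=> m0; apply: fpsP => n; rewrite dilateE.
have [->|n0] := posnP n; first by rewrite div0n dvdn0 mulr1n !lamb0E.
rewrite [RHS]lambE // (sum_divisorsC (fun d x => g d (x %/ m)%N *+ (m %| x)%N)) //.
have [mn|ndiv] := boolP (m %| n)%N; last first.
  rewrite mulr0n big_seq big1 // => d; rewrite -dvdn_divisors // => dn.
  have [md|] := boolP (m %| d)%N; last by rewrite mulr0n.
  by case/negP: ndiv; apply: dvdn_trans dn.
have nm0 : (0 < n %/ m)%N by rewrite divn_gt0 // dvdn_leq.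
rewrite mulr1n lambE // (sum_divisorsC g) //.
rewrite [RHS](eq_bigr (fun d => if (m %| d)%N then g (n %/ d)%N (d %/ m)%N else 0)); last first.
  by move=> d _; case: (m %| d)%N; rewrite ?mulr0n ?mulr1n.
rewrite -[RHS]big_mkcond -[RHS]big_filter [RHS](perm_big [seq m * d | d <- divisors (n %/ m)]%N).
  by rewrite big_map; apply: eq_bigr => d _; rewrite mulKn // divnMA.
apply: uniq_perm; rewrite ?filter_uniq ?divisors_uniq //.
  rewrite map_inj_uniq ?divisors_uniq // => d e /eqP.
  by rewrite eqn_pmul2l // => /eqP.
move=> d; rewrite mem_filter -dvdn_divisors //; apply/andP/mapP => [[md dn]|[e]].
  exists (d %/ m)%N; last by rewrite mulnC divnK.
  by rewrite -dvdn_divisors // dvdn_divRL // divnK.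
rewrite -dvdn_divisors // => en ->; split; first exact: dvdn_mulr.
by rewrite mulnC -dvdn_divRL.
Qed.
End Dilate.

Section Squares.
Variables (K : comNzRingType) (E E' : K).
Hypothesis EE' : E * E' = 1.

Let expEE' n : E ^+ n * E' ^+ n = 1.
Proof. by rewrite -exprMn EE' expr1n. Qed.

(** The values E^a and E^(-a) of the character, on the residue classes
    1 and -1 modulo L.  For L = 1 the sums below belong to the curve C^* / q^Z
    at the point E; for L = 3 they belong to C^* / q^(3Z) at the point E q. *)
Definition upos L a x : K := E ^+ a *+ (L %| x.-1)%N.
Definition uneg L a x : K := E' ^+ a *+ (L %| x.+1)%N.
Definition usym L a x := upos L a x + uneg L a x.

(** The Weierstrass function and, up to sign, the zeta function, without the
    terms that depend on E or on q alone. *)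
Definition Aplus L := lamb (fun a x => usym L a x *+ a).
Definition Aminus L := lamb (fun a x => upos L a x - uneg L a x).
Definition sigma1 := lamb (fun d _ => d%:R : K).

Let kap L y : K := (L %| y)%N%:R.
Let del L x y : K := ((L %| x.-1) && (L %| y.+1))%N%:R.

Let mul_ind (c d : K) (b1 b2 : bool) : (c *+ b1) * (d *+ b2) = (c * d) *+ (b1 && b2).
Proof. by case: b1 b2 => [] []; rewrite ?mulr1n ?mulr0n ?mulr0 ?mul0r. Qed.

Let mul_ind1 (c : K) (b1 b2 : bool) : (c *+ b1) * b2%:R = c *+ (b1 && b2).
Proof. by rewrite mul_ind mulr1. Qed.

Section Instance.
Variables (L : nat) (w c : nat -> nat -> K) (eps : K).
Hypothesis wC : forall a b, w a b = w b a.
Hypothesis eps2 : eps * eps = 1.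
Hypothesis c_gt : forall a b, (0 < b < a)%N ->
  c a b = w (a - b)%N b + eps * w (a + b)%N b.
Hypothesis c_lt : forall a b, (0 < a < b)%N ->
  c a b = eps * w (a + b)%N b - eps * w b (b - a)%N.
Hypothesis c_eq : forall a, (0 < a)%N -> c a a = eps * w (a + a)%N a.

Lemma liouvilleL n :
  qsum n (fun _ _ _ _ => true) (fun a b x y =>
    w a b * ((upos L a x + eps * uneg L a x) * (upos L b y + eps * uneg L b y))) =
  2 * qsum n (fun _ _ _ _ => true) (fun a b x y => c a b * (usym L a x * kap L y))
  - 2 * eps * qsum n (fun _ _ x y => x == y)
      (fun a b x y => w (a + b)%N b * (usym L a x * kap L x))
  + qsum n (fun _ _ x y => x == y) (fun a b x y => w a b * usym L (a + b)%N x)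
  + 2 * eps * qsum n (fun a b _ _ => a == b) (fun a b x y => w a a * del L x y).
Proof.
apply: (@liouville K (upos L) (uneg L) (kap L) (del L) w c eps) => //;
  rewrite /upos /uneg /kap /del.
- move=> a b [|x] y // _ _; rewrite mul_ind mul_ind1 exprD addSn /=.
  by case: (boolP (L %| x)%N) => //= Lx; rewrite dvdn_addr.
- move=> a b x y _ _; rewrite mul_ind mul_ind1 exprD -addSn /=.
  by case: (boolP (L %| x.+1)%N) => //= Lx; rewrite dvdn_addr.
- move=> a b [|x] y // _ _; rewrite mul_ind mul_ind1 exprD -mulrA expEE' mulr1 /=.
  by rewrite addSnnS; case: (boolP (L %| x)%N) => //= Lx; rewrite dvdn_addr.
- move=> a b x [|y] // _ _; rewrite mul_ind mul_ind1 exprD -mulrA [E' ^+ b * _]mulrC.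
  rewrite expEE' mulr1 /= addnS -addSn.
  by case: (boolP (L %| x.+1)%N) => //= Lx; rewrite dvdn_addr.
- move=> a [|x] y // _ _; rewrite !mul_ind1 addSn /= andbC [in RHS]andbC.
  by case: (boolP (L %| y)%N) => //= Ly; rewrite dvdn_addl.
- move=> a x y _ _; rewrite !mul_ind1 -addSn andbC [in RHS]andbC.
  by case: (boolP (L %| y)%N) => //= Ly; rewrite dvdn_addl.
- by move=> a b x _; rewrite mul_ind exprD andbb.
- by move=> a b x _; rewrite mul_ind exprD andbb.
- by move=> a x y _ _; rewrite mul_ind expEE'.
Qed.
End Instance.

Lemma dilate_sigma1 L : (0 < L)%N ->
  dilate L sigma1 = lamb (fun b y => b%:R * kap L y).
Proof.
by move=> L0; rewrite dilate_lamb //; apply: eq_lamb => d x _ _; rewrite mulr_natr.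
Qed.

(** The weight a b.  The sum against kappa is the product with the dilated
    [sigma1], and the diagonals give the three divisor sums. *)
Lemma Aplus_sqr L : (0 < L)%N ->
  6 * (Aplus L * Aplus L) = 24 * (Aplus L * dilate L sigma1)
   - 12 * lamb (fun d x => \sum_(1 <= a < d) (usym L a x * kap L x) *+ (d * (d - a)))
   + lamb (fun d x => usym L d x *+ (d ^ 3 - d))
   + 12 * lamb (fun d x => (\sum_(1 <= y < x) del L y (x - y)%N) *+ (d * d)).
Proof.
move=> L0; apply: fpsP => n; rewrite !fpsDE !fpsNE !fps_natM.
have [->|n0] := posnP n.
  by rewrite !fpsME0 !lamb0E !mul0r !mul0rn subrr !addr0.
rewrite dilate_sigma1 // !lambM.
rewrite (eq_qsum (h' := fun a b x y => (a * b)%:R *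
    ((upos L a x + 1 * uneg L a x) * (upos L b y + 1 * uneg L b y)))); last first.
  by move=> a b x y *; rewrite /usym; ring.
rewrite (@liouvilleL L (fun a b => (a * b)%:R) (fun a b => (2 * a * b)%:R)) ?mulr1 //;
  first 1 last.
- by move=> a b; rewrite mulnC.
- by move=> a b ab; rewrite mul1r -natrD; congr _%:R; nia.
- move=> a b ab; rewrite !mul1r -natrB; last by nia.
  by congr _%:R; nia.
- by move=> a a0; rewrite mul1r; congr _%:R; nia.
rewrite !mulrnDl !qsum_diagx // qsum_diaga // !lambE //.
congr (_ + _ + _ + _).
- rewrite mulr_natl -mulrnA -[RHS]mulr_natl -[LHS]mulr_natl !qsum_mulr.
  by apply: eq_qsum => a b x y *; rewrite -mulnA natrM mulrnAl; ring.
- rewrite mulNrn; congr (- _); rewrite mulr_natl -mulrnA; congr (_ *+ _).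
  apply: eq_bigr => d _; apply: eq_big_nat => a /andP[a0 ad].
  by rewrite subnKC 1?ltnW // mulr_natl.
- rewrite -sumrMnl; apply: eq_bigr => d _; rewrite -sum_nat_mulC.
  rewrite mulnC mulrnA; congr (_ *+ _); rewrite -sumrMnr.
  by apply: eq_big_nat => a /andP[a0 ad]; rewrite subnKC 1?ltnW // mulr_natl.
- rewrite mulr_natl -mulrnA; congr (_ *+ _); apply: eq_bigr => d _.
  by rewrite -sumrMnl; apply: eq_bigr => x _; rewrite mulr_natl.
Qed.

(** The constant weight, with the sign -1 between the residue classes: then c
    vanishes off the diagonal a = b, and every term is a divisor sum. *)
Lemma Aminus_sqr L :
  Aminus L * Aminus L = 
   - 2 * lamb (fun d x => \sum_(1 <= y < x) (usym L d y * kap L (x - y)%N))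
   + 2 * lamb (fun d x => \sum_(1 <= a < d) (usym L a x * kap L x))
   + lamb (fun d x => usym L d x *+ d.-1)
   - 2 * lamb (fun d x => \sum_(1 <= y < x) del L y (x - y)%N).
Proof.
apply: fpsP => n; rewrite !mulNr !fpsDE !fpsNE !fps_natM.
have [->|n0] := posnP n.
  by rewrite !fpsME0 !lamb0E !mul0r !mul0rn oppr0 !addr0.
rewrite !lambM.
rewrite (eq_qsum (h' := fun a b x y => 1 *
    ((upos L a x + (- 1) * uneg L a x) * (upos L b y + (- 1) * uneg L b y)))); last first.
  by move=> a b x y *; ring.
rewrite (@liouvilleL L (fun a b => 1) (fun a b => - (a == b)%:R)) //; first 1 last.
- by ring.
- by move=> a b /andP[_ ab]; rewrite gtn_eqF //=; ring.
- by move=> a b /andP[_ ab]; rewrite ltn_eqF //=; ring.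
- by move=> a a0; rewrite eqxx /=; ring.
rewrite !qsum_diagx // qsum_diaga // !lambE //.
congr (_ + _ + _ + _).
- rewrite -[RHS]mulNrn -[RHS]mulr_natl; congr (_ * _).
  rewrite -(qsum_diaga (fun a b x y => usym L a x * kap L y)) // -qsumN /qsum.
  rewrite [RHS]big_mkcond; apply: eq_bigr => t _.
  by case: eqP => _ /=; ring.
- rewrite mulrN1 mulNr opprK mulr_natl; congr (_ *+ _).
  by apply: eq_bigr => d _; apply: eq_bigr => a _; rewrite mul1r.
- apply: eq_bigr => d _.
  rewrite (eq_big_nat _ _ (F2 := fun=> usym L d (n %/ d))); last first.
    by move=> a /andP[a0 ad]; rewrite subnKC 1?ltnW // mul1r.
  by rewrite sumr_const_nat subn1.
- rewrite mulrN1 mulNr mulr_natl; congr (- (_ *+ _)).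
  by apply: eq_bigr => d _; apply: eq_bigr => a _; rewrite mul1r.
Qed.

End Squares.

(** * Differential equations of elliptic functions *)

Section CoefDer.
Variables (K : comNzRingType) (der : {additive K -> K}).
Hypothesis derM : forall x y, der (x * y) = der x * y + x * der y.

(** The derivation of the coefficients; with q fixed, it is d/du for E = e^u. *)
Definition cder (f : fps K) : fps K := Fps (fun n => der (f n)).

Fact cder_additive : zmod_morphism cder.
Proof. by move=> f g; apply: fpsP => n /=; rewrite raddfB. Qed.
HB.instance Definition _ :=
  GRing.isZmodMorphism.Build (fps K) (fps K) cder cder_additive.

Lemma cderD : {morph cder : f g / f + g}. Proof. exact: raddfD. Qed.
Lemma cderB : {morph cder : f g / f - g}. Proof. exact: raddfB. Qed.

Lemma cderM f g : cder (f * g) = cder f * g + f * cder g.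
Proof.
apply: fpsP => n; rewrite fpsDE !fpsME /= raddf_sum /= -big_split /=.
by apply: eq_bigr => i _; rewrite derM.
Qed.

Lemma der1 : der 1 = 0.
Proof.
by have := derM 1 1; rewrite !mul1r mulr1 => /eqP; rewrite -subr_eq0 opprD addNKr
  oppr_eq0 => /eqP.
Qed.

Lemma cder_const c : cder (fconst c) = fconst (der c).
Proof. by apply: fpsP => n /=; rewrite raddfMn. Qed.

Lemma cder_nat n : cder n%:R = 0.
Proof.
by rewrite raddfMn -[1](rmorph1 (@fconst K)) /= cder_const der1 raddf0 mul0rn.
Qed.

Lemma cder1 : cder 1 = 0.
Proof. exact: (cder_nat 1). Qed.

Lemma cder_eulerD f : cder (eulerD f) = eulerD (cder f).
Proof. by apply: fpsP => n /=; rewrite raddfMn. Qed.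

Lemma cder_lamb (g : nat -> nat -> K) : cder (lamb g) = lamb (fun d x => der (g d x)).
Proof. by apply: fpsP => n /=; case: eqP => _; rewrite ?raddf0 // raddf_sum. Qed.

Lemma cder_sigma1 : cder (sigma1 K) = 0.
Proof.
rewrite cder_lamb; apply: fpsP => n; rewrite /= fun_if big1 ?if_same // => d _.
by rewrite raddfMn /= der1 mul0rn.
Qed.

Lemma cder_dilate m f : cder (dilate m f) = dilate m (cder f).
Proof. by apply: fpsP => n /=; rewrite raddfMn. Qed.
(** With q0 twelve times the Weierstrass function p, the hypothesis is
    p''' = 12 p p'.  Odd derivatives are q1 times a polynomial in q0, q1^2 and
    q2, and these give the Eisenstein series of weights 7, 9 and 11. *)
Section Taylor.
Variable q0 : fps K.
Let q1 := cder q0.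
Let q2 := cder q1.
Hypothesis q3 : cder q2 = q0 * q1.

Let q4 : iter 4 cder q0 = q1 ^+ 2 + q0 * q2.
Proof. by rewrite /= -/q1 -/q2 q3 cderM -/q1 -/q2 expr2. Qed.

Lemma taylor5 : iter 5 cder q0 = 3 * q1 * q2 + q0 ^+ 2 * q1.
Proof. by rewrite iterS q4 !expr2 cderD !cderM -/q1 -/q2 q3; ring. Qed.

Let q6 : iter 6 cder q0 = 3 * q2 ^+ 2 + 5 * q0 * q1 ^+ 2 + q0 ^+ 2 * q2.
Proof.
by rewrite iterS taylor5 !expr2 cderD !cderM -/q1 -/q2 q3 !cder_nat; ring.
Qed.

Lemma taylor7 : iter 7 cder q0 = 5 * q1 ^+ 3 + 18 * q0 * q1 * q2 + q0 ^+ 3 * q1.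
Proof.
by rewrite iterS q6 !expr2 !cderD !cderM -/q1 -/q2 q3 !cder_nat; ring.
Qed.

Let q8 : iter 8 cder q0 =
  33 * q1 ^+ 2 * q2 + 18 * q0 * q2 ^+ 2 + 21 * q0 ^+ 2 * q1 ^+ 2 + q0 ^+ 3 * q2.
Proof.
by rewrite iterS taylor7 !exprS !expr0 !cderD !cderM -/q1 -/q2 q3 !cder_nat cder1; ring.
Qed.

Lemma taylor9 : iter 9 cder q0 =
  84 * q1 * q2 ^+ 2 + 75 * q0 * q1 ^+ 3 + 81 * q0 ^+ 2 * q1 * q2 + q0 ^+ 4 * q1.
Proof.
by rewrite iterS q8 !exprS !expr0 !cderD !cderM -/q1 -/q2 q3 !cder_nat cder1; ring.
Qed.
End Taylor.
End CoefDer.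

Section Elliptic.
Variables (K : comNzRingType) (der : {additive K -> K}).
Hypothesis derM : forall x y, der (x * y) = der x * y + x * der y.
Variables (E E' : K).
Hypotheses (EE' : E * E' = 1) (derE : der E = E).

Let derE' : der E' = - E'.
Proof.
have := derM E E'; rewrite EE' der1 // derE EE' => e.
have: E' * (1 + E * der E') = 0 by rewrite -e mulr0.
by rewrite mulrDr mulr1 mulrA [E' * E]mulrC EE' mul1r => /eqP; rewrite addrC addr_eq0 => /eqP.
Qed.

Let derX n : der (E ^+ n) = E ^+ n *+ n.
Proof.
elim: n => [|n IH]; first by rewrite expr0 der1.
by rewrite exprS derM derE IH mulrnAr -mulrS.
Qed.

Let derX' n : der (E' ^+ n) = - (E' ^+ n *+ n).
Proof.
elim: n => [|n IH]; first by rewrite expr0 der1 // oppr0.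
by rewrite exprS derM derE' IH mulNr mulrN mulrnAr -opprD -mulrS.
Qed.

Lemma der_upos L a x : der (upos E L a x) = upos E L a x *+ a.
Proof. by rewrite raddfMn /= derX mulrnAC. Qed.

Lemma der_uneg L a x : der (uneg E' L a x) = - (uneg E' L a x *+ a).
Proof. by rewrite raddfMn /= derX' mulNrn mulrnAC. Qed.

Local Notation Ap := (Aplus E E').
Local Notation Am := (Aminus E E').
Local Notation u := (upos E).
Local Notation v := (uneg E').
Local Notation Sg := (sigma1 K).
Local Notation cd := (cder der).
Local Notation D := (@eulerD K).

Lemma cder_Aminus L : cd (Am L) = Ap L.
Proof.
rewrite cder_lamb; apply: eq_lamb => d x _ _.
by rewrite raddfB /= der_upos der_uneg opprK mulrnDl.
Qed.

Lemma cder_Aplus L : cd (Ap L) = lamb (fun d x => (u L d x - v L d x) *+ (d * d)).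
Proof.
rewrite cder_lamb; apply: eq_lamb => d x _ _.
by rewrite raddfMn raddfD /= der_upos der_uneg -mulrnBl -mulrnA.
Qed.

Lemma cder2_Aplus L : cd (cd (Ap L)) = lamb (fun d x => usym E E' L d x *+ d ^ 3).
Proof.
rewrite cder_Aplus cder_lamb; apply: eq_lamb => d x _ _.
by rewrite raddfMn raddfB /= der_upos der_uneg opprK -mulrnDl -mulrnA.
Qed.

Lemma cder_iter_Aplus L k : iter k cd (Ap L) =
  lamb (fun d x => (u L d x + (-1) ^+ k * v L d x) *+ d ^ k.+1).
Proof.
elim: k => [|k IH].
  by apply: eq_lamb => d x _ _; rewrite expr0 mul1r expn1.
rewrite iterS IH cder_lamb; apply: eq_lamb => d x _ _.
rewrite raddfMn raddfD /= exprS [(d ^ k.+2)%N]expnS mulrnA -signr_odd.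
congr (_ *+ _); case: (odd k); rewrite ?expr0 ?expr1 ?mulN1r ?mul1r.
  by rewrite raddfN /= der_upos der_uneg; ring.
by rewrite der_upos der_uneg; ring.
Qed.

Let lamb_cube L :
  lamb (fun d x => usym E E' L d x *+ (d ^ 3 - d)) = cd (cd (Ap L)) - Ap L.
Proof.
rewrite cder2_Aplus /Aplus lambN lambD; apply: eq_lamb => d x d0 _.
by rewrite mulrnBr // -[leqLHS]expn1 leq_pexp2l.
Qed.

(** ** The curve with nome q *)

Section Period1.
Variable I : K.
Hypothesis I1 : I * (1 - E) = 1.

(** The terms free of q: up to sign, coth (u / 2), and the square of
    1 / (2 sinh (u / 2)). *)
Definition coth0 : K := (1 + E) * I.
Definition wp0 : K := E * I ^+ 2.

Lemma der_I : der I = E * I ^+ 2.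
Proof.
have := derM I (1 - E); rewrite I1 der1 // raddfB /= der1 // derE sub0r => e.
have: I * (der I * (1 - E) + I * - E) = 0 by rewrite -e mulr0.
rewrite mulrDr mulrCA I1 mulr1 => /eqP; rewrite addr_eq0 => /eqP ->; ring.
Qed.

Lemma der_coth0 : der coth0 = 2 * wp0.
Proof.
rewrite /coth0 /wp0 derM raddfD /= der1 // add0r derE der_I.
have -> : E * I = E * (I * (I * (1 - E))) by rewrite I1 mulr1.
ring.
Qed.

Let I1sq : (I * (1 - E)) ^+ 2 = 1.
Proof. by rewrite I1 expr1n. Qed.

Lemma coth0_sqr : coth0 ^+ 2 = 4 * wp0 + 1.
Proof.
by rewrite /coth0 /wp0 -[X in _ = _ + X]I1sq; ring.
Qed.

Lemma der_wp0 : der wp0 = coth0 * wp0.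
Proof.
rewrite /coth0 /wp0 expr2 !derM derE der_I.
transitivity (E * I ^+ 2 * 1 + 2 * E ^+ 2 * I ^+ 3); first by ring.
rewrite -[X in _ * X + _]I1; ring.
Qed.

Let F a := E ^+ a + E' ^+ a.

Lemma usym1 a x : usym E E' 1 a x = F a.
Proof. by rewrite /usym /upos /uneg !dvd1n. Qed.

(* Geometric sums: the finite sums over a < d left over by the Liouville
   identity combine with the constant terms of the elliptic functions. *)
Let sumF d : 1 + \sum_(1 <= a < d.+1) F a = - (E * I * (E ^+ d - E' ^+ d.+1)).
Proof.
elim: d => [|d IH].
  rewrite big_geq // addr0 expr0 expr1 -[LHS]I1.
  have -> : - (E * I * (1 - E')) = I * (E * E' - E) by ring.
  by rewrite EE'.
rewrite big_nat_recr //= addrA IH /F [E' ^+ d.+2]exprS.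
have -> : E ^+ d.+1 + E' ^+ d.+1 =
  (E ^+ d.+1 + E' ^+ d.+1) * (I * (1 - E)) by rewrite I1 mulr1.
have -> : E * I * (E ^+ d.+1 - E' * E' ^+ d.+1) =
  I * (E * E ^+ d.+1 - E * E' * E' ^+ d.+1) by ring.
by rewrite EE' (exprS E d); ring.
Qed.

Let sumFd d : \sum_(1 <= a < d) F a *+ (d - a) = wp0 * (F d - 2) - d%:R.
Proof.
case: d => [|d]; first by rewrite big_geq // /F !expr0; ring.
elim: d => [|d IH].
  rewrite big_geq // /F !expr1 /wp0.
  have -> : E * I ^+ 2 * (E + E' - 2) = I ^+ 2 * (E ^+ 2 + E * E' - 2 * E) by ring.
  by rewrite EE' -[X in _ = _ - X]I1sq; ring.
have -> : \sum_(1 <= a < d.+2) F a *+ (d.+2 - a) =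
    \sum_(1 <= a < d.+1) F a *+ (d.+1 - a) + \sum_(1 <= a < d.+2) F a.
  rewrite [LHS]big_nat_recr // [X in _ = _ + X]big_nat_recr //= subSnn mulr1n.
  rewrite [RHS]addrA; congr (_ + _); rewrite -big_split /=.
  by apply: eq_big_nat => a /andP[_ ad]; rewrite subSn 1?ltnW // mulrSr.
have := sumF d.+1 => /(canRL (addKr _)) ->; rewrite IH /F /wp0.
have -> : E * I * (E ^+ d.+1 - E' ^+ d.+2) =
  E * I * (E ^+ d.+1 - E' ^+ d.+2) * (I * (1 - E)) by rewrite I1 mulr1.
have -> : E' ^+ d.+1 = E * E' ^+ d.+2 by rewrite (exprS E' d.+1) mulrA EE' mul1r.
by rewrite -[d.+2%:R]natr1 (exprS E d.+1); ring.
Qed.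

Let cothF d : (0 < d)%N ->
  coth0 * (E ^+ d - E' ^+ d) = - (F d + 2 + 2 * \sum_(1 <= a < d) F a).
Proof.
case: d => // d _; have := sumF d => /(canRL (addKr _)) ->; rewrite /F /coth0.
transitivity (- ((E ^+ d.+1 + E' ^+ d.+1) * 1 - 2 * E * I * (E ^+ d - E' ^+ d.+1))).
  by rewrite -[X in _ = - (_ * X - _)]I1 (exprS E d); ring.
ring.
Qed.

(** The Weierstrass equation p'' = 6 p^2 - g_2 / 2 for the part of p that
    depends on q.  The geometric sums in E merge with the product of wp0 and
    the Lambert series. *)
Lemma wp_sqr1 : 6 * (Ap 1 * Ap 1) =
  24 * (Ap 1 * Sg) - 12 * (fconst wp0 * Ap 1) + 24 * (fconst wp0 * Sg)
  + 12 * D Sg + cd (cd (Ap 1)) - Ap 1.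
Proof.
rewrite Aplus_sqr // dilate_sigma1 // -/(sigma1 K) lamb_cube.
have -> : lamb (fun b y : nat => b%:R * (1 %| y)%N%:R) = Sg.
  by apply: eq_lamb => d x _ _; rewrite dvd1n mulr1.
have -> : lamb (fun d x => \sum_(1 <= a < d)
    usym E E' 1 a x * (1 %| x)%N%:R *+ (d * (d - a))) =
  fconst wp0 * Ap 1 - 2 * (fconst wp0 * Sg) - lamb (fun d _ => (d * d)%:R).
  rewrite /Aplus /sigma1 !lambZ mulr_natl lambMn !lambN !lambD.
  apply: eq_lamb => d x _ _; rewrite usym1 dvd1n natrM.
  have -> : \sum_(1 <= a < d) usym E E' 1 a x * 1 *+ (d * (d - a)) =
            (\sum_(1 <= a < d) F a *+ (d - a)) *+ d.
    rewrite -sumrMnl; apply: eq_bigr => a _.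
    by rewrite usym1 mulr1 mulnC mulrnA.
  by rewrite sumFd; ring.
have -> : lamb (fun d x => (\sum_(1 <= y < x)
    ((1 %| y.-1) && (1 %| (x - y).+1))%N%:R) *+ (d * d)) =
  D Sg - lamb (fun d _ => (d * d)%:R) :> fps K.
  rewrite eulerD_lamb lambN lambD; apply: eq_lamb => d [|x] // _ _.
  rewrite (eq_bigr (fun=> 1)); last by move=> y _; rewrite !dvd1n.
  rewrite sumr_const_nat subn1 /= -!mulrnA -mulrnBr; last by nia.
  by congr (_ *+ _); nia.
ring.
Qed.

(** Up to sign, the derivative of log theta in log q. *)
Definition heatH := lamb (fun d x => F d *+ x).

Lemma cder_heatH : cd heatH = D (Am 1).
Proof.
rewrite cder_lamb eulerD_lamb; apply: eq_lamb => d x _ _.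
by rewrite raddfMn raddfD /= derX derX' -mulrnBl -mulrnA /upos /uneg !dvd1n.
Qed.

(** The heat equation of the theta function, divided by theta.  Half of the
    series squared here is, up to sign, the logarithmic derivative f of theta in
    u, and f^2 is theta'' / theta - f', where theta'' is a derivative in
    log q. *)
Lemma zeta_sqr1 : (fconst coth0 + 2 * Am 1) ^+ 2 =
  fconst (coth0 ^+ 2) + 4 * Ap 1 - 8 * heatH - 8 * Sg.
Proof.
have -> : (fconst coth0 + 2 * Am 1) ^+ 2 =
    fconst coth0 ^+ 2 + 4 * (fconst coth0 * Am 1) + 4 * (Am 1 * Am 1) by ring.
rewrite rmorphXn -!addrA; congr (_ + _).
have -> : Sg = lamb (fun _ x => x%:R) by exact: lambC.
rewrite Aminus_sqr // /Aminus /Aplus /heatH lambZ !mulNr.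
rewrite !mulr_natl !(lambMn, lambN, lambD).
apply: eq_lamb => d x d0 x0; rewrite !usym1 !dvd1n.
have -> : upos E 1 d x - uneg E' 1 d x = E ^+ d - E' ^+ d.
  by rewrite /upos /uneg !dvd1n.
rewrite cothF //.
have -> : \sum_(1 <= y < x) usym E E' 1 d y * (1 %| x - y)%N%:R = F d *+ x.-1.
  rewrite (eq_bigr (fun=> F d)); last by move=> y _; rewrite usym1 dvd1n mulr1.
  by rewrite sumr_const_nat subn1.
have -> : \sum_(1 <= a < d) usym E E' 1 a x * 1 = \sum_(1 <= a < d) F a.
  by apply: eq_bigr => a _; rewrite usym1 mulr1.
have -> : \sum_(1 <= y < x) ((1 %| y.-1) && (1 %| (x - y).+1))%N%:R = x.-1%:R :> K.
  rewrite (eq_bigr (fun=> 1)); last by move=> y _; rewrite !dvd1n.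
  by rewrite sumr_const_nat subn1.
case: d d0 => // d _; case: x x0 => // x _ /=.
rewrite !mulrSr -?natr1; ring.
Qed.

End Period1.

(** ** The curve with nome q^3 *)

Section Period3.

Let count1 m : (\sum_(1 <= y < (3 * m).+1) (3 %| y.-1) = m)%N.
Proof.
elim: m => [|m IH]; first by rewrite big_geq.
by rewrite mulnS !addSn add0n; do 3!rewrite big_nat_recr //=; rewrite IH; lia.
Qed.

Let count2 m : (\sum_(1 <= y < (3 * m).+2) (3 %| y.+1) = m)%N.
Proof.
elim: m => [|m IH]; first by rewrite big_nat1.
by rewrite mulnS !addSn add0n; do 3!rewrite big_nat_recr //=; rewrite IH; lia.
Qed.

Let sum_usym3 d x : (0 < x)%N ->
  \sum_(1 <= y < x) usym E E' 3 d y * (3 %| x - y)%N%:R =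
  usym E E' 3 d x *+ (x %/ 3)%N.
Proof.
move=> x0; have e1 : (\sum_(1 <= y < x) ((3 %| y.-1) && (3 %| x - y)) =
    (3 %| x.-1) * (x %/ 3))%N.
  case: (boolP (3 %| x.-1)%N) => [x1|x1].
    have [m xm] : exists m, x = (3 * m).+1 by exists (x.-1 %/ 3)%N; lia.
    rewrite (eq_big_nat _ _ (F2 := fun y => (3 %| y.-1)%N : nat)); last by move=> y; lia.
    by rewrite xm count1; lia.
  by rewrite big_nat big1 // => y; lia.
have e2 : (\sum_(1 <= y < x) ((3 %| y.+1) && (3 %| x - y)) =
    (3 %| x.+1) * (x %/ 3))%N.
  case: (boolP (3 %| x.+1)%N) => [x1|x1].
    have [m xm] : exists m, x = (3 * m).+2 by exists ((x - 2) %/ 3)%N; lia.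
    rewrite (eq_big_nat _ _ (F2 := fun y => (3 %| y.+1)%N : nat)); last by move=> y; lia.
    by rewrite xm count2; lia.
  by rewrite big_nat big1 // => y; lia.
rewrite /usym mulrnDl /upos /uneg -!mulrnA -e1 -e2 -!sumrMnr -big_split /=.
apply: eq_bigr => y _; rewrite mulrDl.
by case: (3 %| y.-1)%N; case: (3 %| y.+1)%N; case: (3 %| x - y)%N => /=; ring.
Qed.

Let count3 x : (0 < x)%N ->
  (\sum_(1 <= y < x) ((3 %| y.-1) && (3 %| (x - y).+1)) = (3 %| x) * (x %/ 3))%N.
Proof.
move=> x0; case: (boolP (3 %| x)%N) => [x3|x3]; last first.
  by rewrite big_nat big1 // => y; lia.
have [m xm] : exists m, x = (3 * m)%N by exists (x %/ 3)%N; lia.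
rewrite (eq_big_nat _ _ (F2 := fun y => (3 %| y.-1)%N : nat)); last by move=> y; lia.
have := count1 m; rewrite big_nat_recr; last by lia.
by rewrite -xm /=; lia.
Qed.

(** The Weierstrass equation again.  No diagonal x = y divisible by 3 meets
    the classes 1 and -1, so one of the sums vanishes. *)
Lemma wp_sqr3 : 6 * (Ap 3 * Ap 3) = 24 * (Ap 3 * dilate 3 Sg)
  + 12 * dilate 3 (D Sg) + cd (cd (Ap 3)) - Ap 3.
Proof.
rewrite Aplus_sqr // lamb_cube.
have -> : lamb (fun d x => \sum_(1 <= a < d)
    usym E E' 3 a x * (3 %| x)%N%:R *+ (d * (d - a))) = 0.
  apply: fpsP => n; rewrite /=; case: eqVneq => // n0.
  rewrite big_seq big1 // => d; rewrite -dvdn_divisors ?lt0n // => dn.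
  have x0 : (0 < n %/ d)%N.
    by rewrite divn_gt0 ?(dvdn_gt0 _ dn) ?lt0n // dvdn_leq // lt0n.
  rewrite big1 // => a _; have [x3|] := boolP (3 %| n %/ d)%N; last first.
    by rewrite mulr0 mul0rn.
  rewrite /usym /upos /uneg.
  have -> : (3 %| (n %/ d).-1)%N = false by lia.
  have -> : (3 %| (n %/ d).+1)%N = false by lia.
  by rewrite addr0 mul0r mul0rn.
have -> : lamb (fun d x => (\sum_(1 <= y < x)
    ((3 %| y.-1) && (3 %| (x - y).+1))%N%:R) *+ (d * d)) = dilate 3 (D Sg) :> fps K.
  rewrite eulerD_lamb dilate_lamb //; apply: eq_lamb => d x _ x0.
  rewrite -natr_sum count3 //; case: (3 %| x)%N; last by rewrite mul0n mul0rn mulr0n.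
  by rewrite mul1n mulr1n -!mulrnA; congr (_ *+ _); nia.
ring.
Qed.

(** The heat equation for nome q^3, differentiated once in u, which removes
    the divisor sums free of E. *)
Lemma zeta_wp3 : 6 * (Am 3 * Ap 3) = 3 * cd (Ap 3) - 2 * D (Am 3) - Ap 3.
Proof.
have : cd (Am 3 * Am 3) = 2 * (Am 3 * Ap 3).
  by rewrite cderM // cder_Aminus; ring.
rewrite Aminus_sqr // => e.
transitivity (3 * (2 * (Am 3 * Ap 3))); first by ring.
rewrite -{}e.
have -> : lamb (fun d x => \sum_(1 <= a < d) usym E E' 3 a x * (3 %| x)%N%:R) = 0.
  apply: fpsP => n; rewrite /=; case: eqVneq => // n0.
  rewrite big_seq big1 // => d; rewrite -dvdn_divisors ?lt0n // => dn.
  have x0 : (0 < n %/ d)%N.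
    by rewrite divn_gt0 ?(dvdn_gt0 _ dn) ?lt0n // dvdn_leq // lt0n.
  rewrite big1 // => a _; have [x3|] := boolP (3 %| n %/ d)%N; last first.
    by rewrite mulr0.
  rewrite /usym /upos /uneg.
  have -> : (3 %| (n %/ d).-1)%N = false by lia.
  have -> : (3 %| (n %/ d).+1)%N = false by lia.
  by rewrite addr0 mul0r.
have -> : lamb (fun d x => \sum_(1 <= y < x) usym E E' 3 d y * (3 %| x - y)%N%:R) =
    lamb (fun d x => usym E E' 3 d x *+ (x %/ 3)%N).
  by apply: eq_lamb => d x _; apply: sum_usym3.
rewrite mulr0 addr0 mulNr raddfB raddfD raddfN /= !cderM // !cder_nat // !mul0r !add0r.
have -> : cd (lamb (fun d x => \sum_(1 <= y < x)
    ((3 %| y.-1) && (3 %| (x - y).+1))%N%:R)) = 0.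
  rewrite cder_lamb; apply: fpsP => n; rewrite /= fun_if big1 ?if_same // => d _.
  by rewrite -natr_sum raddfMn /= der1 // mul0rn.
rewrite mulr0 subr0 cder_Aplus !cder_lamb eulerD_lamb /Aplus.
rewrite !mulr_natl !(lambMn, lambN, lambD).
apply: eq_lamb => d x d0 x0; rewrite !raddfMn raddfD /= der_upos der_uneg /usym.
rewrite /upos /uneg.
case: (boolP (3 %| x.-1)%N) => x1.
  have -> : (3 %| x.+1)%N = false by lia.
  have [m ->] : exists m, x = (3 * m).+1 by exists (x %/ 3)%N; lia.
  have -> : ((3 * m).+1 %/ 3 = m)%N by lia.
  case: d d0 => // d _; rewrite !mulr1n !mulr0n mul0rn !oppr0 !addr0 /=.
  have -> : (d.+1 * (3 * m).+1 = 3 * m * d.+1 + d.+1)%N by nia.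
  have -> : (d.+1 * d.+1 = d.+1 * d + d.+1)%N by nia.
  ring.
case: (boolP (3 %| x.+1)%N) => x2; last by rewrite !mulr0n !mul0rn; ring.
have [m ->] : exists m, x = (3 * m).+2 by exists (x %/ 3)%N; lia.
have -> : ((3 * m).+2 %/ 3 = m)%N by lia.
case: d d0 => // d _; rewrite !mulr1n !mulr0n mul0rn !add0r /=.
ring.
Qed.

End Period3.

End Elliptic.

(** * The cubic theta functions as Lambert series *)

(** The quadratic character modulo 3; the predecessor makes it computable
    by divisibility alone. *)
Definition chi3 (n : nat) : int :=
  if (3 %| n)%N then 0 else if (3 %| n.-1)%N then 1 else -1.

Section CubicSeries.
Variable F : numFieldType.

(** The quasi-modular Eisenstein series of weight 2 and, with [E2'], its
    companion at 3 z. *)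
Definition E2 : fps F := 1 - 24 * sigma1 F.
Definition E2' : fps F := dilate 3 E2.
(** The cubic theta functions: [cub_a] is a, and [cub_B], [cub_C] are
    b^3 and c^3 / 27 in the usual notation. *)
Definition cub_a : fps F := 1 + 6 * lamb (fun d _ => (chi3 d)%:~R).
Definition eis_chi k : fps F := lamb (fun d _ => (chi3 d)%:~R * d%:R ^+ k).
Definition eis_chi' k : fps F := lamb (fun d x => (chi3 x)%:~R * d%:R ^+ k).
Definition cub_B : fps F := 1 - 9 * eis_chi 2.
Definition cub_C : fps F := eis_chi' 2.
Definition sigma3 : fps F := lamb (fun d _ => d%:R ^+ 3).

Local Notation D := (@eulerD F).
Local Notation Sg := (sigma1 F).
Local Notation a := cub_a.
Local Notation B := cub_B.
Local Notation C := cub_C.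
Local Notation e := E2.
Local Notation f := E2'.

Let tf : torsion_free (fps F) := torsion_free_fps (@torsion_free_num F).

(** ** The point of order 3 on the unit circle *)

Section Point1.
Variable w : F.
Hypothesis w3 : w ^+ 2 + w + 1 = 0.

Let s : F := w - w ^+ 2.

Let w2E : w ^+ 2 = - (w + 1).
Proof. by apply/eqP; rewrite -subr_eq0 opprK addrA w3. Qed.

Lemma sqrt_m3 : s * s = - 3.
Proof.
rewrite /s w2E opprK; have -> : (w + (w + 1)) * (w + (w + 1)) =
  4 * w ^+ 2 + 4 * w + 1 by ring.
by rewrite w2E; ring.
Qed.

Let w_cube : w ^+ 3 = 1.
Proof.
have : (w - 1) * (w ^+ 2 + w + 1) = 0 by rewrite w3 mulr0.
move=> /eqP; rewrite (_ : _ * _ = w ^+ 3 - 1) ?subr_eq0 => [/eqP //|]; ring.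
Qed.

Let wX m r : w ^+ (3 * m + r) = w ^+ r.
Proof. by rewrite exprD exprM w_cube expr1n mul1r. Qed.

Let w2X m r : (w ^+ 2) ^+ (3 * m + r) = (w ^+ 2) ^+ r.
Proof. by rewrite -!exprM mulnC mulnDl mulnAC -mulnA wX mulnC. Qed.

Let mod3 d : exists m, [\/ d = (3 * m + 0)%N, d = (3 * m + 1)%N | d = (3 * m + 2)%N].
Proof.
exists (d %/ 3)%N; have := divn_eq d 3; have : (d %% 3 < 3)%N by rewrite ltn_pmod.
by case: (d %% 3)%N => [|[|[|//]]] _ e;
  [constructor 1|constructor 2|constructor 3]; rewrite {1}e mulnC.
Qed.

(** The sums over the nontrivial cube roots of unity detect divisibility by 3
    and the character; all Lambert series at E = w become divisor sums through
    them. *)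
Lemma root3_sum d : w ^+ d + (w ^+ 2) ^+ d = -1 + 3 * (3 %| d)%N%:R.
Proof.
have [m [] ->] := mod3 d; rewrite wX w2X dvdn_addr ?dvdn_mulr //= ?expr0 ?expr1.
- by ring.
- by rewrite w2E; ring.
- have -> : (w ^+ 2) ^+ 2 = w ^+ 3 * w by rewrite -exprM -exprSr.
  by rewrite w_cube w2E; ring.
Qed.

Lemma root3_diff d : w ^+ d - (w ^+ 2) ^+ d = s * (chi3 d)%:~R.
Proof.
have [m [] ->] := mod3 d; rewrite wX w2X /chi3 dvdn_addr ?dvdn_mulr //= ?expr0 ?expr1.
- by ring.
- by rewrite addn1 /= dvdn_mulr // mulr1.
- have -> : (w ^+ 2) ^+ 2 = w ^+ 3 * w by rewrite -exprM -exprSr.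
  rewrite w_cube addnS /= dvdn_addr ?dvdn_mulr //= /s; ring.
Qed.

Variables (K : comNzRingType) (der : {additive K -> K}) (ev : {rmorphism K -> F}).
Hypothesis derM : forall x y, der (x * y) = der x * y + x * der y.
Variables (E E' I : K).
Hypotheses (EE' : E * E' = 1) (derE : der E = E) (I1 : I * (1 - E) = 1).
Hypotheses (evE : ev E = w).

Local Notation cd := (cder der).
Local Notation Ev := (fmap ev).
Local Notation Ap := (Aplus E E' 1).
Local Notation Am := (Aminus E E' 1).
Local Notation wp := (fconst (wp0 E I)).

Let eK : fps K := 1 - 24 * sigma1 K.
Let q0 : fps K := 12 * (wp + Ap) + eK.
Let Z : fps K := fconst (coth0 E I) + 2 * Am.
Let RK : fps K := eK ^+ 2 - 12 * eulerD eK.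

Let cd_eK : cd eK = 0.
Proof. by rewrite cderB cderM // (cder1 derM) (cder_nat derM) cder_sigma1 //; ring. Qed.

Let D_eK : eulerD eK = - 24 * eulerD (sigma1 K).
Proof. by rewrite eulerDB eulerD1 eulerDM eulerDn; ring. Qed.

Let cd_wp : cd wp = fconst (coth0 E I * wp0 E I).
Proof. by rewrite cder_const der_wp0. Qed.

Let cd2_wp : cd (cd wp) = 6 * wp ^+ 2 + wp.
Proof.
rewrite cd_wp cder_const derM der_coth0 // der_wp0 //.
have -> : 2 * wp0 E I * wp0 E I + coth0 E I * (coth0 E I * wp0 E I) =
  2 * wp0 E I ^+ 2 + coth0 E I ^+ 2 * wp0 E I by ring.
rewrite coth0_sqr //; ring.
Qed.

Let cd_q0 : cd q0 = 12 * (cd wp + cd Ap).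
Proof. by rewrite cderD cd_eK cderM // (cder_nat derM) cderD; ring. Qed.

(* The Weierstrass equation: q0 is twelve times the Weierstrass function, and RK
   is E_4 by Ramanujan's equation for E_2.  What matters is that RK does not
   depend on u. *)
Let weier : 2 * cd (cd q0) = q0 ^+ 2 - RK.
Proof.
rewrite cd_q0 cderM // (cder_nat derM) cderD cd2_wp.
have -> : cd (cd Ap) = 6 * (Ap * Ap) - (24 * (Ap * sigma1 K) - 12 * (wp * Ap)
    + 24 * (wp * sigma1 K) + 12 * eulerD (sigma1 K)) + Ap.
  by rewrite (wp_sqr1 derM EE' derE I1); ring.
rewrite /RK D_eK /q0 /eK; ring.
Qed.

Let cd_Z : 6 * cd Z = q0 - eK.
Proof.
rewrite cderD cderM // (cder_nat derM) cder_const der_coth0 // cder_Aminus //.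
rewrite /q0; ring.
Qed.

(* The heat equation, differentiated in u: Z is, up to sign, twice the
   logarithmic derivative of theta. *)
Let heat : 12 * eulerD Z = cd q0 - Z * (q0 - eK).
Proof.
have := congr1 cd (zeta_sqr1 EE' I1); rewrite -/Z expr2 cderM // [LHS](_ : _ = 2 * Z * cd Z);
  last by ring.
rewrite !cderB cderD !cderM // !(cder_nat derM) cder_heatH //.
rewrite cder_sigma1 // cder_const expr2 derM der_coth0 // => e.
rewrite -cd_Z eulerDD eulerDM eulerD_const eulerDn cd_q0 cd_wp.
have -> : Z * (6 * cd Z) = 3 * (2 * Z * cd Z) by ring.
rewrite e; ring.
Qed.

Hypothesis tfK : torsion_free K.

Let cd_RK : cd RK = 0.
Proof.
rewrite cderB expr2 !cderM // cd_eK (cder_nat derM) cder_eulerD cd_eK raddf0; ring.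
Qed.

Let q3 : cd (cd (cd q0)) = q0 * cd q0.
Proof.
apply: (natmul_inj (torsion_free_fps tfK) (isT : 0 < 2)%N) => /=.
have := congr1 cd weier; rewrite cderM // (cder_nat derM) mul0r add0r => ->.
rewrite cderB cd_RK expr2 cderM //; ring.
Qed.

Let cd_qe : cd (q0 - eK) = cd q0.
Proof. by rewrite [LHS](cderB der q0 eK) cd_eK subr0. Qed.

(* Differentiating in u once more gives the dependence on log q of the
   Weierstrass function and of its derivative. *)
Let heat1 : 12 * eulerD (q0 - eK) = 6 * cd (cd q0) - (q0 - eK) ^+ 2 - 6 * Z * cd q0.
Proof.
have := congr1 cd heat; rewrite cderM // (cder_nat derM) cder_eulerD mul0r add0r.
rewrite cderB cderM // cd_qe => e.
have -> : eulerD (q0 - eK) = 6 * eulerD (cd Z) by rewrite -cd_Z eulerDM eulerDn; ring.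
rewrite mulrCA {}e -cd_Z; ring.
Qed.

Let heat2 : 12 * eulerD (cd q0) = 3 * (q0 + eK) * cd q0 - 6 * Z * cd (cd q0).
Proof.
have := congr1 cd heat1; rewrite expr2 cderM // (cder_nat derM) cder_eulerD mul0r add0r.
rewrite cd_qe 2!cderB => ->; rewrite !cderM // !(cder_nat derM) cd_qe q3.
transitivity (6 * (q0 * cd q0) - 2 * (q0 - eK) * cd q0 - 6 * cd Z * cd q0
  - 6 * Z * cd (cd q0)); first by ring.
rewrite cd_Z; ring.
Qed.

(** ** Evaluation *)

Let S0 : fps F := fconst s.

Let S0S0 : S0 * S0 = - 3.
Proof. by rewrite -rmorphM sqrt_m3 rmorphN rmorph_nat. Qed.

Let S0_inj : injective ( *%R S0).
Proof.
move=> x y xy; apply: (natmul_inj tf (isT : 0 < 3)%N) => /=.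
by apply: oppr_inj; rewrite -!mulNr -S0S0 -!mulrA xy.
Qed.

Let evE' : ev E' = w ^+ 2.
Proof.
have : w ^+ 2 * ev (E * E') = w ^+ 2 by rewrite EE' rmorph1 mulr1.
by rewrite rmorphM evE mulrA -exprSr w_cube mul1r.
Qed.

Let w_sqr1 : (1 - w) ^+ 2 = - 3 * w.
Proof.
have -> : (1 - w) ^+ 2 = w ^+ 2 - 2 * w + 1 by ring.
by rewrite w2E; ring.
Qed.

Let evI : ev I * (1 - w) = 1.
Proof. by have := congr1 ev I1; rewrite rmorphM rmorphB rmorph1 evE. Qed.

Let ev_coth0 : 3 * ev (coth0 E I) = s.
Proof.
rewrite rmorphM rmorphD rmorph1 evE.
transitivity (s * (ev I * (1 - w))); last by rewrite evI mulr1.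
have -> : s * (ev I * (1 - w)) = w * (1 - w) ^+ 2 * ev I by rewrite /s; ring.
rewrite w_sqr1; have -> : w * (- 3 * w) = - 3 * w ^+ 2 by ring.
by rewrite w2E; ring.
Qed.

Let ev_wp0 : 3 * ev (wp0 E I) = -1.
Proof.
rewrite rmorphM rmorphXn evE.
transitivity (- (ev I * (1 - w)) ^+ 2); last by rewrite evI expr1n.
rewrite exprMn w_sqr1; ring.
Qed.

Let E2'E : f = 1 - 24 * dilate 3 Sg.
Proof. by rewrite /E2' /E2 raddfB /= -/(dilate 3 1) dilateM // dilate_nat // (dilate_nat _ 1). Qed.

Let lamb_div3 k : lamb (fun d _ => (3 %| d)%N%:R * d%:R ^+ k) =
  3 ^+ k * dilate 3 (lamb (fun d _ => d%:R ^+ k)) :> fps F.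
Proof.
rewrite lambC [lamb (fun d _ => d%:R ^+ k)]lambC dilate_lamb //.
rewrite -natrX mulr_natl lambMn; apply: eq_lamb => d x _ _.
case: (boolP (3 %| x)%N) => [/dvdnP[y ->]|]; last by rewrite mul0r mulr0n mul0rn.
by rewrite mulnK // natrM exprMn !mulr1n mul1r -[RHS]mulr_natr natrX.
Qed.

Let ev_upos a0 x : ev (upos E 1 a0 x) = w ^+ a0.
Proof. by rewrite /upos dvd1n mulr1n rmorphXn /= evE. Qed.

Let ev_uneg a0 x : ev (uneg E' 1 a0 x) = (w ^+ 2) ^+ a0.
Proof. by rewrite /uneg dvd1n mulr1n rmorphXn /= evE'. Qed.

Let Ev_even k : Ev (lamb (fun d x => usym E E' 1 d x *+ d ^ k)) =
  - lamb (fun d _ => d%:R ^+ k) + 3 ^+ k.+1 * dilate 3 (lamb (fun d _ => d%:R ^+ k)).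
Proof.
rewrite exprS -mulrA -lamb_div3 -[3]/(3%:R) mulr_natl lambMn lambN lambD fmap_lamb.
apply: eq_lamb => d x _ _.
by rewrite rmorphMn rmorphD /= ev_upos ev_uneg root3_sum -[LHS]mulr_natr natrX; ring.
Qed.

Let Ev_odd k : Ev (lamb (fun d x => (upos E 1 d x - uneg E' 1 d x) *+ d ^ k)) =
  S0 * eis_chi k.
Proof.
rewrite lambZ fmap_lamb; apply: eq_lamb => d x _ _.
by rewrite rmorphMn rmorphB /= ev_upos ev_uneg root3_diff -[LHS]mulr_natr natrX mulrA.
Qed.

Let sigma1E : Sg = lamb (fun d _ => d%:R ^+ 1).
Proof. by apply: eq_lamb => d x _ _; rewrite expr1. Qed.

Let Ev_Ap : Ev Ap = - Sg + 9 * dilate 3 Sg.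
Proof.
have -> : Ap = lamb (fun d x => usym E E' 1 d x *+ d ^ 1).
  by apply: eq_lamb => d x _ _; rewrite expn1.
by rewrite Ev_even sigma1E; congr (_ + _ * _); ring.
Qed.

Let Ev_Z : 3 * Ev Z = S0 * a.
Proof.
have AmE : Am = lamb (fun d x => (upos E 1 d x - uneg E' 1 d x) *+ d ^ 0).
  by apply: eq_lamb => d x _ _; rewrite expn0.
rewrite /Z AmE fmapD fmapM fmap_nat Ev_odd fmap_const /cub_a.
have -> : eis_chi 0 = lamb (fun d _ => (chi3 d)%:~R) :> fps F.
  by apply: eq_lamb => d x _ _; rewrite expr0 mulr1.
by rewrite /S0 -ev_coth0; ring.
Qed.

Let Ev_heatH : Ev (heatH E E') = - Sg + 3 * dilate 3 Sg.
Proof.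
rewrite fmap_lamb dilate_lamb // mulr_natl lambMn lambN lambD lambC.
apply: eq_lamb => x d _ _; rewrite rmorphMn rmorphD !rmorphXn evE evE' root3_sum.
rewrite -[LHS]mulr_natr; case: (boolP (3 %| d)%N) => _; rewrite ?mulr1n ?mulr0n; ring.
Qed.

Let Ev_sigma1 : Ev (sigma1 K) = Sg.
Proof. by rewrite fmap_lamb; apply: eq_lamb => d x _ _; rewrite rmorph_nat. Qed.

Let Ev_eK : Ev eK = e.
Proof. by rewrite fmapB fmapM fmap1 fmap_nat Ev_sigma1. Qed.

(** The heat equation at w: Z becomes sqrt(-3) a / 3, and the remaining
    series are combinations of E_2(z) and E_2(3z). *)
Lemma cub_a_sqr : 2 * a ^+ 2 = 3 * f - e.
Proof.
apply: (natmul_inj tf (isT : 0 < 3)%N) => /=.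
have : 9 * Ev Z ^+ 2 = S0 * S0 * a ^+ 2.
  transitivity ((3 * Ev Z) ^+ 2); first by ring.
  by rewrite Ev_Z; ring.
rewrite S0S0 -fmapX zeta_sqr1 // fmapB fmapB fmapD !fmapM !fmap_nat.
rewrite Ev_Ap Ev_heatH Ev_sigma1 fmap_const rmorphXn => e1.
have e2 : 9 * fconst (ev (coth0 E I) ^+ 2) = - 3 :> fps F.
  by rewrite -S0S0 /S0 -ev_coth0; ring.
have -> : 3 * (2 * a ^+ 2) = - 2 * (-3 * a ^+ 2) by ring.
rewrite -e1 E2'E /E2 !mulrBr mulrDr e2; ring.
Qed.

Let Q0 : Ev q0 = - 3 * a ^+ 2.
Proof.
apply: (natmul_inj tf (isT : 0 < 2)%N) => /=.
have -> : 2 * (- 3 * a ^+ 2) = - 3 * (2 * a ^+ 2) by ring.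
rewrite cub_a_sqr E2'E /E2 fmapD fmapM fmapD fmap_nat fmap_const Ev_eK Ev_Ap.
have e2 : 12 * fconst (ev (wp0 E I)) = - 4 :> fps F.
  have -> : 12 * fconst (ev (wp0 E I)) = 4 * fconst (3 * ev (wp0 E I)) :> fps F by ring.
  by rewrite ev_wp0 rmorphN rmorph1; ring.
transitivity (2 * (12 * fconst (ev (wp0 E I)))
    + (24 * (- Sg + 9 * dilate 3 Sg) + 2 * (1 - 24 * Sg))); first by rewrite /E2; ring.
by rewrite e2; ring.
Qed.

Let ev_der_wp0 : 9 * ev (coth0 E I * wp0 E I) = - s.
Proof.
by rewrite rmorphM -ev_coth0 -[RHS]mulr1 mulNr -mulrN -ev_wp0; ring.
Qed.

Let Ev_qe : Ev (q0 - eK) = - 3 * a ^+ 2 - e.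
Proof. by transitivity (Ev q0 - Ev eK); [exact: fmapB|rewrite Q0 Ev_eK]. Qed.

Let Ev_qe' : Ev (q0 + eK) = - 3 * a ^+ 2 + e.
Proof. by transitivity (Ev q0 + Ev eK); [exact: fmapD|rewrite Q0 Ev_eK]. Qed.

Let Q1 : 3 * Ev (cd q0) = - 4 * S0 * B.
Proof.
rewrite cd_q0 cder_Aplus // cd_wp.
have -> : lamb (fun d x => (upos E 1 d x - uneg E' 1 d x) *+ (d * d)) =
    lamb (fun d x => (upos E 1 d x - uneg E' 1 d x) *+ d ^ 2).
  by apply: eq_lamb => d x _ _; rewrite expnS expn1.
rewrite fmapM fmapD fmap_nat Ev_odd fmap_const /cub_B.
have -> : - 4 * S0 = 4 * fconst (- s) by rewrite rmorphN; ring.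
have -> : 3 * (12 * (fconst (ev (coth0 E I * wp0 E I)) + S0 * eis_chi 2)) =
  4 * fconst (9 * ev (coth0 E I * wp0 E I)) + 36 * (S0 * eis_chi 2) by ring.
rewrite ev_der_wp0 rmorphN -/S0; ring.
Qed.

(** The equations [heat], [heat1] and [heat2], evaluated at w, are a system of
    Ramanujan type for a, E_2 and B. *)
Lemma eulerD_cub_a : 12 * D a = 3 * a ^+ 3 + a * e - 4 * B.
Proof.
apply: S0_inj => /=.
have := congr1 (fun h => 3 * Ev h) heat.
rewrite fmapM fmapB fmapM fmapB fmap_nat fmap_eulerD Q0 Ev_eK => e1.
have -> : S0 * (12 * D a) = 12 * D (S0 * a) by rewrite eulerDM eulerD_const; ring.
rewrite -Ev_Z eulerDM eulerDn.
transitivity (3 * (12 * D (Ev Z))); first by ring.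
rewrite {}e1 mulrBr Q1.
have -> : 3 * (Ev Z * (-3 * a ^+ 2 - e)) = 3 * Ev Z * (-3 * a ^+ 2 - e) by ring.
rewrite Ev_Z; ring.
Qed.

Lemma eulerD_E2 : 12 * D e = e ^+ 2 - (9 * a ^+ 4 - 8 * (a * B)).
Proof.
have RE : Ev RK = e ^+ 2 - 12 * D e.
  by rewrite fmapB fmapX fmapM fmap_nat fmap_eulerD Ev_eK.
have := congr1 Ev weier; rewrite fmapM fmapB fmapX fmap_nat Q0 RE => e1.
have := congr1 Ev heat1.
rewrite fmapM fmap_nat fmap_eulerD [RHS]fmapB [X in _ = X - _]fmapB fmapX !fmapM !fmap_nat Ev_qe.
move=> e2; apply: (natmul_inj tf (isT : 0 < 12)%N) => /=.
transitivity (3 * (12 * D e + 3 * (12 * D e))); first by ring.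
have {1}-> : 12 * D e = - 6 * a * (12 * D a) - 12 * D (- 3 * a ^+ 2 - e).
  have -> : D (- 3 * a ^+ 2 - e) = D (- 3 * a ^+ 2) - D e by exact: eulerDB.
  by rewrite expr2 !eulerDM raddfN /= eulerDn; ring.
have -> : 12 * D e = 2 * Ev (cd (cd q0)) - 9 * a ^+ 4 + e ^+ 2 by rewrite e1; ring.
rewrite e2 eulerD_cub_a.
transitivity (- 18 * a * (3 * a ^+ 3 + a * e - 4 * B) + 3 * (3 * a ^+ 2 + e) ^+ 2
  - 81 * a ^+ 4 + 9 * e ^+ 2 + 2 * ((3 * Ev Z) * (3 * Ev (cd q0)))); first by ring.
rewrite Ev_Z Q1; have -> : S0 * a * (-4 * S0 * B) = - 4 * (S0 * S0) * (a * B) by ring.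
rewrite S0S0; ring.
Qed.

Let Q2 : Ev (cd (cd q0)) = 4 * (a * B).
Proof.
have RE : Ev RK = e ^+ 2 - 12 * D e.
  by rewrite fmapB fmapX fmapM fmap_nat fmap_eulerD Ev_eK.
apply: (natmul_inj tf (isT : 0 < 2)%N) => /=.
have := congr1 Ev weier; rewrite fmapM fmapB fmapX fmap_nat Q0 RE => ->.
rewrite eulerD_E2; ring.
Qed.

Lemma eulerD_cub_B : 4 * D B = B * (e - a ^+ 2).
Proof.
apply: S0_inj => /=; apply: (natmul_inj tf (isT : 0 < 12)%N) => /=.
have := congr1 (fun h => 3 * Ev h) heat2.
rewrite fmapM fmap_nat fmap_eulerD [in RHS]fmapB !fmapM !fmap_nat Ev_qe'.
rewrite Q2 => e1.
transitivity (- (3 * (12 * D (Ev (cd q0))))).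
  have -> : 3 * (12 * D (Ev (cd q0))) = 12 * D (3 * Ev (cd q0)).
    by rewrite eulerDM eulerDn; ring.
  by rewrite Q1 !eulerDM raddfN /= eulerDn /S0 eulerD_const; ring.
rewrite e1.
transitivity (- 3 * (- 3 * a ^+ 2 + e) * (3 * Ev (cd q0))
    + 24 * (3 * Ev Z) * (a * B)); first by ring.
rewrite Q1 Ev_Z; ring.
Qed.

(** Derivatives of odd order at w carry the odd part w^d - w^(-d), a multiple
    of the character; the derivatives of even order carry plain divisor sums. *)
Let Qodd k : odd k -> exists c,
  Ev (iter k cd q0) = fconst c + 12 * (S0 * eis_chi k.+1).
Proof.
case: k => // k ok.
have -> : iter k.+1 cd q0 = 12 * (iter k.+1 cd wp + iter k.+1 cd Ap).
  elim: k {ok} => [|k IH]; first exact: cd_q0.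
  by rewrite iterS IH cderM // (cder_nat derM) mul0r add0r cderD.
have -> : iter k.+1 cd wp = fconst (iter k.+1 der (wp0 E I)).
  by elim: k {ok} => [|k IH]; rewrite iterS ?IH cder_const.
rewrite cder_iter_Aplus //.
have -> : lamb (fun d x => (upos E 1 d x + (-1) ^+ k.+1 * uneg E' 1 d x) *+ d ^ k.+2) =
    lamb (fun d x => (upos E 1 d x - uneg E' 1 d x) *+ d ^ k.+2).
  by apply: eq_lamb => d x _ _; rewrite -signr_odd ok expr1 mulN1r.
rewrite fmapM fmapD fmap_nat fmap_const Ev_odd.
exists (12 * ev (iter k.+1 der (wp0 E I))); rewrite rmorphM rmorph_nat; ring.
Qed.

Let Q1_sqr : 3 * Ev (cd q0) ^+ 2 = - 16 * B ^+ 2.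
Proof.
apply: (natmul_inj tf (isT : 0 < 3)%N) => /=.
transitivity ((3 * Ev (cd q0)) ^+ 2); first by ring.
rewrite Q1; have -> : (-4 * S0 * B) ^+ 2 = 16 * (S0 * S0) * B ^+ 2 by ring.
rewrite S0S0; ring.
Qed.

(* Passing from a multiple of S0 to the Eisenstein series itself. *)
Let from_S0 m M k c G : (0 < m)%N -> M = (3 * m)%N ->
    m%:R * (fconst c + 12 * (S0 * eis_chi k)) = - 4 * S0 * G ->
  exists c', M%:R * eis_chi k = fconst c' - G.
Proof.
move=> m0 -> e1; exists (s * c * m%:R / 12).
apply: (natmul_inj tf (isT : 0 < 12)%N) => /=.
have c12 : 12 * fconst (s * c * m%:R / 12) = S0 * (m%:R * fconst c) :> fps F.
  rewrite /S0 -!(rmorph_nat (@fconst F)) -!rmorphM; congr fconst.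
  by rewrite mulrCA divff ?pnatr_eq0 // mulr1; ring.
have e2 : S0 * (m%:R * (fconst c + 12 * (S0 * eis_chi k))) =
    S0 * (m%:R * fconst c) + 12 * (S0 * S0) * m%:R * eis_chi k by ring.
have e3 : S0 * (-4 * S0 * G) = - 4 * (S0 * S0) * G by ring.
rewrite mulrBr c12; move: (congr1 ( *%R S0) e1); rewrite /= e2 e3 S0S0.
move=> /(canRL (addrK _)) ->; rewrite natrM; ring.
Qed.

(** The derivative of order 5 of the Weierstrass function at w, as a Lambert
    series and through [taylor5]; orders 7 and 9 give the next two lemmas.  The
    constant c comes from the terms free of q. *)
Lemma eis_chi6 : exists c,
  9 * eis_chi 6 = fconst c - (12 * a * B ^+ 2 + 9 * a ^+ 4 * B).
Proof.
have [c ec] := Qodd (isT : odd 5).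
apply: (@from_S0 3 9 6 c) => //; rewrite -ec (taylor5 derM q3).
have -> x y z : Ev (3 * y * z + x ^+ 2 * y) = 3 * Ev y * Ev z + Ev x ^+ 2 * Ev y.
  by ring.
rewrite Q0 Q2.
transitivity ((12 * a * B + 9 * a ^+ 4) * (3 * Ev (cd q0))); first by ring.
rewrite Q1; ring.
Qed.

Lemma eis_chi8 : exists c, 27 * eis_chi 8 =
  fconst c + (80 * B ^+ 3 + 648 * a ^+ 3 * B ^+ 2 + 81 * a ^+ 6 * B).
Proof.
have [c ec] := Qodd (isT : odd 7).
have [|c' ec'] := @from_S0 9 27 8 c
    (- (80 * B ^+ 3 + 648 * a ^+ 3 * B ^+ 2 + 81 * a ^+ 6 * B)) isT erefl.
  rewrite -ec (taylor7 derM q3).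
  have -> x y z : Ev (5 * y ^+ 3 + 18 * x * y * z + x ^+ 3 * y) =
    5 * Ev y ^+ 3 + 18 * Ev x * Ev y * Ev z + Ev x ^+ 3 * Ev y by ring.
  rewrite Q0 Q2.
  transitivity (3 * Ev (cd q0) * (5 * (3 * Ev (cd q0) ^+ 2)
    - 648 * a ^+ 3 * B - 81 * a ^+ 6)); first by ring.
  rewrite Q1_sqr Q1; ring.
by exists c'; apply: etrans ec' _; rewrite opprK.
Qed.

Lemma eis_chi10 : exists c, 9 * eis_chi 10 = fconst c
  - (2544 * a ^+ 2 * B ^+ 3 + 2916 * a ^+ 5 * B ^+ 2 + 81 * a ^+ 8 * B).
Proof.
have [c ec] := Qodd (isT : odd 9).
apply: (@from_S0 3 9 10 c) => //; rewrite -ec (taylor9 derM q3).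
have -> x y z : Ev (84 * y * z ^+ 2 + 75 * x * y ^+ 3 + 81 * x ^+ 2 * y * z + x ^+ 4 * y) =
  84 * Ev y * Ev z ^+ 2 + 75 * Ev x * Ev y ^+ 3 + 81 * Ev x ^+ 2 * Ev y * Ev z
  + Ev x ^+ 4 * Ev y by ring.
rewrite Q0 Q2.
transitivity (3 * Ev (cd q0) * (1344 * a ^+ 2 * B ^+ 2
   - 75 * a ^+ 2 * (3 * Ev (cd q0) ^+ 2) + 2916 * a ^+ 5 * B + 81 * a ^+ 8));
  first by ring.
rewrite Q1_sqr Q1; ring.
Qed.

(** The second derivative at w, on the one hand a B by the Weierstrass
    equation, on the other hand a sum of cubes over the divisors. *)
Lemma sigma3_1 : exists c,
  3 * (- sigma3 + 81 * dilate 3 sigma3) = fconst c + a * B.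
Proof.
exists (- (3 * ev (der (coth0 E I * wp0 E I)))).
apply: (natmul_inj tf (isT : 0 < 4)%N) => /=.
have -> : 4 * (fconst (- (3 * ev (der (coth0 E I * wp0 E I)))) + a * B) =
   4 * (a * B) - 12 * fconst (ev (der (coth0 E I * wp0 E I))).
  by rewrite rmorphN rmorphM rmorph_nat; ring.
rewrite -Q2 cd_q0 cderM // (cder_nat derM) cderD cd_wp cder_const cder2_Aplus //.
rewrite mul0r add0r fmapM fmap_nat fmapD fmap_const Ev_even /sigma3; ring.
Qed.

End Point1.
End CubicSeries.

Section Exponential.
Variable F : numFieldType.

(** From here on the coefficients are power series in u, the derivation is
    d/du and the evaluation is at u = 0. *)
Definition fps_at0 (f : fps F) : F := f 0%N.

Fact fps_at0_additive : zmod_morphism fps_at0. Proof. by []. Qed.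
Fact fps_at0_monoid : monoid_morphism fps_at0.
Proof. by split=> [|f g]; rewrite /fps_at0 ?fpsME0. Qed.
HB.instance Definition _ :=
  GRing.isZmodMorphism.Build (fps F) F fps_at0 fps_at0_additive.
HB.instance Definition _ :=
  GRing.isMonoidMorphism.Build (fps F) F fps_at0 fps_at0_monoid.

Definition fexp (c : F) : fps F := Fps (fun n => c ^+ n / n`!%:R).

Lemma fderiv_fexp c : fderiv (fexp c) = fconst c * fexp c.
Proof.
apply: fpsP => n; rewrite fconstM /= factS natrM exprS -[LHS]mulr_natr.
have f0 : n`!%:R != 0 :> F by rewrite pnatr_eq0 -lt0n fact_gt0.
have n0 : n.+1%:R != 0 :> F by rewrite pnatr_eq0.
rewrite invfM -!mulrA; congr (_ * (_ * _)).
by rewrite mulrCA mulVf // mulr1.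
Qed.

Lemma fexpN : fexp 1 * fexp (-1) = 1.
Proof.
apply: (@ode_uniq _ (@torsion_free_num F) _ _ 0 0).
- rewrite mulr0 -fX1_fderiv fderivM !fderiv_fexp rmorphN rmorph1; ring.
- by rewrite mulr0 eulerD1.
- by [].
- by rewrite fpsME0 /= !expr0 fact0 divr1 mulr1.
Qed.
End Exponential.

Section CubicRelations.
Variables (F : numFieldType) (w : F).
Hypothesis w3 : w ^+ 2 + w + 1 = 0.

Local Notation K := (fps F).
Local Notation D := (@eulerD F).
Local Notation Sg := (sigma1 F).
Local Notation a := (cub_a F).
Local Notation B := (cub_B F).
Local Notation C := (cub_C F).
Local Notation e := (E2 F).
Local Notation f := (E2' F).

Let tf : torsion_free (fps F) := torsion_free_fps (@torsion_free_num F).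

Let w_cube : w * w ^+ 2 = 1.
Proof.
have : (w - 1) * (w ^+ 2 + w + 1) = 0 by rewrite w3 mulr0.
move=> /eqP; rewrite (_ : _ * _ = w * w ^+ 2 - 1) ?subr_eq0 => [/eqP //|]; ring.
Qed.

Let E : K := fconst w * fexp 1.
Let E' : K := fconst (w ^+ 2) * fexp (-1).

Let EE' : E * E' = 1.
Proof.
have -> : E * E' = fconst w * fconst (w ^+ 2) * (fexp 1 * fexp (-1)).
  by rewrite /E /E'; ring.
by rewrite -rmorphM w_cube fexpN rmorph1 mulr1.
Qed.

Let derE : fderiv E = E.
Proof.
rewrite /E fderivM fderiv_fexp rmorph1 mul1r.
have -> : fderiv (fconst w) = 0 by apply: fpsP => n /=; rewrite mul0rn.
by rewrite mul0r add0r.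
Qed.

Let evE : fps_at0 E = w.
Proof. by rewrite /fps_at0 fpsME0 /= expr0 fact0 divr1 mulr1 mulr1n. Qed.

Let exI : exists I, I * (1 - E) = 1.
Proof.
have w1 : 1 - w != 0.
  rewrite subr_eq0; apply/eqP => w1; move/eqP: w3; rewrite -w1 expr1n.
  by rewrite -[1 in X in X == _]/(1%:R) -!natrD pnatr_eq0.
have e0 : (1 - E) 0%N = 1 - w by rewrite fpsBE; congr (_ - _); apply: evE.
have [|g eg] := @fps_inv _ (1 - E) (1 - w)^-1; first by rewrite e0 mulVf.
by exists g; rewrite mulrC.
Qed.

Let I : K := projT1 (cid exI).

Let I1 : I * (1 - E) = 1 := projT2 (cid exI).

Let derM := @fderivM F.

(** The identities of the preceding part, for E = w e^u. *)
Lemma cub_aE : 2 * a ^+ 2 = 3 * f - e.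
Proof. exact: (cub_a_sqr w3 EE' I1 evE). Qed.

Lemma D_cub_a : 12 * D a = 3 * a ^+ 3 + a * e - 4 * B.
Proof. exact: (eulerD_cub_a w3 derM EE' derE I1 evE). Qed.

Lemma D_E2 : 12 * D e = e ^+ 2 - (9 * a ^+ 4 - 8 * (a * B)).
Proof. exact: (eulerD_E2 w3 derM EE' derE I1 evE). Qed.

Lemma D_cub_B : 4 * D B = B * (e - a ^+ 2).
Proof. exact: (eulerD_cub_B w3 derM EE' derE I1 evE (@torsion_free_fps _ (@torsion_free_num F))). Qed.

Lemma eis_chi6E : exists c,
  9 * eis_chi F 6 = fconst c - (12 * a * B ^+ 2 + 9 * a ^+ 4 * B).
Proof. exact: (eis_chi6 w3 derM EE' derE I1 evE (@torsion_free_fps _ (@torsion_free_num F))). Qed.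

Lemma eis_chi8E : exists c, 27 * eis_chi F 8 =
  fconst c + (80 * B ^+ 3 + 648 * a ^+ 3 * B ^+ 2 + 81 * a ^+ 6 * B).
Proof. exact: (eis_chi8 w3 derM EE' derE I1 evE (@torsion_free_fps _ (@torsion_free_num F))). Qed.

Lemma eis_chi10E : exists c, 9 * eis_chi F 10 = fconst c
  - (2544 * a ^+ 2 * B ^+ 3 + 2916 * a ^+ 5 * B ^+ 2 + 81 * a ^+ 8 * B).
Proof. exact: (eis_chi10 w3 derM EE' derE I1 evE (@torsion_free_fps _ (@torsion_free_num F))). Qed.

Lemma sigma3_1E : exists c,
  3 * (- sigma3 F + 81 * dilate 3 (sigma3 F)) = fconst c + a * B.
Proof. exact: (sigma3_1 w3 derM EE' derE I1 evE). Qed.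

(** ** The point of order 3 off the unit circle *)

Local Notation E1 := (fexp (1 : F)).
Local Notation E1' := (fexp (-1 : F)).

Let EE1 : E1 * E1' = 1 := fexpN F.

Let derE1 : fderiv E1 = E1.
Proof. by rewrite fderiv_fexp rmorph1 mul1r. Qed.

Local Notation cd := (cder (@fderiv F)).
Local Notation Ev := (fmap (@fps_at0 F)).
Local Notation Ap := (Aplus E1 E1' 3).
Local Notation Am := (Aminus E1 E1' 3).

Let fK : fps K := 1 - 24 * dilate 3 (sigma1 K).
Let q0 : fps K := 12 * Ap + fK.
Let RK : fps K := fK ^+ 2 + 288 * dilate 3 (eulerD (sigma1 K)).

Let cd_fK : cd fK = 0.
Proof.
rewrite cderB cderM // (cder1 derM) (cder_nat derM) cder_dilate (cder_sigma1 derM) raddf0; ring.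
Qed.

Let cd_q0 : cd q0 = 12 * cd Ap.
Proof. by rewrite cderD cd_fK cderM // (cder_nat derM); ring. Qed.

Let weier : 2 * cd (cd q0) = q0 ^+ 2 - RK.
Proof.
rewrite cd_q0 cderM // (cder_nat derM).
have -> : cd (cd Ap) = 6 * (Ap * Ap) - (24 * (Ap * dilate 3 (sigma1 K))
    + 12 * dilate 3 (eulerD (sigma1 K))) + Ap.
  by rewrite (wp_sqr3 derM EE1 derE1); ring.
rewrite /RK /q0 /fK; ring.
Qed.

Let cd_RK : cd RK = 0.
Proof.
rewrite cderD expr2 !cderM // cd_fK (cder_nat derM) cder_dilate cder_eulerD.
rewrite (cder_sigma1 derM) !raddf0; ring.
Qed.

Let q3 : cd (cd (cd q0)) = q0 * cd q0.
Proof.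
apply: (natmul_inj (torsion_free_fps tf) (isT : 0 < 2)%N) => /=.
have := congr1 cd weier; rewrite cderM // (cder_nat derM) mul0r add0r => ->.
rewrite cderB cd_RK expr2 cderM //; ring.
Qed.

Let ev_E1 c n : fps_at0 (fexp c ^+ n) = 1 :> F.
Proof. by rewrite /fps_at0 fpsXE0 /= expr0 fact0 divr1 expr1n. Qed.

Let ev_upos d x : fps_at0 (upos E1 3 d x) = (3 %| x.-1)%N%:R.
Proof. by rewrite raddfMn /= ev_E1. Qed.

Let ev_uneg d x : fps_at0 (uneg E1' 3 d x) = (3 %| x.+1)%N%:R.
Proof. by rewrite raddfMn /= ev_E1. Qed.

Let chi3E x : (0 < x)%N -> (3 %| x.-1)%N%:R - (3 %| x.+1)%N%:R = (chi3 x)%:~R :> F.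
Proof.
case: x => // x _; rewrite /chi3 /=; case: (boolP (3 %| x)%N) => x0.
  have -> : (3 %| x.+2)%N = false by lia.
  have -> : (3 %| x.+1)%N = false by lia.
  by rewrite subr0.
case: (boolP (3 %| x.+1)%N) => x1.
  have -> : (3 %| x.+2)%N = false by lia.
  by rewrite subrr.
have -> : (3 %| x.+2)%N = true by lia.
by rewrite sub0r.
Qed.

Let Ev_odd k : Ev (lamb (fun d x => (upos E1 3 d x - uneg E1' 3 d x) *+ d ^ k)) =
  eis_chi' F k.
Proof.
rewrite fmap_lamb; apply: eq_lamb => d x _ x0.
by rewrite raddfMn raddfB /= ev_upos ev_uneg chi3E // -[LHS]mulr_natr natrX.
Qed.

Let Ev_even k : Ev (lamb (fun d x => usym E1 E1' 3 d x *+ d ^ k)) =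
  lamb (fun d _ => d%:R ^+ k) - dilate 3 (lamb (fun d _ => d%:R ^+ k)).
Proof.
rewrite fmap_lamb dilate_lamb // lambN lambD; apply: eq_lamb => d x _ x0.
rewrite raddfMn raddfD /= ev_upos ev_uneg -[LHS]mulr_natr natrX.
have -> : (3 %| x.-1)%N%:R + (3 %| x.+1)%N%:R = 1 - (3 %| x)%N%:R :> F.
  case: x x0 => // x _ /=; case: (boolP (3 %| x)%N) => x3.
    have -> : (3 %| x.+2)%N = false by lia.
    have -> : (3 %| x.+1)%N = false by lia.
    by rewrite addr0 subr0.
  case: (boolP (3 %| x.+1)%N) => x1.
    have -> : (3 %| x.+2)%N = false by lia.
    by rewrite addr0 subrr.
  have -> : (3 %| x.+2)%N = true by lia.
  by rewrite add0r subr0.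
by case: (3 %| x)%N; rewrite ?mulr1n ?mulr0n; ring.
Qed.

Let Ev_Ap : Ev Ap = Sg - dilate 3 Sg.
Proof.
have -> : Sg = lamb (fun d _ => d%:R ^+ 1).
  by apply: eq_lamb => d x _ _; rewrite expr1.
rewrite -Ev_even; congr Ev; apply: eq_lamb => d x _ _; by rewrite expn1.
Qed.

Let Ev_Am : 6 * Ev Am = a - 1.
Proof.
have -> : Am = lamb (fun d x => (upos E1 3 d x - uneg E1' 3 d x) *+ d ^ 0).
  by apply: eq_lamb => d x _ _; rewrite expn0.
rewrite Ev_odd /cub_a addrC addKr; congr (_ * _); rewrite [RHS]lambC.
by apply: eq_lamb => d x _ _; rewrite expr0 mulr1.
Qed.

Let E2'E : f = 1 - 24 * dilate 3 Sg.
Proof. by rewrite /E2' /E2 raddfB /= dilateM // dilate_nat // (dilate_nat _ 1). Qed.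

Let Q1 : Ev (cd q0) = 12 * C.
Proof.
rewrite cd_q0 (cder_Aplus derM EE1 derE1) fmapM fmap_nat; congr (_ * _).
by rewrite /cub_C -Ev_odd; congr Ev; apply: eq_lamb.
Qed.

Let Ev_cd_Ap : Ev (cd Ap) = C.
Proof.
by rewrite (cder_Aplus derM EE1 derE1) /cub_C -Ev_odd; congr Ev; apply: eq_lamb.
Qed.

(** The relation a^3 = B + 27 C comes from [zeta_wp3] at u = 0, compared with
    the derivative of a found at the point w: the two curves share a. *)
Lemma cub_CE : 27 * C = a ^+ 3 - B.
Proof.
have := congr1 Ev (zeta_wp3 derM EE1 derE1).
have -> x y z : Ev (3 * x - 2 * y - z) = 3 * Ev x - 2 * Ev y - Ev z by ring.
have -> x y : Ev (6 * (x * y)) = 6 * Ev x * Ev y by ring.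
rewrite fmap_eulerD Ev_cd_Ap Ev_Am Ev_Ap => e1.
apply: (natmul_inj tf (isT : 0 < 8)%N) => /=.
transitivity (24 * (3 * (3 * C))); first by ring.
have -> : 3 * C = (a - 1) * (Sg - dilate 3 Sg) + (Sg - dilate 3 Sg) + 2 * D (Ev Am).
  by rewrite e1; ring.
have Da : D a = 6 * D (Ev Am).
  have -> : D a = D (a - 1) by rewrite eulerDB eulerD1 subr0.
  by rewrite -Ev_Am eulerDM eulerDn; ring.
transitivity (a * (3 * (24 * Sg - 24 * dilate 3 Sg)) + 2 * (12 * D a)).
  by rewrite Da; ring.
have -> : 3 * (24 * Sg - 24 * dilate 3 Sg) = 3 * f - 3 * e by rewrite E2'E /E2; ring.
have -> : 3 * f = 2 * a ^+ 2 + e by rewrite cub_aE; ring.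
rewrite D_cub_a; ring.
Qed.

Lemma D_cub_C : 4 * D C = C * (3 * a ^+ 2 + e).
Proof.
apply: (natmul_inj tf (isT : 0 < 27)%N) => /=.
transitivity (4 * D (27 * C)); first by rewrite eulerDM eulerDn; ring.
rewrite cub_CE eulerDB eulerDX /=.
transitivity (a ^+ 2 * (12 * D a) - 4 * D B); first by ring.
rewrite D_cub_a D_cub_B.
transitivity ((27 * C) * (3 * a ^+ 2 + e)); last by ring.
rewrite cub_CE; ring.
Qed.

Let Ev_fK : Ev fK = f.
Proof.
rewrite E2'E /fK; have -> x : Ev (1 - 24 * x) = 1 - 24 * Ev x by ring.
rewrite fmap_dilate; congr (1 - 24 * dilate 3 _).
by rewrite fmap_lamb; apply: eq_lamb => d x _ _; rewrite rmorph_nat.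
Qed.

Let Q0 : Ev q0 = a ^+ 2.
Proof.
apply: (natmul_inj tf (isT : 0 < 2)%N) => /=.
rewrite cub_aE; have -> : Ev q0 = 12 * Ev Ap + Ev fK.
  by rewrite /q0; move: fK Ap => x y; ring.
rewrite Ev_fK Ev_Ap E2'E /E2; ring.
Qed.

Let Q2 : Ev (cd (cd q0)) = 12 * (a * C).
Proof.
apply: (natmul_inj tf (isT : 0 < 18)%N) => /=.
have ERK : Ev RK = f ^+ 2 - 4 * D f.
  have -> : Ev RK = Ev fK ^+ 2 + 288 * dilate 3 (D Sg).
    have -> : Ev RK = Ev fK ^+ 2 + 288 * Ev (dilate 3 (eulerD (sigma1 K))).
      by rewrite /RK; move: fK (dilate 3 _) => x y; ring.
    rewrite fmap_dilate fmap_eulerD; congr (_ + 288 * dilate 3 (D _)).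
    by rewrite fmap_lamb; apply: eq_lamb => d x _ _; rewrite rmorph_nat.
  by rewrite Ev_fK E2'E eulerDB eulerD1 eulerDM eulerDn eulerD_dilate; ring.
have := congr1 Ev weier; have -> x : Ev (2 * x) = 2 * Ev x by ring.
have -> : Ev (q0 ^+ 2 - RK) = Ev q0 ^+ 2 - Ev RK by move: q0 RK => x y; ring.
rewrite Q0 ERK => e1.
transitivity (9 * (2 * Ev (cd (cd q0)))); first by ring.
rewrite e1.
have Df : 3 * D f = 4 * a * D a + D e.
  have -> : 3 * D f = D (3 * f) by rewrite eulerDM eulerDn; ring.
  have -> : 3 * f = 2 * a ^+ 2 + e by rewrite cub_aE; ring.
  by rewrite eulerDD eulerDM eulerDn eulerDX /=; ring.
transitivity (9 * a ^+ 4 - (3 * f) ^+ 2 + 12 * (3 * D f)); first by ring.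
rewrite Df; have -> : 3 * f = 2 * a ^+ 2 + e by rewrite cub_aE; ring.
transitivity (9 * a ^+ 4 - (2 * a ^+ 2 + e) ^+ 2 + 4 * a * (12 * D a) + 12 * D e).
  by ring.
rewrite D_cub_a D_E2.
transitivity (8 * a * (27 * C)); last by ring.
rewrite cub_CE; ring.
Qed.

Let Qodd k : odd k -> Ev (iter k cd q0) = 12 * eis_chi' F k.+1.
Proof.
case: k => // k ok.
have -> : iter k.+1 cd q0 = 12 * iter k.+1 cd Ap.
  elim: k {ok} => [|k IH]; first exact: cd_q0.
  by rewrite iterS IH cderM // (cder_nat derM) mul0r add0r.
rewrite (cder_iter_Aplus derM EE1 derE1).
have -> : lamb (fun d x => (upos E1 3 d x + (-1) ^+ k.+1 * uneg E1' 3 d x) *+ d ^ k.+2) =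
    lamb (fun d x => (upos E1 3 d x - uneg E1' 3 d x) *+ d ^ k.+2).
  by apply: eq_lamb => d x _ _; rewrite -signr_odd ok expr1 mulN1r.
have -> x : Ev (12 * x) = 12 * Ev x by ring.
by rewrite Ev_odd.
Qed.

(** As for [eis_chi6], now at the point q of C^* / q^(3Z), where the
    Weierstrass function has no term free of q. *)
Lemma eis_chi'6E : eis_chi' F 6 = a ^+ 4 * C + 36 * a * C ^+ 2.
Proof.
apply: (natmul_inj tf (isT : 0 < 12)%N) => /=.
rewrite -Qodd // (taylor5 derM q3).
have -> x y z : Ev (3 * y * z + x ^+ 2 * y) = 3 * Ev y * Ev z + Ev x ^+ 2 * Ev y.
  by ring.
rewrite Q0 Q1 Q2; ring.
Qed.

Lemma eis_chi'8E :
  eis_chi' F 8 = 720 * C ^+ 3 + 216 * a ^+ 3 * C ^+ 2 + a ^+ 6 * C.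
Proof.
apply: (natmul_inj tf (isT : 0 < 12)%N) => /=.
rewrite -Qodd // (taylor7 derM q3).
have -> x y z : Ev (5 * y ^+ 3 + 18 * x * y * z + x ^+ 3 * y) =
  5 * Ev y ^+ 3 + 18 * Ev x * Ev y * Ev z + Ev x ^+ 3 * Ev y by ring.
rewrite Q0 Q1 Q2; ring.
Qed.

Lemma eis_chi'10E : eis_chi' F 10 =
  22896 * a ^+ 2 * C ^+ 3 + 972 * a ^+ 5 * C ^+ 2 + a ^+ 8 * C.
Proof.
apply: (natmul_inj tf (isT : 0 < 12)%N) => /=.
rewrite -Qodd // (taylor9 derM q3).
have -> x y z : Ev (84 * y * z ^+ 2 + 75 * x * y ^+ 3 + 81 * x ^+ 2 * y * z + x ^+ 4 * y) =
  84 * Ev y * Ev z ^+ 2 + 75 * Ev x * Ev y ^+ 3 + 81 * Ev x ^+ 2 * Ev y * Ev z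
  + Ev x ^+ 4 * Ev y by ring.
rewrite Q0 Q1 Q2; ring.
Qed.

Lemma sigma3_3E : sigma3 F - dilate 3 (sigma3 F) = a * C.
Proof.
apply: (natmul_inj tf (isT : 0 < 12)%N) => /=.
rewrite -Q2 cd_q0 cderM // (cder_nat derM) mul0r add0r.
have -> x : Ev (12 * x) = 12 * Ev x by ring.
by rewrite (cder2_Aplus derM EE1 derE1) Ev_even.
Qed.

End CubicRelations.

(** * The representation identities for power series *)

(** Here G and G' stand for the two Eisenstein series, c for the constant term.
    N is the multiple of G whose expression is known.  After elimination of a^3
    both sides are polynomials in B and C, times 1, a or a^2. *)
Section Algebra.
Variables (A : comNzRingType) (a B C G G' c : A).
Hypothesis aE : a ^+ 3 = B + 27 * C.

Lemma weight7_algebra N : N = 9 * G -> N = c - (12 * a * B ^+ 2 + 9 * a ^+ 4 * B) ->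
  G' = a ^+ 4 * C + 36 * a * C ^+ 2 ->
  3 * (7 * a ^+ 7) = c + 3 * (3 * (27 * G' - G) + 216 * (a * C * B)).
Proof.
move=> NG hN ->.
transitivity (c - N + 3 * (81 * (a ^+ 4 * C + 36 * a * C ^+ 2) + 216 * (a * C * B)));
  last by rewrite NG; ring.
rewrite hN subKr.
transitivity (21 * a * (a ^+ 3) ^+ 2); first by ring.
transitivity (12 * a * B ^+ 2 + 9 * a * a ^+ 3 * B
  + 3 * (81 * (a * a ^+ 3 * C + 36 * a * C ^+ 2) + 216 * (a * C * B))); last by ring.
rewrite aE; ring.
Qed.

Lemma weight9_algebra N : N = 27 * G ->
  N = c + (80 * B ^+ 3 + 648 * a ^+ 3 * B ^+ 2 + 81 * a ^+ 6 * B) ->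
  G' = 720 * C ^+ 3 + 216 * a ^+ 3 * C ^+ 2 + a ^+ 6 * C ->
  809 * a ^+ 9 = - c + (27 * (81 * G' + G)
   + 24 * 1728 * (27 * (C ^+ 2 * B) + B ^+ 2 * C)).
Proof.
move=> NG hN ->.
transitivity (N - c + 27 * (81 * (720 * C ^+ 3 + 216 * a ^+ 3 * C ^+ 2 + a ^+ 6 * C))
    + 24 * 1728 * (27 * (C ^+ 2 * B) + B ^+ 2 * C)); last by rewrite NG; ring.
rewrite hN.
transitivity (809 * (a ^+ 3) ^+ 3); first by ring.
transitivity (80 * B ^+ 3 + 648 * a ^+ 3 * B ^+ 2 + 81 * (a ^+ 3) ^+ 2 * B
  + 27 * (81 * (720 * C ^+ 3 + 216 * a ^+ 3 * C ^+ 2 + (a ^+ 3) ^+ 2 * C))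
  + 24 * 1728 * (27 * (C ^+ 2 * B) + B ^+ 2 * C)); last by ring.
rewrite aE; ring.
Qed.

Lemma weight11_algebra N : N = 9 * G -> N = c
    - (2544 * a ^+ 2 * B ^+ 3 + 2916 * a ^+ 5 * B ^+ 2 + 81 * a ^+ 8 * B) ->
  G' = 22896 * a ^+ 2 * C ^+ 3 + 972 * a ^+ 5 * C ^+ 2 + a ^+ 8 * C ->
  3 * (9235 * a ^+ 11) = 5 * c + 3 * (15 * (243 * G' - G)
   + 81 * 748 * ((a * B + 243 * (a * C)) * (a * C * B)
       + 9 * ((a * B + 3 * (a * C)) * (a * C * B)))).
Proof.
move=> NG hN ->.
transitivity (5 * (c - N) + 3 * (3645 * (22896 * a ^+ 2 * C ^+ 3
      + 972 * a ^+ 5 * C ^+ 2 + a ^+ 8 * C)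
    + 81 * 748 * (10 * a ^+ 2 * (B + 27 * C) * (C * B)))); last by rewrite NG; ring.
rewrite hN subKr.
transitivity (3 * 9235 * a ^+ 2 * (a ^+ 3) ^+ 3); first by ring.
transitivity (5 * (2544 * a ^+ 2 * B ^+ 3 + 2916 * a ^+ 2 * a ^+ 3 * B ^+ 2
     + 81 * a ^+ 2 * (a ^+ 3) ^+ 2 * B)
    + 3 * (3645 * (22896 * a ^+ 2 * C ^+ 3 + 972 * a ^+ 2 * a ^+ 3 * C ^+ 2
         + a ^+ 2 * (a ^+ 3) ^+ 2 * C)
    + 81 * 748 * (10 * a ^+ 2 * (B + 27 * C) * (C * B)))); last by ring.
rewrite aE; ring.
Qed.
End Algebra.

Section FormalIdentities.
Variables (F : numFieldType) (w : F).
Hypothesis w3 : w ^+ 2 + w + 1 = 0.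

Local Notation a := (cub_a F).
Local Notation B := (cub_B F).
Local Notation C := (cub_C F).

(** The Eisenstein series of weight 4. *)
Definition E4s : fps F := 1 + 240 * sigma3 F.

Let tf : torsion_free (fps F) := torsion_free_fps (@torsion_free_num F).

Lemma cub_a0 : a 0%N = 1.
Proof. by rewrite fpsDE fps_natM lamb0E mul0rn addr0. Qed.

Lemma cub_B0 : B 0%N = 1.
Proof. by rewrite fpsBE fps_natM lamb0E mul0rn subr0. Qed.

Let sigma3_1c : 3 * (- sigma3 F + 81 * dilate 3 (sigma3 F)) = a * B - 1.
Proof.
have [c ec] := sigma3_1E w3; have := congr1 (@fps_at0 F) ec.
have -> x y : fps_at0 (3 * (- x + 81 * y)) = 3 * (- fps_at0 x + 81 * fps_at0 y) :> F.
  by ring.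
have -> x : fps_at0 (fconst c + x) = c + fps_at0 x.
  by rewrite rmorphD; congr (_ + _); apply: mulr1n.
have -> : fps_at0 (a * B) = 1 by rewrite /fps_at0 fpsME0 cub_a0 cub_B0 mulr1.
have -> : fps_at0 (dilate 3 (sigma3 F)) = 0 by exact: dilate0E.
have -> : fps_at0 (sigma3 F) = 0 by [].
move=> c1.
have {}c1 : c = -1.
  by apply/eqP; rewrite -subr_eq0 opprK -c1 oppr0 mulr0 addr0 mulr0.
by rewrite ec c1 rmorphN rmorph1 addrC.
Qed.

(** The two sums of cubes, at w and at q, are two linear equations for
    E_4(z) and E_4(3z). *)
Lemma E4s_cubic : E4s = a * B + 243 * (a * C).
Proof.
apply: (natmul_inj tf (isT : 0 < 1)%N) => /=; rewrite !mul1r.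
have e3 := sigma3_3E w3; have e1 := sigma3_1c.
transitivity (1 + 243 * (sigma3 F - dilate 3 (sigma3 F)) +
   3 * (- sigma3 F + 81 * dilate 3 (sigma3 F))); first by rewrite /E4s; ring.
by rewrite e1 e3; ring.
Qed.

Lemma E4s_dilate_cubic : dilate 3 E4s = a * B + 3 * (a * C).
Proof.
have e3 := sigma3_3E w3; have e1 := sigma3_1c.
rewrite /E4s raddfD /= dilateM // dilate_nat // (dilate_nat _ 1) //.
transitivity (1 + 3 * (sigma3 F - dilate 3 (sigma3 F)) +
   3 * (- sigma3 F + 81 * dilate 3 (sigma3 F))); first by ring.
by rewrite e1 e3; ring.
Qed.

Lemma E4s_diff : E4s - dilate 3 E4s = 240 * (a * C).
Proof. rewrite E4s_dilate_cubic E4s_cubic; ring. Qed.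

Let coef_const (g h : fps F) c n : (0 < n)%N -> g = fconst c + h -> g n = h n.
Proof. by move=> n0 ->; rewrite fpsDE fconstE gtn_eqF // add0r. Qed.

Let coefn n (m : nat) (g : fps F) : (m%:R * g) n = m%:R * g n.
Proof. by rewrite fps_natM mulr_natl. Qed.

Let aE : a ^+ 3 = B + 27 * C.
Proof. by rewrite (cub_CE w3); ring. Qed.

(** Positive n removes the constants that the Eisenstein series would add. *)
Lemma cub_a7_coef n : (0 < n)%N -> 7 * (a ^+ 7) n =
  3 * (27 * eis_chi' F 6 n - eis_chi F 6 n) + 216 * (a * C * B) n.
Proof.
move=> n0; have [c ec] := eis_chi6E w3.
have := coef_const n0 (weight7_algebra aE erefl ec (eis_chi'6E w3)); rewrite !coefn.
move=> /(natmul_inj (@torsion_free_num F) (isT : 0 < 3)%N) ->.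
have lin x y z : (3 * (27 * x - y) + 216 * z : fps F) n =
  3 * (27 * x n - y n) + 216 * z n by rewrite fpsDE !coefn fpsBE !coefn.
exact: lin.
Qed.

Lemma cub_a9_coef n : (0 < n)%N -> 809 * (a ^+ 9) n =
  27 * (81 * eis_chi' F 8 n + eis_chi F 8 n)
  + 24 * 1728 * (27 * (C ^+ 2 * B) n + (B ^+ 2 * C) n).
Proof.
move=> n0; have [c ec] := eis_chi8E w3.
have := weight9_algebra aE erefl ec (eis_chi'8E w3); rewrite -rmorphN.
move=> /(coef_const n0); rewrite coefn => ->.
have lin (k m : nat) x y z t : (27 * (81 * x + y) + k%:R * m%:R * (27 * z + t) : fps F) n =
    27 * (81 * x n + y n) + k%:R * m%:R * (27 * z n + t n).
  by rewrite fpsDE -mulrA !coefn !fpsDE !coefn mulrA.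
exact: lin.
Qed.

Lemma cub_a11_coef n : (0 < n)%N -> 9235 * (a ^+ 11) n =
  15 * (243 * eis_chi' F 10 n - eis_chi F 10 n)
  + 81 * 748 * ((E4s * (a * C * B)) n + 9 * (dilate 3 E4s * (a * C * B)) n).
Proof.
move=> n0; have [c ec] := eis_chi10E w3.
have := weight11_algebra aE erefl ec (eis_chi'10E w3).
rewrite -E4s_dilate_cubic -E4s_cubic -(rmorph_nat (@fconst F) 5) -rmorphM.
move=> /(coef_const n0); rewrite !coefn.
move=> /(natmul_inj (@torsion_free_num F) (isT : 0 < 3)%N) ->.
have lin (k m : nat) x y z t : (15 * (243 * x - y) + k%:R * m%:R * (z + 9 * t) : fps F) n =
    15 * (243 * x n - y n) + k%:R * m%:R * (z n + 9 * t n).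
  by rewrite fpsDE -mulrA !coefn fpsBE fpsDE !coefn mulrA.
exact: lin.
Qed.

End FormalIdentities.

(** * Infinite products *)

Section Euler.
Variable K : comNzRingType.
Implicit Types y : K.

Definition eprod y N : fps K := \prod_(m < N) (1 - fconst y * fX K m.+1).

(** The product of all 1 - y q^m, whose n-th coefficient is that of the first
    n factors. *)
Definition einf y : fps K := Fps (fun n => eprod y n n).

Lemma eprodS y N : eprod y N.+1 = eprod y N * (1 - fconst y * fX K N.+1).
Proof. by rewrite /eprod big_ord_recr. Qed.

Lemma factor_cong y m : fcong m (1 - fconst y * fX K m) 1.
Proof.
move=> n nm; rewrite fpsBE mulrC fXM leqNgt nm /= subr0 //.
Qed.

Lemma eprod_cong y N k : fcong N.+1 (eprod y (N + k)%N) (eprod y N).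
Proof.
elim: k => [|k IH]; first by rewrite addn0.
rewrite addnS eprodS -[eprod y N]mulr1; apply: fcongM => //.
apply: (@fcong_le _ (N + k).+1 N.+1); last exact: factor_cong.
by rewrite ltnS leq_addr.
Qed.

Lemma einf_cong y N : fcong N.+1 (eprod y N) (einf y).
Proof.
move=> n; rewrite ltnS => nN; rewrite /einf /= -(subnKC nN).
exact: eprod_cong.
Qed.

Lemma einf0 y : einf y 0%N = 1.
Proof. by rewrite /einf /= /eprod big_ord0. Qed.

(* The geometric series of y q^m without its constant term. *)
Let geo m y : fps K :=
  Fps (fun n => if (m %| n)%N && (0 < n)%N then y ^+ (n %/ m)%N else 0).

Let geoE m y : (0 < m)%N -> (1 - fconst y * fX K m) * geo m y = fconst y * fX K m.
Proof.
move=> m0; apply: fpsP => n; rewrite mulrBl mul1r fpsBE -mulrA !fconstM fXM fXE /=.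
have [nm|mn] := ltnP n m.
  rewrite mulr0 subr0 (ltn_eqF nm) mulr0.
  case: n nm => [|n] nm; first by rewrite ltnn andbF.
  by rewrite gtnNdvd.
have n0 : (0 < n)%N by apply: leq_trans mn.
rewrite n0 andbT -{1}(subnK mn) dvdn_addl // subn_gt0.
have [->|nm] := eqVneq n m.
  by rewrite subnn dvdn0 ltnn mulr0 subr0 divnn m0 expr1 mulr1.
have mn' : (m < n)%N by rewrite ltn_neqAle eq_sym nm.
rewrite mn' andbT mulr0; case: ifP => [d|_]; last by rewrite mulr0 subrr.
by rewrite -[in X in X - _](subnK mn) divnDr // divnn m0 addn1 exprS subrr.
Qed.

Let eulerD_eprod y N : eulerD (eprod y N) =
  - (eprod y N * \sum_(m < N) m.+1%:R * geo m.+1 y).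
Proof.
elim: N => [|N IH]; first by rewrite /eprod !big_ord0 eulerD1 mulr0 oppr0.
rewrite eprodS big_ord_recr /= eulerDM IH eulerDB eulerD1 sub0r.
rewrite eulerDM eulerD_const mul0r add0r eulerD_fX -[fX _ _ *+ _]mulr_natl.
have := geoE y (ltn0Sn N).
set g := geo _ _; set x := fX _ _; set S := \sum_(_ < _) _ => e.
transitivity (- (eprod y N * (1 - fconst y * x) * S
   + eprod y N * N.+1%:R * (fconst y * x))); first by ring.
rewrite -{2}e; ring.
Qed.

(** Each factor contributes a geometric series to the logarithmic
    derivative. *)
Lemma eulerD_einf y :
  eulerD (einf y) = einf y * - lamb (fun d x => y ^+ d *+ x).
Proof.
apply: fcong_eq => N; have NN := leqnSn N.
apply: (@fcong_trans _ _ (eulerD (eprod y N))).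
  exact/fcong_eulerD/fcong_sym/(fcong_le NN)/einf_cong.
rewrite eulerD_eprod -mulrN; apply: fcongM; first exact/(fcong_le NN)/einf_cong.
apply: fcongN => n nN; rewrite fps_sumE.
have [->|n0] := posnP n.
  rewrite lamb0E big1 // => m _.
  by rewrite fps_natM mul0rn.
rewrite lambE // (sum_divisorsC (fun d x => y ^+ d *+ x)) //.
pose g m := (if (m %| n)%N then y ^+ (n %/ m) *+ m else 0).
transitivity (\sum_(m < N) g m.+1).
  apply: eq_bigr => m _; rewrite fps_natM /= n0 andbT /g.
  by case: ifP => // _; rewrite mul0rn.
transitivity (\sum_(1 <= m < N.+1) g m); first by rewrite big_add1 /= big_mkord.
rewrite /index_iota subSS subn0 /g -big_mkcond -big_filter; apply: perm_big; apply: uniq_perm.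
- by rewrite filter_uniq // iota_uniq.
- exact: divisors_uniq.
move=> m; rewrite mem_filter mem_iota -dvdn_divisors // add1n ltnS.
apply: andb_idr => mn; rewrite (dvdn_gt0 n0 mn) (leq_trans (dvdn_leq n0 mn)) //.
exact: ltnW.
Qed.

End Euler.

Lemma fmap_einf (R S : comNzRingType) (phi : {rmorphism R -> S}) y :
  fmap phi (einf y) = einf (phi y).
Proof.
have e N : fmap phi (eprod y N) = eprod (phi y) N.
  rewrite /eprod rmorph_prod; apply: eq_bigr => m _.
  by rewrite rmorphB rmorph1 rmorphM /= fmap_const fmap_fX.
by apply: fpsP => n; rewrite fmapE -[RHS]/(eprod (phi y) n n) -e.
Qed.

Section EulerDerivation.
Variables (K : comNzRingType) (der : {additive K -> K}).
Hypothesis derM : forall x y, der (x * y) = der x * y + x * der y.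
Hypothesis tfK : torsion_free K.
Local Notation cd := (cder der).

(** The logarithmic derivative in y: W below satisfies the same homogeneous
    equation as the product, with vanishing constant term. *)
Lemma cder_einf y c : der y = c * y -> der c = 0 ->
  cd (einf y) = - fconst c * einf y * lamb (fun d _ => y ^+ d).
Proof.
move=> dy dc; set P := einf y; set L := lamb _.
pose M := lamb (fun d x => y ^+ d *+ x).
pose W := cd P + fconst c * P * L.
have derX n : der (y ^+ n) = c * y ^+ n *+ n.
  elim: n => [|n IH]; first by rewrite expr0 der1.
  rewrite exprS derM dy IH mulrS; ring.
have cdM : cd M = fconst c * eulerD L.
  rewrite cder_lamb eulerD_lamb lambZ; apply: eq_lamb => d x _ _.
  by rewrite raddfMn /= derX -mulrnA mulrnAr.
have DP : eulerD P = P * - M by exact: eulerD_einf.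
have W0 : W = 0.
  apply: (@ode_eq0 _ tfK W (- M) 0).
  - rewrite /W eulerDD -cder_eulerD !eulerDM eulerD_const DP cderM //.
    have -> : cd (- M) = - cd M by exact: raddfN.
    rewrite cdM; ring.
  - by rewrite fpsNE lamb0E oppr0.
  - rewrite /W fpsDE fpsME0 lamb0E mulr0 addr0 -[LHS]/(der (P 0%N)) /P einf0.
    exact: der1.
by apply/eqP; rewrite -subr_eq0 mulNr mulNr opprK -/W W0.
Qed.
End EulerDerivation.

Section EulerCubic.
Variable F : numFieldType.
Local Notation D := (@eulerD F).
Local Notation P := (einf (1 : F)).
Local Notation P3 := (dilate 3 P).
Local Notation a := (cub_a F).
Local Notation B := (cub_B F).
Local Notation C := (cub_C F).
Local Notation e := (E2 F).
Local Notation f := (E2' F).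
Let tf := @torsion_free_num F.
Let tff : torsion_free (fps F) := torsion_free_fps tf.

Let D_P : D P = P * - sigma1 F.
Proof.
rewrite eulerD_einf lambC; congr (_ * - _).
by apply: eq_lamb => d x _ _; rewrite expr1n.
Qed.

Let D_P3 : D P3 = P3 * (- 3 * dilate 3 (sigma1 F)).
Proof.
by rewrite eulerD_dilate D_P dilateM // raddfN /= -mulr_natl; ring.
Qed.

(** The three products multiply to 1 - q^(3 m) factor by factor; the
    logarithmic derivatives show it without regrouping. *)
Lemma einf_root3 w : w ^+ 2 + w + 1 = 0 -> P * (einf w * einf (w ^+ 2)) = P3.
Proof.
move=> w3; pose M w := - lamb (fun d x => w ^+ d *+ x) : fps F.
apply: (@ode_uniq _ tf _ _ (- 3 * dilate 3 (sigma1 F)) 0).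
- rewrite !eulerDM !eulerD_einf -/(M 1) -/(M w) -/(M (w ^+ 2)).
  have -> : - 3 * dilate 3 (sigma1 F) = M 1 + (M w + M (w ^+ 2)).
    rewrite dilate_lamb // mulNr mulr_natl lambMn lambC /M -!opprD !lambD.
    congr (- _); apply: eq_lamb => d x _ _.
    rewrite -!mulrnDl (root3_sum w3) expr1n.
    case: (3 %| d)%N; rewrite ?mulr1n ?mulr0n; ring.
  ring.
- exact: D_P3.
- by rewrite mulNr fpsNE fps_natM dilate0E lamb0E mul0rn oppr0.
- by rewrite !fpsME0 dilate0E !einf0 !mulr1.
Qed.

Section Eta.
Variable w : F.
Hypothesis w3 : w ^+ 2 + w + 1 = 0.

Let E2'E : f = 1 - 24 * dilate 3 (sigma1 F).
Proof. by rewrite /E2' /E2 raddfB /= dilateM // dilate_nat // (dilate_nat _ 1). Qed.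

Let D_PX n : D (P ^+ n) = P ^+ n * (- n%:R * sigma1 F).
Proof.
case: n => [|n]; first by rewrite expr0 eulerD1 oppr0 mul0r mulr0.
rewrite eulerDX /= D_P -mulr_natl exprS; ring.
Qed.

Let D_P3X n : D (P3 ^+ n) = P3 ^+ n * (- (3 * n)%:R * dilate 3 (sigma1 F)).
Proof.
case: n => [|n]; first by rewrite expr0 eulerD1 muln0 oppr0 mul0r mulr0.
rewrite eulerDX /= D_P3 -mulr_natl exprS natrM; ring.
Qed.

Let D_B : D B = B * (9 * dilate 3 (sigma1 F) - 9 * sigma1 F).
Proof.
apply: (natmul_inj tff (isT : 0 < 8)%N) => /=.
transitivity (2 * (4 * D B)); first by ring.
rewrite (D_cub_B w3); transitivity (B * (2 * e - 2 * a ^+ 2)); first by ring.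
rewrite (cub_aE w3) E2'E /E2; ring.
Qed.

Let D_C : D C = C * (1 - 27 * dilate 3 (sigma1 F) + 3 * sigma1 F).
Proof.
apply: (natmul_inj tff (isT : 0 < 8)%N) => /=.
transitivity (2 * (4 * D C)); first by ring.
rewrite (D_cub_C w3); transitivity (C * (2 * e + 3 * (2 * a ^+ 2))); first by ring.
rewrite (cub_aE w3) E2'E /E2; ring.
Qed.

(** The logarithmic derivatives of B and C are E_2(z) - a^2 and
    E_2(z) + 3 a^2 up to a factor 4, and 2 a^2 = 3 E_2(3z) - E_2(z); so they are
    combinations of E_2(z) and E_2(3z), as those of eta products are. *)
Lemma cub_B_prod : B * P3 ^+ 3 = P ^+ 9.
Proof.
apply: (@ode_uniq _ tf _ _ (- 9 * sigma1 F) 0).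
- rewrite eulerDM D_P3X D_B; ring.
- exact: D_PX.
- by rewrite mulNr fpsNE fps_natM lamb0E mul0rn oppr0.
- by rewrite fpsME0 !fpsXE0 dilate0E einf0 cub_B0 !expr1n mulr1.
Qed.

Lemma cub_C_prod : C * P ^+ 3 = fX F 1 * P3 ^+ 9.
Proof.
apply: (@ode_uniq _ tf _ _ (1 - 27 * dilate 3 (sigma1 F)) 1).
- rewrite eulerDM D_PX D_C; ring.
- rewrite eulerDM eulerD_fX mulr1n D_P3X; ring.
- by rewrite fpsBE fps_natM dilate0E lamb0E mul0rn subr0.
- rewrite fXM leqnn subnn fpsXE0 dilate0E einf0 expr1n fpsME big_ord_recl big_ord1.
  rewrite [cub_C F _]lamb0E mul0r add0r subnn fpsXE0 einf0 expr1n mulr1 lambE //.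
  by rewrite (_ : divisors 1 = [:: 1%N]) // big_seq1 divnn expr1n mulr1.
Qed.
End Eta.
End EulerCubic.

(** * Generating series of weighted sets *)

Section GeneratingSeries.
Variable K : comNzRingType.

(** The series of w i q^(N i); [finite_fibres] makes its coefficients finite
    sums. *)
Definition gser (I : choiceType) (N : I -> nat) (w : I -> K) : fps K :=
  Fps (fun n => \sum_(i \in [set i | N i == n]%classic) w i).

Definition finite_fibres (I : choiceType) (N : I -> nat) :=
  forall n, exists r : seq I, uniq r /\ forall i, (N i <= n)%N -> i \in r.

Lemma gserE (I : choiceType) (N : I -> nat) w n (r : seq I) :
    uniq r -> (forall i, N i = n -> i \in r) ->
  gser N w n = \sum_(i <- r | N i == n) w i.
Proof.
move=> ur rN; rewrite (bigfs _ (P := fun i => N i == n)) //.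
by move=> i /eqP /rN ->.
Qed.

Lemma eq_gser (I : choiceType) (N : I -> nat) w v : w =1 v -> gser N w = gser N v.
Proof. by move=> wv; congr gser; apply/funext. Qed.

Lemma gserD (I : choiceType) (N : I -> nat) w v : finite_fibres N ->
  gser N w + gser N v = gser N (fun i => w i + v i).
Proof.
move=> fN; apply: fpsP => n; have [r [ur rN]] := fN n.
have rn i : N i = n -> i \in r by move=> e; apply: rN; rewrite e.
by rewrite fpsDE !(gserE _ ur rn) -big_split.
Qed.

Lemma gserZ (I : choiceType) (N : I -> nat) w c : finite_fibres N ->
  fconst c * gser N w = gser N (fun i => c * w i).
Proof.
move=> fN; apply: fpsP => n; have [r [ur rN]] := fN n.
have rn i : N i = n -> i \in r by move=> e; apply: rN; rewrite e.
by rewrite fconstM !(gserE _ ur rn) mulr_sumr.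
Qed.

Lemma finite_fibresM (I J : choiceType) (N : I -> nat) (M : J -> nat) :
  finite_fibres N -> finite_fibres M ->
  finite_fibres (fun p : I * J => N p.1 + M p.2)%N.
Proof.
move=> fN fM n; have [r [ur rN]] := fN n; have [s [us sM]] := fM n.
exists [seq (i, j) | i <- r, j <- s]; split; first by rewrite allpairs_uniq // => -[? ?] [].
move=> [i j] /= ij; apply/allpairsP; exists (i, j); split=> //=.
  by apply: rN; apply: leq_trans ij; apply: leq_addr.
by apply: sM; apply: leq_trans ij; apply: leq_addl.
Qed.

Lemma gserM (I J : choiceType) (N : I -> nat) (M : J -> nat) w v :
    finite_fibres N -> finite_fibres M ->
  gser N w * gser M v =
  gser (fun p : I * J => N p.1 + M p.2)%N (fun p => w p.1 * v p.2).
Proof.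
move=> fN fM; apply: fpsP => n; have [r [ur rN]] := fN n; have [s [us sM]] := fM n.
rewrite fpsME.
have urs : uniq [seq (i, j) | i <- r, j <- s] by rewrite allpairs_uniq // => -[? ?] [].
rewrite (gserE _ urs) => [|[i j] /= ij]; last first.
  apply/allpairsP; exists (i, j); split=> //=.
    by apply: rN; rewrite -ij leq_addr.
  by apply: sM; rewrite -ij leq_addl.
rewrite [RHS]big_mkcond big_allpairs_dep.
pose G i j k := (w i * v j) *+ ((N i == k) && (M j == n - k))%N.
transitivity (\sum_(k < n.+1) \sum_(i <- r) \sum_(j <- s) G i j k).
  apply: eq_bigr => k _; have kn : (k <= n)%N by rewrite -ltnS.
  rewrite (gserE _ ur) => [|i e]; last by apply: rN; rewrite e.
  rewrite (gserE _ us) => [|j e]; last by apply: sM; rewrite e leq_subr.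
  rewrite big_distrl /= big_mkcond; apply: eq_bigr => i _; rewrite /G.
  case: eqP => _; last by rewrite big1 // => j _; rewrite mulr0n.
  rewrite big_distrr /= big_mkcond; apply: eq_bigr => j _.
  by case: eqP; rewrite ?mulr1n ?mulr0n.
rewrite exchange_big; apply: eq_bigr => i _; rewrite exchange_big.
apply: eq_bigr => j _ /=; rewrite /G; have [e|e] := eqVneq.
  have lt : (N i < n.+1)%N by rewrite -e ltnS leq_addr.
  rewrite (bigD1 (Ordinal lt)) //= eqxx -{1}e addKn eqxx mulr1n big1 ?addr0 //.
  by move=> k; rewrite -val_eqE /= eq_sym => /negPf ->.
rewrite big1 // => k _; case: eqP => [Nk|]; last by rewrite mulr0n.
case: eqP => [Mk|]; last by rewrite mulr0n.
by case/eqP: e; rewrite Nk Mk subnKC // -ltnS.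
Qed.

Lemma gser_reindex (I J : choiceType) (N : I -> nat) (M : J -> nat) w (h : J -> I) :
    injective h -> (forall j, N (h j) = M j) ->
    (forall i, w i != 0 -> exists j, h j = i) ->
  gser N w = gser M (w \o h).
Proof.
move=> hI NM hw; apply: fpsP => n /=.
rewrite -(fsbig_image _ h w); last by move=> x y _ _ /hI.
apply/esym/fsbig_widen => [_ [j /= + <-]|i /= [/eqP Ni nh]]; first by rewrite NM.
apply: contrapT => /eqP /hw [j ji]; apply: nh; exists j => //=.
by rewrite -NM ji Ni.
Qed.

End GeneratingSeries.

Lemma gser_fmap (R S : comNzRingType) (phi : {rmorphism R -> S}) (I : choiceType)
    (N : I -> nat) w : finite_fibres N ->
  fmap phi (gser N w) = gser N (phi \o w).
Proof.
move=> fN; apply: fpsP => n; have [r [ur rN]] := fN n.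
have rn i : N i = n -> i \in r by move=> e; apply: rN; rewrite e.
by rewrite fmapE !(gserE _ ur rn) rmorph_sum.
Qed.

(** * The triple product identity *)

(** The triangular numbers j (j - 1) / 2. *)
Definition tri (j : int) : nat :=
  match j with Posz m => 'C(m, 2) | Negz m => 'C(m.+2, 2) end.

Lemma triE j : (tri j)%:Z *+ 2 = j * (j - 1).
Proof.
have bin2Z m : ('C(m, 2))%:Z *+ 2 = m%:Z * (m%:Z - 1).
  case: m => [|m]; first by rewrite bin0n mul0r.
  by have := mul_bin_diag m.+1 1; rewrite bin1 /=; lia.
by case: j => m; rewrite [tri _]/= bin2Z; lia.
Qed.

Lemma finite_fibres_tri : finite_fibres tri.
Proof.
move=> n; exists [seq k%:Z - n.+1%:Z | k <- iota 0 (2 * n.+1).+1]; split.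
  by rewrite map_inj_uniq ?iota_uniq // => j k /addIr [].
move=> j tn; have := triE j; apply: contraPT => /mapP nj.
have {}nj : ~ (- n.+1%:Z <= j <= n.+1%:Z).
  move=> jn; apply: nj; exists (absz (j + n.+1%:Z)); last by lia.
  by rewrite mem_iota; lia.
by move: (tri j) tn nj => t tn nj; nia.
Qed.

Section TripleProduct.
Variables (K : comNzRingType) (y y' : K).
Hypothesis yy' : y * y' = 1.

Definition theta_wt (j : int) : K :=
  match j with Posz m => (- y) ^+ m | Negz m => (- y') ^+ m.+1 end.

Lemma theta_wtS j : theta_wt (j + 1) = - y * theta_wt j.
Proof.
case: j => [m|[|m]].
- by rewrite -PoszD addn1 /= exprS.
- by rewrite /= expr0 expr1 mulrNN yy'.
- have -> : Negz m.+1 + 1 = Negz m by lia.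
  by rewrite /= [in RHS]exprS mulrA mulrNN yy' mul1r.
Qed.

Definition thetas : fps K := gser tri theta_wt.

Local Notation X := (fX K).
Local Notation Q := (eprod (1 : K)).

Let iQ_ex n : exists g, Q n * g = 1.
Proof. by apply: (@fps_inv _ _ 1); rewrite mul1r (einf_cong 1 (ltn0Sn n)) einf0. Qed.

Let iQ n := projT1 (cid (iQ_ex n)).

Let QiQ n : Q n * iQ n = 1 := projT2 (cid (iQ_ex n)).

Let QS n : Q n.+1 = Q n * (1 - X n.+1).
Proof. by rewrite eprodS rmorph1 mul1r. Qed.

Let iQE n : iQ n = (1 - X n.+1) * iQ n.+1.
Proof.
transitivity (Q n.+1 * iQ n.+1 * iQ n); first by rewrite QiQ mul1r.
rewrite QS; have -> : Q n * (1 - X n.+1) * iQ n.+1 * iQ n =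
  (Q n * iQ n) * ((1 - X n.+1) * iQ n.+1) by ring.
by rewrite QiQ mul1r.
Qed.

(** The Gaussian binomial coefficients. *)
Let qb n k := if (k <= n)%N then Q n * iQ k * iQ (n - k)%N else 0.

Let Q0 : Q 0 = 1. Proof. by rewrite /eprod big_ord0. Qed.

Let iQ0 : iQ 0 = 1.
Proof. by rewrite -[LHS]mul1r -Q0 QiQ. Qed.

Let qbn0 n : qb n 0 = 1.
Proof. by rewrite /qb subn0 iQ0 mulr1 QiQ. Qed.

Let qbnn n : qb n n = 1.
Proof. by rewrite /qb leqnn subnn iQ0 mulr1 QiQ. Qed.

Let qb_gt n k : (n < k)%N -> qb n k = 0.
Proof. by move=> nk; rewrite /qb leqNgt nk. Qed.

Let qb_pascal1 n k : (k <= n)%N -> qb n.+1 k.+1 = qb n k.+1 + X (n - k)%N * qb n k.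
Proof.
move=> kn; have [->|nk] := eqVneq k n.
  by rewrite !qbnn qb_gt // subnn fX0 mul1r add0r.
have {nk}kn : (k < n)%N by rewrite ltn_neqAle nk.
have e : iQ (n - k.+1)%N = (1 - X (n - k)%N) * iQ (n - k)%N by rewrite iQE subnSK.
rewrite /qb ltnS kn (ltnW kn) subSS QS (iQE k) e.
have -> : X n.+1 = X (n - k)%N * X k.+1 by rewrite -fXD; congr X; lia.
ring.
Qed.

Let qb_pascal2 n k : (k <= n)%N -> qb n.+1 k.+1 = qb n k + X k.+1 * qb n k.+1.
Proof.
move=> kn; have [->|nk] := eqVneq k n.
  by rewrite !qbnn qb_gt // mulr0 addr0.
have {nk}kn : (k < n)%N by rewrite ltn_neqAle nk.
have e : iQ (n - k.+1)%N = (1 - X (n - k)%N) * iQ (n - k)%N by rewrite iQE subnSK.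
rewrite /qb ltnS kn (ltnW kn) subSS QS (iQE k) e.
have -> : X n.+1 = X (n - k)%N * X k.+1 by rewrite -fXD; congr X; lia.
ring.
Qed.

Let term M (k : nat) : fps K :=
  fconst (theta_wt (k%:Z - M%:Z)) * X (tri (k%:Z - M%:Z)).

(* The finite form: F N M is a Laurent polynomial in y with Gaussian binomial
   coefficients.  Multiplying by one more factor on either side is one of the
   two Pascal rules. *)
Let F N M := \prod_(i < N) (1 - fconst y * X i) * \prod_(i < M) (1 - fconst y' * X i.+1).

Let term_up N M k : (k <= N + M)%N ->
  - fconst y * X N * term M k = term M k.+1 * X (N + M - k)%N.
Proof.
move=> kn; rewrite /term.
have e : k.+1%:Z - M%:Z = k%:Z - M%:Z + 1 by lia.
rewrite e theta_wtS rmorphM rmorphN /=.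
have -> : - fconst y * X N * (fconst (theta_wt (k%:Z - M%:Z)) * X (tri (k%:Z - M%:Z))) =
  - fconst y * fconst (theta_wt (k%:Z - M%:Z)) * (X N * X (tri (k%:Z - M%:Z))) by ring.
rewrite -[RHS]mulrA -!fXD; congr (_ * X _).
have := triE (k%:Z - M%:Z); have := triE (k%:Z - M%:Z + 1).
by move: (tri _) (tri _) => s t; nia.
Qed.

Let term_shift M k : term M k = term M.+1 k.+1.
Proof. by rewrite /term; have -> : k.+1%:Z - M.+1%:Z = k%:Z - M%:Z by lia. Qed.

Let term_down M k : - fconst y' * X M.+1 * term M k = term M.+1 k * X k.
Proof.
rewrite /term; have e : k%:Z - M%:Z = k%:Z - M.+1%:Z + 1 by lia.
have -> : theta_wt (k%:Z - M.+1%:Z) = - y' * theta_wt (k%:Z - M%:Z).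
  by rewrite e theta_wtS mulrA mulrNN [y' * y]mulrC yy' mul1r.
rewrite rmorphM rmorphN /=.
have -> : - fconst y' * X M.+1 * (fconst (theta_wt (k%:Z - M%:Z)) * X (tri (k%:Z - M%:Z))) =
  - fconst y' * fconst (theta_wt (k%:Z - M%:Z)) * (X M.+1 * X (tri (k%:Z - M%:Z))) by ring.
rewrite -[RHS]mulrA -!fXD; congr (_ * X _).
have := triE (k%:Z - M%:Z); have := triE (k%:Z - M.+1%:Z).
by move: (tri _) (tri _) => s t; nia.
Qed.

Let F00 : F 0 0 = \sum_(k < 1) term 0 k * qb 0 k.
Proof.
by rewrite /F !big_ord0 big_ord1 qbn0 /term /= expr0 bin0n fX0 !rmorph1 !mulr1.
Qed.

Let FS1 N M : F N M = \sum_(k < (N + M).+1) term M k * qb (N + M) k ->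
  F N.+1 M = \sum_(k < (N.+1 + M).+1) term M k * qb (N.+1 + M) k.
Proof.
move=> IH; have -> : F N.+1 M = (1 - fconst y * X N) * F N M.
  by rewrite /F big_ord_recr /=; ring.
rewrite IH addSn [RHS]big_ord_recl [X in _ = X + _]/= qbn0 mulr1.
have -> : \sum_(i < (N + M).+1) term M (lift ord0 i) * qb (N + M).+1 (lift ord0 i) =
   \sum_(i < (N + M).+1) term M i.+1 * qb (N + M) i.+1 +
   \sum_(i < (N + M).+1) - fconst y * X N * (term M i * qb (N + M) i).
  rewrite -big_split; apply: eq_bigr => i _.
  have iNM : (i <= N + M)%N by rewrite -ltnS.
  rewrite !lift0 qb_pascal1 // mulrDr; congr (_ + _).
  by rewrite mulrA -term_up // -[LHS]mulrA.
rewrite [X in _ = _ + (X + _)]big_ord_recr /= [qb _ (N + M).+1]qb_gt // mulr0 addr0 addrA.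
rewrite [X in _ = X + _](_ : _ = \sum_(k < (N + M).+1) term M k * qb (N + M) k).
  by rewrite mulrBl mul1r -mulr_sumr -mulNr; ring.
by rewrite big_ord_recl /= qbn0 mulr1.
Qed.

Let FS2 N M : F N M = \sum_(k < (N + M).+1) term M k * qb (N + M) k ->
  F N M.+1 = \sum_(k < (N + M.+1).+1) term M.+1 k * qb (N + M.+1) k.
Proof.
move=> IH; have -> : F N M.+1 = (1 - fconst y' * X M.+1) * F N M.
  by rewrite /F big_ord_recr /=; ring.
rewrite IH addnS [RHS]big_ord_recl [X in _ = X + _]/= qbn0 mulr1.
have -> : \sum_(i < (N + M).+1) term M.+1 (lift ord0 i) * qb (N + M).+1 (lift ord0 i) =
   \sum_(i < (N + M).+1) term M i * qb (N + M) i +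
   \sum_(i < (N + M).+1) term M.+1 i.+1 * X i.+1 * qb (N + M) i.+1.
  rewrite -big_split; apply: eq_bigr => i _.
  have iNM : (i <= N + M)%N by rewrite -ltnS.
  rewrite !lift0 qb_pascal2 // mulrDr; congr (_ + _).
    by rewrite -term_shift.
  by rewrite -[RHS]mulrA.
rewrite [X in _ = _ + (_ + X)]big_ord_recr /= [qb _ (N + M).+1]qb_gt // mulr0 addr0.
rewrite mulrBl mul1r addrCA; congr (_ + _).
rewrite -mulNr mulr_sumr big_ord_recl /= qbn0 mulr1; congr (_ + _).
  by rewrite -mulNr term_down fX0 mulr1.
by apply: eq_bigr => i _; rewrite -mulNr mulrA term_down.
Qed.

Let FE N M : F N M = \sum_(k < (N + M).+1) term M k * qb (N + M) k.
Proof.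
elim: M => [|M IH]; last exact: FS2.
by elim: N => [|N IH]; [exact: F00|exact: FS1].
Qed.

(* Times the infinite product, the central binomial coefficients tend to 1. *)
Let qb_cong n k : (k <= n)%N ->
  fcong (minn k (n - k)).+1 (einf 1 * qb n k) 1.
Proof.
move=> kn; rewrite /qb kn.
have -> : einf 1 * (Q n * iQ k * iQ (n - k)%N) =
  (einf 1 * iQ k) * (Q n * iQ (n - k)%N) by ring.
rewrite -[X in fcong _ _ X]mulr1; apply: fcongM.
  rewrite -(QiQ k); apply: fcongM => //; apply/fcong_sym.
  by apply: (@fcong_le _ k.+1); [rewrite ltnS geq_minl|exact: einf_cong].
rewrite -(QiQ (n - k)%N); apply: fcongM => //.
apply: (@fcong_le _ (n - k).+1); first by rewrite ltnS geq_minr.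
by have := @eprod_cong K 1 (n - k)%N k; rewrite subnK.
Qed.

Let thetas_cong N :
  fcong N (\sum_(k < (N + N).+1) term N k) thetas.
Proof.
move=> n nN; rewrite fps_sumE.
rewrite /thetas (@gserE _ _ _ _ _ [seq k%:Z - N%:Z | k <- iota 0 (N + N).+1]).
- rewrite [RHS]big_mkcond big_map.
  have -> : iota 0 (N + N).+1 = index_iota 0 (N + N).+1 by rewrite /index_iota subn0.
  rewrite big_mkord.
  apply: eq_bigr => k _; rewrite /term fconstM fXE eq_sym.
  by case: eqP; rewrite ?mulr1 ?mulr0.
- by rewrite map_inj_uniq ?iota_uniq // => i j /addIr [].
move=> j tj; apply/mapP; exists (absz (j + N%:Z)).
  by rewrite mem_iota; have := triE j; rewrite tj; nia.
by have := triE j; rewrite tj; nia.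
Qed.

(** Jacobi's triple product, as the limit of its finite form. *)
Theorem triple_product :
  thetas = fconst (1 - y) * (einf 1 * (einf y * einf y')).
Proof.
apply: fcong_eq => N.
apply: (@fcong_trans _ _ (einf 1 * F N.+1 N.+1)).
  apply: (fcong_trans (fcong_le (leqnSn N) (fcong_sym (@thetas_cong N.+1)))).
  rewrite FE mulr_sumr; apply: fcong_sum => k _.
  have kn : (k <= N.+1 + N.+1)%N by rewrite -ltnS.
  have -> : einf 1 * (term N.+1 k * qb (N.+1 + N.+1) k) =
    fconst (theta_wt (k%:Z - N.+1%:Z)) *
      (X (tri (k%:Z - N.+1%:Z)) * (einf 1 * qb (N.+1 + N.+1) k)) by rewrite /term; ring.
  apply: fcongM => //; apply: fcong_sym; rewrite -[X in fcong _ _ X]mulr1.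
  apply: (@fcong_le _ (tri (k%:Z - N.+1%:Z) + (minn k (N.+1 + N.+1 - k)).+1)%N); last first.
    by apply: fcong_fXM; apply: qb_cong.
  have := triE (k%:Z - N.+1%:Z); move: (tri _) kn => t kn.
  by rewrite /minn; case: ltnP => ?; nia.
have -> : fconst (1 - y) * (einf 1 * (einf y * einf y')) =
  einf 1 * ((1 - fconst y * X 0) * einf y * einf y').
  by rewrite fX0 mulr1 rmorphB rmorph1; ring.
apply: fcongM => //; rewrite /F big_ord_recl /=; apply: fcongM.
  apply: fcongM => //; apply: (@fcong_le _ N.+1) => //.
  exact: (@einf_cong K y N).
by apply: (@fcong_le _ N.+2); [rewrite ltnW|exact: (@einf_cong K y' N.+1)].
Qed.

End TripleProduct.

(** * The theta series of the hexagonal lattice *)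

Definition qnorm (m : int * int) : nat :=
  absz (m.1 ^+ 2 + m.1 * m.2 + m.2 ^+ 2).

Lemma qnormE m : (qnorm m)%:Z = m.1 ^+ 2 + m.1 * m.2 + m.2 ^+ 2.
Proof. by rewrite /qnorm; nia. Qed.

Lemma finite_fibres_qnorm : finite_fibres qnorm.
Proof.
move=> n; pose s := [seq k%:Z - (2 * n)%:Z | k <- iota 0 (4 * n).+1].
have ms (j : int) : (- (2 * n)%:Z <= j <= (2 * n)%:Z) -> j \in s.
  move=> jn; apply/mapP; exists (absz (j + (2 * n)%:Z)); last by lia.
  by rewrite mem_iota; lia.
exists [seq (i, j) | i <- s, j <- s]; split.
  rewrite allpairs_uniq // => [||[? ?] [? ?] _ _ /= [-> ->] //];
  by rewrite map_inj_uniq ?iota_uniq // => j k /addIr [].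
move=> [i j] ijn; apply/allpairsP; exists (i, j).
have := qnormE (i, j); rewrite /=; move: (qnorm _) ijn => q qn e.
have := sqr_ge0 (2 * i + j); have := sqr_ge0 (2 * j + i).
rewrite !expr2 in e * => hj hi.
have i2 : 3 * (i * i) <= 4 * q%:Z by rewrite e; nia.
have j2 : 3 * (j * j) <= 4 * q%:Z by rewrite e; nia.
by split=> //=; apply: ms; nia.
Qed.

Definition hexagonal (F : numFieldType) : fps F := gser qnorm (fun=> 1).

Lemma cder_gser (K : comNzRingType) (der : {additive K -> K}) (I : choiceType)
    (N : I -> nat) w : finite_fibres N ->
  cder der (gser N w) = gser N (der \o w).
Proof.
move=> fN; apply: fpsP => n; have [r [ur rN]] := fN n.
have rn i : N i = n -> i \in r by move=> e; apply: rN; rewrite e.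
by rewrite -[LHS]/(der (gser N w n)) !(gserE _ ur rn) raddf_sum.
Qed.

Lemma dilate_gser (K : comNzRingType) m (I : choiceType) (N : I -> nat) (w : I -> K) :
  (0 < m)%N -> finite_fibres N ->
  dilate m (gser N w) = gser (fun i => m * N i)%N w.
Proof.
move=> m0 fN; apply: fpsP => n; have [r [ur rN]] := fN n.
rewrite [RHS](gserE _ ur) => [|i e]; last by apply: rN; rewrite -e leq_pmull.
rewrite dilateE (gserE _ ur) => [|i e]; last by apply: rN; rewrite e leq_div.
case: (boolP (m %| n)%N) => [/dvdnP[k ->]|mn].
  by apply: eq_bigl => i /=; rewrite mulnK // [(k * m)%N]mulnC eqn_pmul2l.
rewrite mulr0n big1 // => i /eqP e; case/negP: mn.
by rewrite -e dvdn_mulr.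
Qed.

Section DerTheta.
Variables (K : comNzRingType) (der : {additive K -> K}).
Hypothesis derM : forall x y, der (x * y) = der x * y + x * der y.
Variables (y y' : K).
Hypotheses (yy' : y * y' = 1) (dery : der y = y).

Lemma der_theta_wt j : der (theta_wt y y' j) = j%:~R * theta_wt y y' j.
Proof.
have dX c z m : der z = c%:~R * z -> der ((- z) ^+ m) = (c * m%:Z)%:~R * (- z) ^+ m.
  move=> dz; elim: m => [|m IH]; first by rewrite expr0 der1 // mulr0 mul0r.
  rewrite exprS derM IH raddfN /= dz.
  have -> : (c * m.+1%:Z)%:~R = (c * m%:Z)%:~R + c%:~R :> K.
    by rewrite -rmorphD /=; congr (_%:~R); lia.
  ring.
have dery' : der y' = (-1)%:~R * y'.
  have := derM y y'; rewrite yy' der1 // dery yy' => e.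
  have : y' * (1 + y * der y') = 0 by rewrite -e mulr0.
  rewrite mulrDr mulr1 mulrA [y' * y]mulrC yy' mul1r => /eqP.
  by rewrite addrC addr_eq0 mulrN1z mulN1r => /eqP.
case: j => m.
  by rewrite [LHS](dX 1) ?mul1r // mul1r.
by rewrite [LHS](dX (-1)) // NegzE mulN1r.
Qed.
End DerTheta.

Section Hexagonal.
Variables (F : numFieldType) (w : F).
Hypothesis w3 : w ^+ 2 + w + 1 = 0.

Local Notation a := (cub_a F).
Local Notation P := (einf (1 : F)).
Local Notation P3 := (dilate 3 P).
Let tf := @torsion_free_num F.
Let tff : torsion_free (fps F) := torsion_free_fps tf.

Definition theta_der (y y' : F) : fps F :=
  gser tri (fun j => j%:~R * theta_wt y y' j).

Let Ev := fmap (@fps_at0 F).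

(** Over power series in u, with y e^u in place of y, the derivative in u of the
    triple product yields the weighted theta series at u = 0.  The factor 1 - y
    is kept outside the product so that y = 1 is allowed. *)
Lemma theta_derE (y y' : F) : y * y' = 1 ->
  thetas y y' = fconst (1 - y) * (P * (einf y * einf y')) /\
  theta_der y y' = fconst (1 - y) * (P * (einf y * einf y')) *
      (lamb (fun d _ => y' ^+ d) - lamb (fun d _ => y ^+ d))
    - fconst y * (P * (einf y * einf y')).
Proof.
move=> yy'; split; first exact: triple_product.
pose E : fps F := fconst y * fexp 1; pose E' : fps F := fconst y' * fexp (-1).
have EE' : E * E' = 1.
  have -> : E * E' = fconst y * fconst y' * (fexp 1 * fexp (-1)) by rewrite /E /E'; ring.
  by rewrite -rmorphM yy' fexpN rmorph1 mulr1.
have dconst (c : F) : fderiv (fconst c) = 0 by apply: fpsP => n /=; rewrite mul0rn.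
have derE : fderiv E = E.
  by rewrite /E fderivM fderiv_fexp rmorph1 mul1r dconst mul0r add0r.
have derE' : fderiv E' = - E'.
  by rewrite /E' fderivM fderiv_fexp rmorphN rmorph1 dconst; ring.
have evE : fps_at0 E = y by rewrite /fps_at0 fpsME0 /= expr0 fact0 divr1 mulr1 mulr1n.
have evE' : fps_at0 E' = y' by rewrite /fps_at0 fpsME0 /= expr0 fact0 divr1 mulr1 mulr1n.
clearbody E E'.
have -> : theta_der y y' = Ev (cder (@fderiv F) (thetas E E')).
  rewrite /Ev /thetas (cder_gser _ _ finite_fibres_tri) (gser_fmap _ _ finite_fibres_tri).
  apply: eq_gser => j; rewrite -[RHS]/(fps_at0 (fderiv (theta_wt E E' j))).
  have -> : fderiv (theta_wt E E' j) = j%:~R * theta_wt E E' j.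
    exact: (der_theta_wt (@fderivM F) EE' derE).
  have evX (z : fps F) c m : fps_at0 z = c -> fps_at0 ((- z) ^+ m) = (- c) ^+ m.
    by move=> <-; rewrite rmorphXn rmorphN.
  rewrite rmorphM rmorph_int; congr (_ * _).
  by case: j => m; apply/esym/evX.
rewrite (triple_product EE').
pose L : fps (fps F) := lamb (fun d _ => E ^+ d).
pose L' : fps (fps F) := lamb (fun d _ => E' ^+ d).
have cd1 : cder (@fderiv F) (einf (1 : fps F)) = 0.
  have d1 : fderiv (1 : fps F) = 0 * 1 by rewrite mul0r fderiv1.
  have d0 : fderiv (0 : fps F) = 0 by apply: fpsP => n /=; rewrite mul0rn.
  by rewrite (cder_einf (@fderivM F) tff d1 d0) rmorph0 oppr0 !mul0r.
have cdE : cder (@fderiv F) (einf E) = - einf E * L.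
  have dE : fderiv E = 1 * E by rewrite mul1r.
  by rewrite (cder_einf (@fderivM F) tff dE (fderiv1 F)) rmorph1 mulN1r.
have cdE' : cder (@fderiv F) (einf E') = einf E' * L'.
  have dE : fderiv E' = -1 * E' by rewrite mulN1r.
  have d1 : fderiv (-1 : fps F) = 0 by rewrite raddfN /= fderiv1 oppr0.
  by rewrite (cder_einf (@fderivM F) tff dE d1) rmorphN rmorph1 opprK mul1r.
have cdy : cder (@fderiv F) (fconst (1 - E)) = - fconst E.
  by rewrite cder_const raddfB /= fderiv1 derE sub0r rmorphN.
have e1 : Ev (einf 1) = P by rewrite /Ev fmap_einf rmorph1.
have eE : Ev (einf E) = einf y by rewrite /Ev fmap_einf -evE.
have eE' : Ev (einf E') = einf y' by rewrite /Ev fmap_einf -evE'.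
have eL : Ev L = lamb (fun d _ => y ^+ d).
  by rewrite /Ev /L fmap_lamb; apply: eq_lamb => d x _ _; rewrite rmorphXn -evE.
have eL' : Ev L' = lamb (fun d _ => y' ^+ d).
  by rewrite /Ev /L' fmap_lamb; apply: eq_lamb => d x _ _; rewrite rmorphXn -evE'.
have ec : Ev (fconst (1 - E)) = fconst (1 - y).
  by rewrite /Ev fmap_const; congr fconst; rewrite rmorphB rmorph1 -evE.
have ey : Ev (fconst E) = fconst y by rewrite /Ev fmap_const -evE.
move: cd1 cdE cdE' cdy e1 eE eE' eL eL' ec ey.
move: (einf (1 : fps F)) (einf E) (einf E') L L' (fconst (1 - E)) (fconst E).
move=> x1 x2 x3 x4 x5 x6 x7 cd1 cd2 cd3 cd6 e1 e2 e3 e4 e5 e6 e7.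
rewrite !(cderM (@fderivM F)) cd1 cd2 cd3 cd6.
have -> : Ev (- x7 * (x1 * (x2 * x3)) + x6 * (0 * (x2 * x3) +
     x1 * (- x2 * x4 * x3 + x2 * (x3 * x5)))) =
   - Ev x7 * (Ev x1 * (Ev x2 * Ev x3)) +
     Ev x6 * (Ev x1 * (- Ev x2 * Ev x4 * Ev x3 + Ev x2 * (Ev x3 * Ev x5))).
  by rewrite /Ev; ring.
rewrite e1 e2 e3 e4 e5 e6 e7; ring.
Qed.

Let theta_wtE (y y' : F) j : y * y' = 1 -> theta_wt y y' j = (- y) ^ j.
Proof.
move=> yy'; have y0 : y != 0 by apply: contra_eq_neq yy' => ->; rewrite mul0r eq_sym oner_eq0.
have -> : y' = y^-1 by rewrite -[y']mul1r -(mulVf y0) -mulrA yy' mulr1.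
by case: j => m //=; rewrite -invrN exprVn.
Qed.

Let root3_int (j : int) : w ^ j + (w ^+ 2) ^ j = -1 + 3 * (3 %| absz j)%N%:R.
Proof.
have ww : w * w ^+ 2 = 1.
  have : (w - 1) * (w ^+ 2 + w + 1) = 0 by rewrite w3 mulr0.
  move=> /eqP; rewrite (_ : _ * _ = w * w ^+ 2 - 1) ?subr_eq0 => [/eqP //|]; ring.
have w0 : w != 0 by apply: contra_eq_neq ww => ->; rewrite mul0r eq_sym oner_eq0.
have wV : w^-1 = w ^+ 2 by rewrite -[LHS]mulr1 -ww mulKf.
case: j => m; first exact: root3_sum.
have nz (z : F) : z ^ Negz m = z^-1 ^+ m.+1 by rewrite exprVn.
by rewrite !nz wV -[in X in _ + X]wV invrK addrC; apply: root3_sum.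
Qed.

Let N3 (p : (int * int) * int) := (tri p.1.1 + tri p.1.2 + tri p.2)%N.
Let s3 (p : (int * int) * int) := p.1.1 + p.1.2 + p.2.

Let theta_cube (y y' : F) : y * y' = 1 ->
  thetas y y' ^+ 2 * theta_der y y' = gser N3 (fun p => p.2%:~R * (- y) ^ s3 p).
Proof.
move=> yy'; rewrite expr2 /thetas /theta_der gserM; try exact: finite_fibres_tri.
rewrite gserM; [|apply: finite_fibresM|]; try exact: finite_fibres_tri.
apply: eq_gser => -[[i j] k] /=; rewrite !theta_wtE //.
have y0 : - y != 0.
  by rewrite oppr_eq0; apply: contra_eq_neq yy' => ->; rewrite mul0r eq_sym oner_eq0.
by rewrite /s3 !expfzDr //= mulrCA mulrA.
Qed.

(* A triple of integers with sum 3 t is (t + m_1, t + m_2, t - m_1 - m_2); the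
   quadratic exponent then separates into that of t and the hexagonal form. *)
Let h (q : int * (int * int)) : (int * int) * int :=
  ((q.1 + q.2.1, q.1 + q.2.2), q.1 - q.2.1 - q.2.2).

Let M3 (q : int * (int * int)) := (3 * tri q.1 + qnorm q.2)%N.

Let N3h q : N3 (h q) = M3 q.
Proof.
case: q => t [m1 m2]; rewrite /N3 /M3 /h /=.
have := qnormE (m1, m2); have := triE t; have := triE (t + m1).
have := triE (t + m2); have := triE (t - m1 - m2); rewrite !mulr2n /=.
move: (tri _) (tri _) (tri _) (tri _) (qnorm _) => b b1 b2 b3 c e3 e2 e1 e e'.
suff : (b1%:Z + b1%:Z) + (b2%:Z + b2%:Z) + (b3%:Z + b3%:Z) =
  3 * (b%:Z + b%:Z) + 2 * c%:Z by lia.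
rewrite e1 e2 e3 e e'; ring.
Qed.

Let h_inj : injective h.
Proof. by move=> [t [m1 m2]] [t' [m1' m2']] [] e1 e2 e3; congr (_, (_, _)); lia. Qed.

(* The sum over the cube roots of unity keeps the triples whose sum is a multiple
   of 3.  One factor carries the weight n_3, because theta itself vanishes at
   y = 1; the part of the weight that is odd in (m_1, m_2) sums to zero. *)
Let cube_sum :
  gser N3 (fun p => p.2%:~R * ((- 1) ^ s3 p + (- w) ^ s3 p + (- w ^+ 2) ^ s3 p)) =
  3 * (dilate 3 (theta_der 1 1) * hexagonal F).
Proof.
have wt p : (- 1) ^ s3 p + (- w) ^ s3 p + (- w ^+ 2) ^ s3 p =
    3 * (3 %| absz (s3 p))%N%:R * (-1) ^ s3 p.
  rewrite (expNrz w) (expNrz (w ^+ 2)).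
  have := root3_int (s3 p) => e.
  transitivity ((-1) ^ s3 p * (1 + (w ^ s3 p + (w ^+ 2) ^ s3 p))); first by ring.
  rewrite e; ring.
rewrite (eq_gser _ (v := fun p => 3 * (3 %| absz (s3 p))%N%:R * (-1) ^ s3 p * p.2%:~R));
  last by move=> p; rewrite wt mulrC.
rewrite (gser_reindex h_inj N3h) => [|[[i j] k]]; last first.
  case: (boolP (3 %| absz (s3 (i, j, k)))%N) => [|_]; last by rewrite mulr0 !mul0r eqxx.
  rewrite /s3 /= => d _; pose t := ((i + j + k) %/ 3)%Z.
  have e : i + j + k = t * 3 by rewrite /t divzK.
  exists (t, (i - t, j - t)); rewrite /h /=; congr ((_, _), _); lia.
have f3 : finite_fibres (fun t => 3 * tri t)%N.
  move=> n; have [r [ur rN]] := finite_fibres_tri n; exists r; split=> // i.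
  by move=> ti; apply: rN; apply: leq_trans ti; apply: leq_pmull.
have fM : finite_fibres M3 := finite_fibresM f3 finite_fibres_qnorm.
pose w1 (t : int) : F := 3 * (-1) ^ t.
rewrite (eq_gser _ (v := fun q => w1 q.1 * q.1%:~R * 1 +
    w1 q.1 * - (q.2.1 + q.2.2)%:~R)); last first.
  move=> [] t [] /= m1 m2; pose u : int := t.
  have -> : s3 (h (t, (m1, m2))) = u * 3 by rewrite /s3 /h /= /u; lia.
  have -> : (3 %| absz (u * 3)%R)%N by rewrite abszM dvdn_mull.
  have -> : (-1) ^ (u * 3) = (-1) ^ u :> F.
    rewrite mulrC -exprz_exp; congr (_ ^ _).
    by rewrite -[LHS]/((-1) ^+ 3); ring.
  by rewrite /w1 /u !rmorphB rmorphD /=; ring.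
rewrite -gserD //.
have -> : gser M3 (fun q => w1 q.1 * - (q.2.1 + q.2.2)%:~R) =
    gser (fun t => 3 * tri t)%N w1 * gser qnorm (fun m => - (m.1 + m.2)%:~R).
  by rewrite gserM //; exact: finite_fibres_qnorm.
have -> : gser qnorm (fun m => - (m.1 + m.2)%:~R) = 0 :> fps F.
  apply: (tff (n := 2)) => //; rewrite mulr2n.
  rewrite [X in _ + X](@gser_reindex _ _ _ _ qnorm _ (fun m => (- m.1, - m.2))).
  - rewrite gserD; last exact: finite_fibres_qnorm.
    rewrite (eq_gser _ (v := fun=> 0)) => [|m /=].
      by apply: fpsP => n /=; rewrite fsbig1.
    by rewrite -[- m.1 - m.2]opprD mulrNz opprK addNr.
  - by move=> [? ?] [? ?] [] /oppr_inj -> /oppr_inj ->.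
  - by move=> m; rewrite /qnorm /= !sqrrN mulrNN.
  - by move=> m _; exists (- m.1, - m.2); rewrite /= !opprK; case: m.
rewrite mulr0 addr0.
have -> : gser M3 (fun q => w1 q.1 * q.1%:~R * 1) =
    gser (fun t => 3 * tri t)%N (fun t => w1 t * t%:~R) * hexagonal F.
  by rewrite /hexagonal gserM //; exact: finite_fibres_qnorm.
rewrite mulrA; congr (_ * _).
rewrite /theta_der dilate_gser //; last exact: finite_fibres_tri.
rewrite -(rmorph_nat (@fconst F)) gserZ //; apply: eq_gser => t.
by rewrite theta_wtE ?mulr1 // /w1; ring.
Qed.

Let theta11 : thetas 1 1 = 0 :> fps F.
Proof. by have [-> _] := theta_derE (mulr1 (1 : F)); rewrite subrr rmorph0 mul0r. Qed.

Let theta_der11 : theta_der 1 1 = - P ^+ 3.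
Proof.
have [_ ->] := theta_derE (mulr1 (1 : F)).
rewrite subrr rmorph0 rmorph1; ring.
Qed.

Let cube_root y y' : y ^+ 2 + y + 1 = 0 -> y' = y ^+ 2 -> y * y' = 1 ->
  6 * (thetas y y' ^+ 2 * theta_der y y') =
  P3 ^+ 3 * (18 * fconst y' - 9 * (a - 1)).
Proof.
move=> y3 y'E yy'; have [-> ->] := theta_derE yy'.
rewrite {1 2 4}y'E (einf_root3 y3).
have -> : lamb (fun d _ => y' ^+ d) - lamb (fun d _ => y ^+ d) =
    - (fconst (y - y ^+ 2) * lamb (fun d _ => (chi3 d)%:~R)).
  rewrite lambZ lambN lambN lambD; apply: eq_lamb => d x _ _.
  by rewrite y'E -(root3_diff y3); ring.
have -> : a - 1 = 6 * lamb (fun d _ => (chi3 d)%:~R) by rewrite /cub_a; ring.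
set l := lamb _.
pose Y := fconst y; have Y2 : Y ^+ 2 = - Y - 1.
  apply/eqP; rewrite -subr_eq0; apply/eqP.
  by rewrite -[RHS](rmorph0 (@fconst F)) -y3 !rmorphD rmorphXn rmorph1 /Y; ring.
have -> : fconst (1 - y) = 1 - Y by rewrite rmorphB rmorph1.
have -> : fconst (y - y ^+ 2) = Y - Y ^+ 2 by rewrite rmorphB rmorphXn.
have -> : fconst y' = - Y - 1 by rewrite y'E rmorphXn.
rewrite -/Y.
have e1 : (1 - Y) ^+ 2 = - 3 * Y.
  by transitivity (Y ^+ 2 - 2 * Y + 1); [ring|rewrite Y2; ring].
transitivity (P3 ^+ 3 * ((1 - Y) ^+ 2 * (- 6 * Y * (1 - Y) ^+ 2 * l - 6 * Y)));
  first by ring.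
rewrite e1.
transitivity (P3 ^+ 3 * (18 * Y ^+ 2 - 54 * Y ^+ 2 * Y * l)); first by ring.
rewrite Y2; transitivity (P3 ^+ 3 * (18 * (- Y - 1) + 54 * (Y ^+ 2 + Y) * l));
  first by ring.
rewrite Y2; ring.
Qed.

(** In [cube_sum] the term at y = 1 vanishes, and the terms at w and w^2 are
    given by [theta_derE], where the logarithmic derivative is the Lambert
    series of the character.  The factor theta' (1) = - P^3 at q^3 cancels
    against the products at w and w^2. *)
Theorem hexagonal_lambert : hexagonal F = cub_a F.
Proof.
have ww : w * w ^+ 2 = 1.
  have : (w - 1) * (w ^+ 2 + w + 1) = 0 by rewrite w3 mulr0.
  move=> /eqP; rewrite (_ : _ * _ = w * w ^+ 2 - 1) ?subr_eq0 => [/eqP //|]; ring.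
have ww' : w = (w ^+ 2) ^+ 2.
  by rewrite -[LHS]mulr1 -ww; ring.
have w3' : (w ^+ 2) ^+ 2 + w ^+ 2 + 1 = 0 by rewrite -ww' [w + _]addrC.
have e1 := cube_root w3 erefl ww.
have e2 := cube_root w3' ww' (etrans (mulrC _ _) ww).
have := cube_sum; rewrite (eq_gser _ (v := fun p => p.2%:~R * (- 1) ^ s3 p +
   (p.2%:~R * (- w) ^ s3 p + p.2%:~R * (- w ^+ 2) ^ s3 p))); last first.
  by move=> p; rewrite !mulrDr addrA.
have fN : finite_fibres N3.
  by apply: (finite_fibresM (finite_fibresM _ _)); exact: finite_fibres_tri.
rewrite -gserD // -gserD // -(theta_cube (mulr1 _)) -(theta_cube ww).
rewrite -(theta_cube (etrans (mulrC _ _) ww)) theta11 theta_der11.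
rewrite expr2 !mul0r add0r raddfN /= dilateX // => e.
have [g gP] : exists g, P3 ^+ 3 * g = 1.
  by apply: (@fps_inv _ _ 1); rewrite fpsXE0 dilate0E einf0 expr1n mulr1.
apply: (natmul_inj tff (isT : 0 < 18)%N) => /=.
rewrite -[LHS]mul1r -[RHS]mul1r -{1 3}gP.
transitivity (- 6 * g * (3 * (- P3 ^+ 3 * hexagonal F))); first by ring.
rewrite -e.
have -> x y : - 6 * g * (x + y) = - g * (6 * x + 6 * y) :> fps F by ring.
rewrite e1 e2.
have -> : fconst (w ^+ 2) = - fconst w - 1.
  apply/eqP; rewrite -subr_eq0; apply/eqP.
  by rewrite -[RHS](rmorph0 (@fconst F)) -w3 !rmorphD rmorph1; ring.
ring.
Qed.

End Hexagonal.

(** * Counting representations *)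

Definition qform_nat k (x : (k.*2).-tuple int) : nat := absz (qform x).

Lemma qform_cons k (m : int * int) (x : (k.*2).-tuple int) :
  qform (k := k.+1) [tuple of m.1 :: m.2 :: x] = (qnorm m)%:Z + qform x.
Proof. by rewrite /qform big_ord_recl qnormE. Qed.

Lemma qform_ge0 k (x : (k.*2).-tuple int) : 0 <= qform x.
Proof.
apply: sumr_ge0 => j _; move: (x`_ _) (x`_ _) => a b.
by have := sqr_ge0 (2 * a + b); have := sqr_ge0 b; nia.
Qed.

Lemma qform_natE k (x : (k.*2).-tuple int) : (qform_nat x)%:Z = qform x.
Proof. by rewrite /qform_nat; have := qform_ge0 x; lia. Qed.

Section Representations.
Variable F : numFieldType.

Let cons2 k (p : (int * int) * (k.*2).-tuple int) : (k.+1.*2).-tuple int :=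
  [tuple of p.1.1 :: p.1.2 :: p.2].

Let cons2_inj k : injective (@cons2 k).
Proof.
move=> [[a b] x] [[c d] y] /(congr1 val) /= [-> -> e].
by congr (_, _); apply: val_inj.
Qed.

Let cons2_surj k (y : (k.+1.*2).-tuple int) : exists p, @cons2 k p = y.
Proof.
case/tupleP: y => a y; case/tupleP: y => b y.
by exists ((a, b), y); apply: val_inj.
Qed.

Let cons2_nat k (p : (int * int) * (k.*2).-tuple int) :
  qform_nat (cons2 p) = (qnorm p.1 + qform_nat p.2)%N.
Proof.
have := qform_natE (cons2 p); rewrite {2}/cons2 qform_cons -qform_natE.
lia.
Qed.

Lemma finite_fibres_qform k : finite_fibres (@qform_nat k).
Proof.
elim: k => [|k IH] n; first by exists [:: [tuple]]; split=> // x _; rewrite tuple0 inE.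
have [r [ur rN]] := finite_fibresM finite_fibres_qnorm IH n.
exists (map (@cons2 k) r); split; first by rewrite map_inj_uniq //; exact: cons2_inj.
move=> y; have [p <-] := cons2_surj y; rewrite cons2_nat => pn.
by apply: map_f; apply: rN.
Qed.

Lemma gser_qform k : gser (@qform_nat k) (fun=> 1) = hexagonal F ^+ k.
Proof.
elim: k => [|k IH].
  apply: fpsP => n; rewrite expr0 fps1E (gserE _ (r := [:: [tuple]])) //; last first.
    by move=> i _; rewrite tuple0 inE.
  have e : @qform_nat 0 [tuple] = 0%N by rewrite /qform_nat /qform big_ord0.
  by rewrite big_cons big_nil e eq_sym; case: eqP; rewrite ?addr0.
rewrite (gser_reindex (@cons2_inj k) (@cons2_nat k)) => [|y _]; last exact: cons2_surj.
rewrite exprS -IH /hexagonal gserM; [|exact: finite_fibres_qnorm|exact: finite_fibres_qform].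
by apply: eq_gser => p /=; rewrite mulr1.
Qed.

(** The set of representations is finite, so that its cardinal is the sum of 1
    over it. *)
Lemma nrepE k n : (nrep k n)%:R = (hexagonal F ^+ k) n.
Proof.
rewrite -gser_qform /nrep; set A := [set _ | _]%classic.
have [s [us sN]] := @finite_fibres_qform k n.
have AE x : A x <-> qform_nat x = n.
  by rewrite /A /= -qform_natE; split=> [[]|->].
have fA : finite_set A.
  apply: sub_finite_set (finite_seq s) => x /AE e /=.
  by apply: sN; rewrite e.
rewrite (gserE _ (r := fset_set A)) => [||x xn]; first last.
- by rewrite in_fset_set // inE; apply/AE.
- exact: fset_uniq.
rewrite [RHS]big_seq_cond (eq_bigl (fun x => (x \in fset_set A) && true)) => [|x].
  by rewrite -big_seq_cond big_const_seq count_predT iter_addr_0.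
rewrite andbT; apply/andb_idr; rewrite in_fset_set // inE => /AE ->.
exact: eqxx.
Qed.

End Representations.

(** * The character modulo 3 *)

Lemma legendre3 d : legendre 3 d = chi3 d.
Proof.
rewrite /legendre /chi3; case: ifP => // d3.
have -> : [exists x : 'I_3, x ^ 2 == d %[mod 3]] = (3 %| d.-1)%N => //.
apply/existsP/idP => [[x /eqP]|d1].
  case: x => -[|[|[|//]]] _ /=; lia.
by exists (inord 1); rewrite inordK //; lia.
Qed.

Lemma rhoE (F : numFieldType) l n : (0 < n)%N ->
  (rho l n)%:~R = 3 ^+ l./2 * eis_chi' F l n + (-1) ^+ l./2 * eis_chi F l n.
Proof.
move=> n0; rewrite /rho rmorph_sum /eis_chi' /eis_chi !lambE // !mulr_sumr -big_split.
apply: eq_bigr => d _; rewrite !legendre3 rmorphM rmorphD !rmorphM !rmorphXn rmorphN1.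
by rewrite rmorph_nat mulrDl !mulrA.
Qed.

(** * Evaluation of power series on the unit interval *)

Section Evaluation.
Local Open Scope classical_set_scope.
Local Open Scope ring_scope.
Variable R : realType.
Implicit Types (f g : fps R) (t s : R).

Definition pterm f t : nat -> R := fun n => f n * t ^+ n.
Definition psum f t N := \sum_(0 <= n < N) pterm f t n.
(** Partial sums of absolute values.  They are subadditive and submultiplicative
    in f, so that convergence is handled through bounds. *)
Definition nsum f t N := \sum_(0 <= n < N) `|pterm f t n|.

Definition psummable f t := exists M, forall N, nsum f t N <= M.

Definition peval f t : R := lim (psum f t @ \oo).

Lemma nsum_ge0 f t N : 0 <= nsum f t N.
Proof. by apply: sumr_ge0. Qed.

Lemma nsum_ge f t N M : (N <= M)%N -> nsum f t N <= nsum f t M.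
Proof.
move=> NM; rewrite /nsum (@big_cat_nat _ _ _ N 0 M) //= lerDl.
by apply: sumr_ge0.
Qed.

Lemma nsum_cvg f t : psummable f t -> cvgn (nsum f t).
Proof.
move=> [M fM]; apply: nondecreasing_is_cvgn => [m n|]; first exact: nsum_ge.
by exists M => _ [N _ <-].
Qed.

Lemma peval_cvg f t : psummable f t -> psum f t @ \oo --> peval f t.
Proof. by move=> /nsum_cvg; exact: normed_cvg. Qed.

Lemma pevalE f t l : psum f t @ \oo --> l -> peval f t = l.
Proof. by move=> h; apply: cvg_lim => //; exact: norm_hausdorff. Qed.

Lemma peval_norm f t M : (forall N, nsum f t N <= M) -> `|peval f t| <= M.
Proof.
move=> fM; have := peval_cvg (ex_intro _ M fM) => /cvg_norm h.
apply: (cvgr_to_le h); apply: nearW => N; apply: le_trans (fM N).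
exact: ler_norm_sum.
Qed.

Lemma ptermD f g t n : pterm (f + g) t n = pterm f t n + pterm g t n.
Proof. by rewrite /pterm fpsDE mulrDl. Qed.

Lemma nsumD f g t N : nsum (f + g) t N <= nsum f t N + nsum g t N.
Proof. by rewrite -big_split; apply: ler_sum => n _; rewrite ptermD ler_normD. Qed.

Lemma nsumN f t N : nsum (- f) t N = nsum f t N.
Proof. by apply: eq_bigr => n _; rewrite /pterm fpsNE mulNr normrN. Qed.

Lemma pevalD f g t : psummable f t -> psummable g t ->
  peval (f + g) t = peval f t + peval g t.
Proof.
move=> sf sg; apply: pevalE.
have -> : psum (f + g) t = (fun N => psum f t N + psum g t N).
  by apply/funext => N; rewrite -big_split; apply: eq_bigr => n _; rewrite ptermD.
by apply: cvgD; exact: peval_cvg.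
Qed.

Lemma pevalN f t : psummable f t -> peval (- f) t = - peval f t.
Proof.
move=> sf; apply: pevalE.
have -> : psum (- f) t = (fun N => - psum f t N).
  by apply/funext => N; rewrite -sumrN; apply: eq_bigr => n _; rewrite /pterm mulNr.
by apply: cvgN; exact: peval_cvg.
Qed.

Let cauchy (a b : nat -> R) N :
  \sum_(0 <= n < N) \sum_(i < n.+1) a i * b (n - i)%N =
  \sum_(i < N) a i * \sum_(0 <= j < N - i) b j.
Proof.
elim: N => [|N IH]; first by rewrite big_nil big_ord0.
rewrite big_nat_recr //= IH [RHS]big_ord_recr /= !big_ord_recr /= addrA -big_split /=.
congr (_ + _); last by rewrite subSn // subnn big_nat1.
apply: eq_bigr => i _; have iN : (i <= N)%N by apply: ltnW.
by rewrite subSn // big_nat_recr //= mulrDr.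
Qed.

Lemma ptermM f g t n :
  pterm (f * g) t n = \sum_(i < n.+1) pterm f t i * pterm g t (n - i)%N.
Proof.
rewrite /pterm fpsME mulr_suml; apply: eq_bigr => i _.
have iN : (i <= n)%N by rewrite -ltnS.
have -> : t ^+ n = t ^+ i * t ^+ (n - i)%N by rewrite -exprD subnKC.
by rewrite mulrACA.
Qed.

Let cauchy_norm (a b : nat -> R) N (A := fun n => `|a n|) (B := fun n => `|b n|) :
  `| (\sum_(0 <= n < N) a n) * (\sum_(0 <= n < N) b n)
     - \sum_(0 <= n < N) \sum_(i < n.+1) a i * b (n - i)%N | <=
  (\sum_(0 <= n < N) A n) * (\sum_(0 <= n < N) B n)
     - \sum_(0 <= n < N) \sum_(i < n.+1) A i * B (n - i)%N.
Proof.
have tail (c d : nat -> R) : (\sum_(0 <= n < N) c n) * (\sum_(0 <= n < N) d n)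
     - \sum_(0 <= n < N) \sum_(i < n.+1) c i * d (n - i)%N =
   \sum_(i < N) c i * \sum_(N - i <= j < N) d j.
  rewrite cauchy [X in X * _]big_mkord mulr_suml -sumrB; apply: eq_bigr => i _.
  by rewrite (@big_cat_nat _ _ _ (N - i) 0 N) ?leq_subr //= mulrDr addrAC subrr add0r.
rewrite !tail; apply: le_trans (ler_norm_sum _ _ _) _; apply: ler_sum => i _.
by rewrite normrM ler_wpM2l // ler_norm_sum.
Qed.

Let half_cvg : (fun N => N./2) @ \oo --> \oo.
Proof.
apply/cvgnyPge => A; exists (A.*2) => // n /= An.
by rewrite -(doubleK A) half_leq.
Qed.

Lemma nsumM f g t N : nsum (f * g) t N <= nsum f t N * nsum g t N.
Proof.
have := @cauchy_norm (pterm f t) (pterm g t) N.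
move=> /(le_trans (normr_ge0 _)); rewrite subr_ge0; apply: le_trans.
apply: ler_sum => n _; rewrite ptermM; apply: le_trans (ler_norm_sum _ _ _) _.
by apply: ler_sum => i _; rewrite normrM.
Qed.

(** The difference of the partial sums of a Cauchy product and of the product
    of the partial sums is largest when all terms are nonnegative, where it is
    squeezed between products of partial sums. *)
Lemma pevalM f g t : psummable f t -> psummable g t ->
  peval (f * g) t = peval f t * peval g t.
Proof.
move=> sf sg; apply: pevalE.
have cf := peval_cvg sf; have cg := peval_cvg sg.
pose A N := nsum f t N; pose B N := nsum g t N.
pose T N := \sum_(0 <= n < N) \sum_(i < n.+1) `|pterm f t i| * `|pterm g t (n - i)%N|.
have cA : A @ \oo --> limn A by exact: nsum_cvg.
have cB : B @ \oo --> limn B by exact: nsum_cvg.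
have cAB : (fun N => A N * B N) @ \oo --> limn A * limn B by exact: cvgM.
have cAB2 : (fun N => A N./2 * B N./2) @ \oo --> limn A * limn B.
  exact: (cvg_comp _ _ half_cvg cAB).
have TAB N : A N./2 * B N./2 <= T N.
  rewrite /T (cauchy (fun n => `|pterm f t n|) (fun n => `|pterm g t n|)).
  rewrite -(big_mkord predT (fun i => `|pterm f t i| *
     \sum_(0 <= j < N - i) `|pterm g t j|)).
  have hN : (N./2 <= N)%N by lia.
  rewrite (@big_cat_nat _ _ _ N./2 0 N) //= -[leLHS]addr0; apply: lerD; last first.
    by apply: sumr_ge0 => i _; apply: mulr_ge0 => //; exact: sumr_ge0.
  rewrite mulr_suml; apply: ler_sum_nat => i /andP[_ iN]; apply: ler_wpM2l => //.
  by apply: nsum_ge; lia.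
have TAB' N : T N <= A N * B N.
  have := @cauchy_norm (pterm f t) (pterm g t) N.
  by move=> /(le_trans (normr_ge0 _)); rewrite subr_ge0.
have cT : T @ \oo --> limn A * limn B.
  by apply: (squeeze_cvgr _ cAB2 cAB); apply: nearW => N; rewrite TAB TAB'.
have c0 : (fun N => A N * B N - T N) @ \oo --> (0 : R).
  by rewrite -(subrr (limn A * limn B)); exact: cvgB.
have d0 : (fun N => psum f t N * psum g t N - psum (f * g) t N) @ \oo --> (0 : R).
  apply: (squeeze_cvgr _ _ c0); last first.
    by rewrite -oppr0; exact: (cvgN c0).
  apply: nearW => N; rewrite -ler_norml.
  have -> : psum (f * g) t N = \sum_(0 <= n < N) \sum_(i < n.+1)
     pterm f t i * pterm g t (n - i)%N by apply: eq_bigr => n _; rewrite ptermM.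
  exact: cauchy_norm.
have -> : psum (f * g) t = (fun N => psum f t N * psum g t N -
   (psum f t N * psum g t N - psum (f * g) t N)).
  by apply/funext => N; rewrite opprB addrC subrK.
by rewrite -[X in _ --> X]subr0; apply: cvgB d0; exact: cvgM.
Qed.

Lemma nsum_const c t N : nsum (fconst c) t N <= `|c|.
Proof.
case: N => [|N]; first by rewrite /nsum big_nil.
rewrite /nsum big_nat_recl // /pterm fconstE mulr1n expr0 mulr1 big1 ?addr0 // => n _.
by rewrite fconstE mulr0n mul0r normr0.
Qed.

Lemma nsum_fX m t N : 0 <= t -> nsum (fX R m) t N <= t ^+ m.
Proof.
move=> t0; have tm : 0 <= t ^+ m by exact: exprn_ge0.
have e n : `|pterm (fX R m) t n| = if n == m then t ^+ m else 0.
  rewrite /pterm fXE; case: eqP => [->|_]; first by rewrite mul1r ger0_norm.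
  by rewrite mul0r normr0.
rewrite /nsum (eq_bigr _ (fun n _ => e n)) -big_mkcond /= big_nat_cond.
case: (ltnP m N) => mN.
  rewrite (eq_bigl (fun n => n == m)) => [|n]; last first.
    by rewrite andb_idl // => /eqP ->; rewrite mN.
  by rewrite /index_iota subn0 -big_filter filter_pred1_uniq ?iota_uniq ?big_seq1 ?mem_iota.
by rewrite big_pred0 // => n; apply/negP => /andP[/andP[_ nN] /eqP nm]; lia.
Qed.

(** ** Series that converge absolutely on the open unit interval *)

Definition disc f := forall t, 0 < t < 1 -> psummable f t.

Lemma discD f g : disc f -> disc g -> disc (f + g).
Proof.
move=> df dg t t01; have [M fM] := df _ t01; have [M' gM] := dg _ t01.
by exists (M + M') => N; apply: le_trans (nsumD _ _ _ _) _; exact: lerD.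
Qed.

Lemma discN f : disc f -> disc (- f).
Proof. by move=> df t t01; have [M fM] := df _ t01; exists M => N; rewrite nsumN. Qed.

Lemma discB f g : disc f -> disc g -> disc (f - g).
Proof. by move=> df dg; apply: discD => //; exact: discN. Qed.

Lemma discM f g : disc f -> disc g -> disc (f * g).
Proof.
move=> df dg t t01; have [M fM] := df _ t01; have [M' gM] := dg _ t01.
exists (M * M') => N; apply: le_trans (nsumM _ _ _ _) _.
by apply: ler_pM => //; exact: nsum_ge0.
Qed.

Lemma disc_const c : disc (fconst c).
Proof. by move=> t _; exists `|c| => N; exact: nsum_const. Qed.

Lemma disc_nat m : disc m%:R.
Proof. by rewrite -(rmorph_nat (@fconst R)); exact: disc_const. Qed.

Lemma discX f k : disc f -> disc (f ^+ k).
Proof.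
move=> df; elim: k => [|k IH]; first exact: (disc_nat 1).
by rewrite exprS; exact: discM.
Qed.

Lemma disc_fX m : disc (fX R m).
Proof. by move=> t /andP[t0 _]; exists (t ^+ m) => N; apply: nsum_fX; exact: ltW. Qed.

Lemma peval_const c t : peval (fconst c) t = c.
Proof.
apply: pevalE; rewrite -(cvg_shiftS _).
have -> : (fun N => psum (fconst c) t N.+1) = (fun=> c).
  apply/funext => N; rewrite /psum big_nat_recl // /pterm fconstE mulr1n expr0 mulr1.
  by rewrite big1 ?addr0 // => n _; rewrite fconstE mulr0n mul0r.
exact: cvg_cst.
Qed.

Lemma peval_nat m t : peval m%:R t = m%:R.
Proof. by rewrite -(rmorph_nat (@fconst R)) peval_const. Qed.

Lemma pevalX f k t : psummable f t -> disc f -> 0 < t < 1 ->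
  peval (f ^+ k) t = peval f t ^+ k.
Proof.
move=> sf df t01; elim: k => [|k IH]; first by rewrite !expr0 (peval_nat 1).
by rewrite !exprS pevalM ?IH //; apply: discX.
Qed.

Lemma peval_fX m t : 0 < t < 1 -> peval (fX R m) t = t ^+ m.
Proof.
move=> t01; have X1 : peval (fX R 1) t = t.
  apply: pevalE; rewrite -(cvg_shiftS _) -(cvg_shiftS _).
  have -> : (fun N => psum (fX R 1) t N.+2) = (fun=> t).
    apply/funext => N; rewrite /psum !big_nat_recl // /pterm !fXE /= mul0r add0r mul1r.
    by rewrite expr1 big1 ?addr0 // => n _ /=; rewrite mul0r.
  exact: cvg_cst.
have -> : fX R m = fX R 1 ^+ m by rewrite fX_exp mul1n.
by rewrite pevalX ?X1 //; [apply: disc_fX|exact: disc_fX].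
Qed.

Let dilate_sum (F G : nat -> R) m N : (0 < m)%N ->
  (forall n, ~~ (m %| n)%N -> F n = 0) -> (forall n, F (m * n)%N = G n) ->
  \sum_(0 <= n < m * N) F n = \sum_(0 <= n < N) G n.
Proof.
move=> m0 F0 FG; elim: N => [|N IH]; first by rewrite muln0 !big_nil.
rewrite big_nat_recr //= -IH -FG (@big_cat_nat _ _ _ (m * N) 0 (m * N.+1)) //=; last first.
  by rewrite leq_pmul2l.
congr (_ + _); rewrite big_ltn ?ltn_pmul2l // [X in _ + X]big_nat_cond big1 ?addr0 // => n.
rewrite andbT => /andP[n1 n2]; apply: F0; apply/negP => /dvdnP[k nk].
by move: n1 n2; rewrite nk [(k * m)%N]mulnC !ltn_pmul2l //; lia.
Qed.

Let pterm_dilate m f t n : (0 < m)%N ->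
  pterm (dilate m f) t (m * n)%N = pterm f (t ^+ m) n.
Proof. by move=> m0; rewrite /pterm dilateME // exprM. Qed.

Let pterm_dilate0 m f t n : ~~ (m %| n)%N -> pterm (dilate m f) t n = 0.
Proof. by move=> mn; rewrite /pterm dilateE (negPf mn) mulr0n mul0r. Qed.

Lemma expr_unit t m : (0 < m)%N -> 0 < t < 1 -> 0 < t ^+ m < 1.
Proof. by move=> m0 /andP[t0 t1]; rewrite exprn_gt0 // exprn_ilt1 // ?ltW // -lt0n. Qed.

Lemma disc_dilate m f : (0 < m)%N -> disc f -> disc (dilate m f).
Proof.
move=> m0 df t t01; have [M fM] := df _ (expr_unit m0 t01); exists M => N.
apply: le_trans (fM N); apply: (@le_trans _ _ (nsum (dilate m f) t (m * N)%N)).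
  by apply: nsum_ge; rewrite leq_pmull.
rewrite /nsum (@dilate_sum _ (fun n => `|pterm f (t ^+ m) n|)) //.
  by move=> n mn; rewrite pterm_dilate0 ?normr0.
by move=> n; rewrite pterm_dilate.
Qed.

Lemma peval_dilate m f t : (0 < m)%N -> disc f -> 0 < t < 1 ->
  peval (dilate m f) t = peval f (t ^+ m).
Proof.
move=> m0 df t01; apply/esym/pevalE.
have := peval_cvg (disc_dilate m0 df t01) => cd.
have mcvg : (fun N => m * N)%N @ \oo --> \oo.
  by apply/cvgnyPge => A; exists A => // n /= An; apply: leq_trans An _; rewrite leq_pmull.
have -> : psum f (t ^+ m) = psum (dilate m f) t \o (fun N => m * N)%N.
  apply/funext => N /=; rewrite /psum (@dilate_sum _ (pterm f (t ^+ m))) //.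
    by move=> n mn; rewrite pterm_dilate0.
  by move=> n; rewrite pterm_dilate.
exact: (cvg_comp _ _ mcvg cd).
Qed.

(** The factor n is absorbed by a larger point s, since n (t / s)^n is
    bounded. *)
Lemma disc_eulerD f : disc f -> disc (eulerD f).
Proof.
move=> df t /andP[t0 t1]; pose s := (t + 1) / 2.
have ts : t < s by rewrite /s; lra.
have s01 : 0 < s < 1 by rewrite /s; apply/andP; split; lra.
have s0 : 0 < s by case/andP: s01.
have [M fM] := df _ s01; pose h := (s - t) / t.
have h0 : 0 < h by rewrite divr_gt0 // subr_gt0.
have hE : s = t * (1 + h) by rewrite /h; field; lra.
exists (h^-1 * M) => N.
apply: (@le_trans _ _ (h^-1 * nsum f s N)); last by rewrite ler_pM2l // invr_gt0.
rewrite mulr_sumr; apply: ler_sum => n _.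
rewrite /pterm eulerDE -mulr_natr !normrM !normr_nat.
rewrite [leRHS]mulrCA -[leLHS]mulrA; apply: ler_wpM2l => //.
have nX x k : 0 < x -> `|x ^+ k| = x ^+ k by move=> x0; rewrite ger0_norm // exprn_ge0 // ltW.
rewrite !nX // hE exprMn mulrC [leRHS]mulrCA.
apply: ler_wpM2l; first by rewrite exprn_ge0 // ltW.
have b : 1 + n%:R * h <= (1 + h) ^+ n.
  elim: n => [|n IH]; first by rewrite mul0r addr0 expr0.
  rewrite exprS -natr1; apply: le_trans (ler_wpM2l _ IH); last by lra.
  have : 0 <= n%:R * (h * h) by rewrite mulr_ge0 // mulr_ge0 // ltW.
  by nra.
by rewrite mulrC ler_pdivlMr //; apply: le_trans b; rewrite lerDr.
Qed.

Lemma disc_le f g : disc g -> (forall n, `|f n| <= `|g n|) -> disc f.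
Proof.
move=> dg fg t t01; have [M gM] := dg _ t01; exists M => N; apply: le_trans (gM N).
by apply: ler_sum => n _; rewrite /pterm !normrM ler_wpM2r.
Qed.

Lemma geometric_bound t N : 0 < t < 1 -> \sum_(0 <= n < N) t ^+ n <= (1 - t)^-1.
Proof.
move=> /andP[t0 t1]; have d0 : 0 < 1 - t by rewrite subr_gt0.
rewrite -[leRHS]mul1r ler_pdivlMr //.
have -> : (\sum_(0 <= n < N) t ^+ n) * (1 - t) = 1 - t ^+ N.
  elim: N => [|N IH]; first by rewrite big_nil mul0r expr0 subrr.
  by rewrite big_nat_recr //= mulrDl IH exprSr; ring.
by rewrite lerBlDr lerDl exprn_ge0 // ltW.
Qed.

(** The number of divisors of n is at most n, so the coefficients are bounded
    by n^(k + 1), those of an iterated [eulerD] of the geometric series. *)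
Lemma disc_lamb k (g : nat -> nat -> R) :
  (forall d x, `|g d x| <= d%:R ^+ k) -> disc (lamb g).
Proof.
move=> gk; pose G : fps R := Fps (fun=> 1).
have dG : disc G.
  move=> t t01; exists (1 - t)^-1 => N; apply: le_trans (geometric_bound N t01).
  apply: ler_sum => n _; rewrite /pterm mul1r ger0_norm // exprn_ge0 // ltW //.
  by case/andP: t01.
have dDG j : disc (iter j (@eulerD R) G).
  by elim: j => //= j IH; exact: disc_eulerD.
have DG j n : iter j (@eulerD R) G n = n%:R ^+ j.
  elim: j => [|j IH]; first by rewrite expr0.
  by rewrite iterS eulerDE IH exprSr mulr_natr.
apply: (disc_le (dDG k.+1)) => n; rewrite DG [ `|_ ^+ _|]ger0_norm ?exprn_ge0 //.
have [->|n0] := posnP n; first by rewrite lamb0E normr0 exprn_ge0.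
rewrite lambE //; apply: le_trans (ler_norm_sum _ _ _) _.
apply: (@le_trans _ _ (\sum_(d <- divisors n) n%:R ^+ k)).
  rewrite big_seq_cond [leRHS]big_seq_cond; apply: ler_sum => d.
  rewrite andbT => dn; apply: le_trans (gk _ _) _; apply: lerXn2r; rewrite ?nnegrE //.
  by rewrite ler_nat dvdn_leq // dvdn_divisors.
rewrite big_const_seq count_predT iter_addr_0 -[leLHS]mulr_natl exprS.
apply: ler_wpM2r; first exact: exprn_ge0.
rewrite ler_nat -[leqRHS](size_iota 1); apply: uniq_leq_size; first exact: divisors_uniq.
move=> d; rewrite -dvdn_divisors // => dn.
by rewrite mem_iota add1n ltnS (dvdn_leq n0 dn) (dvdn_gt0 n0 dn).
Qed.

(** ** The infinite product *)

Local Notation P := (einf (1 : R)).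

Let sum_pow t N : 0 < t < 1 -> \sum_(m < N) t ^+ m.+1 <= (1 - t)^-1.
Proof.
move=> t01; apply: le_trans (geometric_bound N.+1 t01).
rewrite big_mkord big_ord_recl lerDr expr0 //.
Qed.

(** Factor by factor, the sums are at most those of 1 + t^m, and
    1 + t^m <= exp (t^m).  The bound does not depend on the number of
    factors. *)
Lemma nsum_eprod t N K : 0 < t < 1 -> nsum (eprod 1 N) t K <= expR ((1 - t)^-1).
Proof.
move=> t01; have t0 : 0 <= t by case/andP: t01 => /ltW.
apply: (@le_trans _ _ (expR (\sum_(m < N) t ^+ m.+1))); last first.
  by rewrite ler_expR; exact: sum_pow.
elim: N => [|N IH].
  rewrite /eprod !big_ord0 expR0 -(rmorph1 (@fconst R)).
  by apply: le_trans (nsum_const _ _ _) _; rewrite normr1.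
rewrite eprodS big_ord_recr expRD; apply: le_trans (nsumM _ _ _ _) _.
apply: ler_pM => //; try exact: nsum_ge0.
apply: le_trans (expR_ge1Dx _); apply: le_trans (nsumD _ _ _ _) _.
rewrite nsumN rmorph1 mul1r; apply: lerD; last exact: nsum_fX.
by rewrite -(rmorph1 (@fconst R)); apply: le_trans (nsum_const _ _ _) _; rewrite normr1.
Qed.

Lemma nsum_einf t K : 0 < t < 1 -> nsum P t K <= expR ((1 - t)^-1).
Proof.
move=> t01; apply: le_trans (nsum_eprod K K t01); rewrite /nsum big_nat [leRHS]big_nat.
apply: ler_sum => n /andP[_ nK]; rewrite /pterm.
by rewrite (@einf_cong R 1 K n) // ltnS ltnW.
Qed.

Lemma disc_einf : disc P.
Proof. by move=> t t01; exists (expR ((1 - t)^-1)) => N; exact: nsum_einf. Qed.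

Lemma disc_eprod N : disc (eprod 1 N).
Proof. by move=> t t01; exists (expR ((1 - t)^-1)) => K; exact: nsum_eprod. Qed.

Lemma peval_eprod t N : 0 < t < 1 ->
  peval (eprod 1 N) t = \prod_(1 <= m < N.+1) (1 - t ^+ m).
Proof.
move=> t01; elim: N => [|N IH].
  by rewrite /eprod big_ord0 big_nil (peval_nat 1).
have d1 : disc (fX R N.+1) by exact: disc_fX.
rewrite eprodS rmorph1 mul1r pevalM //; first last.
- by apply: discB => //; exact: (disc_nat 1).
- exact: disc_eprod.
rewrite IH [RHS]big_nat_recr //; congr (_ * _).
rewrite pevalD; [|exact: (disc_nat 1)|exact: discN].
by rewrite pevalN; [rewrite (peval_nat 1) peval_fX|exact: d1].
Qed.

(** Only the tails contribute to the difference, and passing from s to t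
    gains (t / s)^N on them. *)
Lemma peval_cong f g t s M N : fcong N f g -> 0 < t -> t <= s ->
  (forall K, nsum f s K <= M) -> (forall K, nsum g s K <= M) ->
  `|peval f t - peval g t| <= (t / s) ^+ N * (M + M).
Proof.
move=> fg t0 ts fM gM; have s0 : 0 < s by apply: lt_le_trans ts.
have le1 : t / s <= 1 by rewrite ler_pdivrMr // mul1r.
have ge0 : 0 <= t / s by rewrite divr_ge0 // ltW.
have ns h K : nsum h t K <= nsum h s K.
  apply: ler_sum => n _; rewrite /pterm !normrM ler_wpM2l //.
  have nX x : 0 < x -> `|x ^+ n| = x ^+ n by move=> x0; rewrite ger0_norm // exprn_ge0 // ltW.
  by rewrite !nX // lerXn2r // nnegrE ltW.
have sf : psummable f t by exists M => K; apply: le_trans (ns _ _) _.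
have sg : psummable (- g) t by exists M => K; rewrite nsumN; apply: le_trans (ns _ _) _.
have -> : peval f t - peval g t = peval (f - g) t.
  by rewrite pevalD // -{1}[g]opprK (pevalN sg) opprK.
apply: peval_norm => K; apply: (@le_trans _ _ ((t / s) ^+ N * nsum (f - g) s K)).
  rewrite mulr_sumr; apply: ler_sum => n _; rewrite /pterm.
  case: (ltnP n N) => nN; first by rewrite fpsBE fg // subrr !mul0r normr0 mulr0.
  have -> : t ^+ n = (t / s) ^+ n * s ^+ n by rewrite -exprMn divfK // gt_eqF.
  rewrite mulrCA normrM [ `|(_ / _) ^+ _|]ger0_norm ?exprn_ge0 //.
  by apply: ler_wpM2r => //; exact: ler_wiXn2l.
apply: ler_wpM2l; first exact: exprn_ge0.
by apply: le_trans (nsumD _ _ _ _) _; rewrite nsumN; exact: lerD.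
Qed.

(** The partial products converge to the value of the series: they agree with
    it to higher and higher order, and all are bounded at a larger point. *)
Lemma einf_cvg t : 0 < t < 1 ->
  \prod_(1 <= m < N.+1) (1 - t ^+ m) @[N --> \oo] --> peval P t.
Proof.
move=> t01; have /andP[t0 t1] := t01; pose s := (t + 1) / 2.
have ts : t < s by rewrite /s; lra.
have s01 : 0 < s < 1 by rewrite /s; apply/andP; split; lra.
have s0 : 0 < s by case/andP: s01.
set M := expR ((1 - s)^-1) + expR ((1 - s)^-1).
have e0 : (fun N => (t / s) ^+ N * M) @ \oo --> (0 : R).
  rewrite -[X in _ --> X](mul0r M); apply: cvgMr_tmp; apply: cvg_expr.
  have q0 : 0 <= t / s by rewrite divr_ge0 // ltW.
  by rewrite ger0_norm // ltr_pdivrMr // mul1r.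
apply/cvgrPdist_le => e e_gt0; have /cvgrPdist_le /(_ e e_gt0) := e0.
apply: filterS => N; rewrite sub0r normrN => /(le_trans (ler_norm _)); apply: le_trans.
rewrite -peval_eprod // distrC.
apply: (peval_cong (fcong_le (leqnSn N) (@einf_cong R 1 N)) t0 (ltW ts)) => K.
  exact: nsum_eprod.
exact: nsum_einf.
Qed.

(** From 1 / (1 - x) <= exp (x / (1 - x)), with x = t^m and 1 - x >= 1 - t. *)
Lemma prod_lower t N : 0 < t < 1 ->
  expR (- ((1 - t)^-1 * (1 - t)^-1)) <= \prod_(1 <= m < N.+1) (1 - t ^+ m).
Proof.
move=> t01; have /andP[t0 t1] := t01; have d0 : 0 < 1 - t by rewrite subr_gt0.
apply: (@le_trans _ _ (expR (- ((1 - t)^-1 * \sum_(m < N) t ^+ m.+1)))).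
  by rewrite ler_expR lerN2; apply: ler_wpM2l; [rewrite invr_ge0 ltW|exact: sum_pow].
elim: N => [|N IH]; first by rewrite big_ord0 big_nil mulr0 oppr0 expR0.
rewrite big_nat_recr //= big_ord_recr mulrDr opprD expRD.
apply: ler_pM; rewrite ?expR_ge0 //.
have tN : t ^+ N.+1 <= t by rewrite exprS ger_pMr // exprn_ile1 // ltW.
have tN0 : 0 < t ^+ N.+1 by rewrite exprn_gt0.
rewrite expRN invf_ple ?posrE ?expR_gt0 ?subr_gt0 //; last by apply: le_lt_trans t1.
apply: le_trans (expR_ge1Dx _).
have x1 : 0 < 1 - t ^+ N.+1 by rewrite subr_gt0; apply: le_lt_trans t1.
rewrite -[leLHS]mul1r ler_pdivrMr //.
move: (t ^+ N.+1) tN tN0 x1 => x xt x0 x1.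
have -> : (1 + (1 - t)^-1 * x) * (1 - x) = 1 + x * (t - x) / (1 - t) by field; lra.
rewrite lerDl; apply: divr_ge0; last exact: ltW.
by apply: mulr_ge0; [exact: ltW|rewrite subr_ge0].
Qed.

Lemma peval_einf_neq0 t : 0 < t < 1 -> peval P t != 0.
Proof.
move=> t01; suff : expR (- ((1 - t)^-1 * (1 - t)^-1)) <= peval P t.
  by move/(lt_le_trans (expR_gt0 _)) => /lt0r_neq0.
apply: (cvgr_to_ge (einf_cvg t01)); apply: nearW => N; exact: prod_lower.
Qed.

End Evaluation.

(** * Transfer along field extensions *)

Section Transfer.
Variables (F K : numFieldType) (phi : {rmorphism F -> K}).

Lemma fmap_inj : injective (fmap phi).
Proof.
move=> f g fg; apply: fpsP => n; apply: (fmorph_inj phi).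
by rewrite -!fmapE fg.
Qed.

Lemma fmap_eis_chi k : fmap phi (eis_chi F k) = eis_chi K k.
Proof.
by rewrite fmap_lamb; apply: eq_lamb => d x _ _; rewrite rmorphM rmorphXn rmorph_int rmorph_nat.
Qed.

Lemma fmap_eis_chi' k : fmap phi (eis_chi' F k) = eis_chi' K k.
Proof.
by rewrite fmap_lamb; apply: eq_lamb => d x _ _; rewrite rmorphM rmorphXn rmorph_int rmorph_nat.
Qed.

Lemma fmap_cub_a : fmap phi (cub_a F) = cub_a K.
Proof.
rewrite /cub_a fmapD fmapM fmap1 fmap_nat fmap_lamb; congr (_ + _ * _).
by apply: eq_lamb => d x _ _; rewrite rmorph_int.
Qed.

Lemma fmap_cub_B : fmap phi (cub_B F) = cub_B K.
Proof. by rewrite /cub_B fmapB fmapM fmap1 fmap_nat fmap_eis_chi. Qed.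

Lemma fmap_cub_C : fmap phi (cub_C F) = cub_C K.
Proof. exact: fmap_eis_chi'. Qed.

Lemma fmap_E4s : fmap phi (E4s F) = E4s K.
Proof.
rewrite /E4s fmapD fmapM fmap1 fmap_nat fmap_lamb; congr (_ + _ * _).
by apply: eq_lamb => d x _ _; rewrite rmorphXn rmorph_nat.
Qed.
End Transfer.

Local Open Scope complex_scope.

Section RealIdentities.
Variable R : rcfType.
Local Notation a := (cub_a R).
Local Notation B := (cub_B R).
Local Notation C := (cub_C R).
Local Notation P := (einf (1 : R)).
Local Notation P3 := (dilate 3 P).
Let phi : {rmorphism R -> R[i]} := real_complex R.

(** The formal identities need a cube root of unity in the coefficient field.
    They are proved over the complex field and descend to the real one, where
    the series are evaluated. *)
Lemma exists_cube_root : exists w : R[i], w ^+ 2 + w + 1 = 0.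
Proof.
exists ((sqrtC (-3) - 1) / 2).
have := sqrtCK (-3 : R[i]); move: (sqrtC _) => s s2.
have -> : ((s - 1) / 2) ^+ 2 + (s - 1) / 2 + 1 = (s ^+ 2 + 3) / 4 by field.
by rewrite s2 addNr mul0r.
Qed.

Let fP : fmap phi P = einf 1.
Proof. by rewrite fmap_einf rmorph1. Qed.

Lemma cub_B_prod_real : B * P3 ^+ 3 = P ^+ 9.
Proof.
have [w w3] := exists_cube_root; apply: (fmap_inj (phi := phi)).
by rewrite fmapM !fmapX fmap_cub_B fmap_dilate fP (cub_B_prod w3).
Qed.

Lemma cub_C_prod_real : C * P ^+ 3 = fX R 1 * P3 ^+ 9.
Proof.
have [w w3] := exists_cube_root; apply: (fmap_inj (phi := phi)).
by rewrite [LHS]fmapM [RHS]fmapM !fmapX fmap_cub_C fmap_dilate fP fmap_fX (cub_C_prod w3).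
Qed.

Lemma E4s_diff_real : E4s R - dilate 3 (E4s R) = 240 * (a * C).
Proof.
have [w w3] := exists_cube_root; apply: (fmap_inj (phi := phi)).
rewrite fmapB !fmapM fmap_nat fmap_cub_a fmap_cub_C fmap_dilate fmap_E4s.
exact: (E4s_diff w3).
Qed.
End RealIdentities.

(** * Values on the imaginary axis *)

Section ImaginaryAxis.
Local Open Scope classical_set_scope.
Local Open Scope ring_scope.
Local Open Scope complex_scope.
Variable R : realType.
Implicit Types (y t : R) (z : R[i]).
Local Notation P := (einf (1 : R)).

Lemma cvg_realC (u : nat -> R) (l : R) : u @ \oo --> l -> (u n)%:C @[n --> \oo] --> l%:C.
Proof.
move=> ul; apply/cvgrPdist_lt => -[e e'].
rewrite ltcE /= => /andP[/eqP -> e0].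
have /cvgrPdist_lt /(_ e e0) := ul; apply: filterS => n h.
by rewrite -rmorphB normc_def /= expr0n addr0 sqrtr_sqr ltcR.
Qed.

Lemma cvg_Re (u : nat -> R[i]) (l : R[i]) : u @ \oo --> l ->
  complex.Re (u n) @[n --> \oo] --> complex.Re l.
Proof.
move=> ul; apply/cvgrPdist_lt => e e0.
have e0C : 0 < e%:C by rewrite ltcR.
have /cvgrPdist_lt /(_ _ e0C) := ul; apply: filterS => n.
rewrite -raddfB /=; move: (l - u n) => z; rewrite normc_def ltcR; apply: le_lt_trans.
case: z => x y /=; rewrite -sqrtr_sqr ler_wsqrtr // lerDl sqr_ge0 //.
Qed.

Lemma cvg_Im (u : nat -> R[i]) (l : R[i]) : u @ \oo --> l ->
  complex.Im (u n) @[n --> \oo] --> complex.Im l.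
Proof.
move=> ul; apply/cvgrPdist_lt => e e0.
have e0C : 0 < e%:C by rewrite ltcR.
have /cvgrPdist_lt /(_ _ e0C) := ul; apply: filterS => n.
rewrite -raddfB /=; move: (l - u n) => z; rewrite normc_def ltcR; apply: le_lt_trans.
case: z => x y /=; rewrite -sqrtr_sqr ler_wsqrtr // lerDr sqr_ge0 //.
Qed.

(** The terms are bounded at t = 1/2.  If the coefficients below m vanish, then
    |f_m| t^m is at most the tail, of order t^(m + 1), so f_m = 0. *)
Lemma psum_eq0 (f : fps R) :
  (forall t, 0 < t < 1 -> psum f t @ \oo --> (0 : R)) -> f = 0.
Proof.
move=> f0; have h01 : 0 < (2^-1 : R) < 1 by apply/andP; split; lra.
have [K fK] : exists K, forall n, `|pterm f 2^-1 n| <= K.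
  have c := f0 _ h01.
  have c' : (fun n => pterm f 2^-1 n) @ \oo --> (0 : R).
    have -> : pterm f 2^-1 = (fun n => psum f 2^-1 n.+1 - psum f 2^-1 n).
      by apply/funext => n; rewrite /psum big_nat_recr //= addrAC subrr add0r.
    by rewrite -(subrr 0); apply: cvgB => //; rewrite cvg_shiftS.
  have /cvg_seq_bounded [M [_ Mb]] : cvgn (pterm f 2^-1) by apply/cvg_ex; exists 0.
  by exists (M + 1) => n; apply: Mb => //; rewrite ltrDl.
pose s : R := 4^-1; have s0 : 0 < s by rewrite invr_gt0.
pose M := K * (1 - 2^-1)^-1.
have fM N : nsum f s N <= M.
  have K0 : 0 <= K by apply: le_trans (fK 0%N).
  apply: (@le_trans _ _ (K * \sum_(0 <= n < N) 2^-1 ^+ n)); last first.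
    by apply: ler_wpM2l => //; exact: geometric_bound.
  rewrite mulr_sumr; apply: ler_sum => n _.
  have -> : pterm f s n = pterm f 2^-1 n * 2^-1 ^+ n.
    by rewrite /pterm -mulrA -exprMn; congr (_ * _ ^+ _); rewrite /s; field.
  rewrite normrM [ `|_ ^+ _|]ger0_norm ?exprn_ge0 ?invr_ge0 //.
  by apply: ler_wpM2r => //; rewrite exprn_ge0 // invr_ge0.
apply: fpsP => m; rewrite fps0E; elim/ltn_ind: m => m IH.
pose h := fconst (f m) * fX R m.
have hE n : h n = f m * (n == m)%:R by rewrite /h fconstM fXE.
have fh : fcong m.+1 f h.
  move=> n; rewrite ltnS leq_eqVlt hE => /orP[/eqP ->|nm]; first by rewrite eqxx mulr1.
  by rewrite IH // (ltn_eqF nm) mulr0.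
have h1 t : 0 < t < 1 -> peval h t = f m * t ^+ m.
  by move=> t01; rewrite pevalM ?peval_const ?peval_fX //; [exact: disc_const|exact: disc_fX].
have hM N : nsum h s N <= `|f m| * s ^+ m.
  apply: le_trans (nsumM _ _ _ _) _; apply: ler_pM; rewrite ?nsum_ge0 ?nsum_const //.
  by apply: nsum_fX; exact: ltW.
pose M' := M + `|f m| * s ^+ m.
have M0 : 0 <= M by apply: le_trans (fM 0%N); exact: nsum_ge0.
have m0 : 0 <= `|f m| * s ^+ m by rewrite mulr_ge0 // exprn_ge0 // ltW.
have key t : 0 < t -> t <= s -> `|f m| <= t * (s ^- m.+1 * (M' + M')).
  move=> t0 ts; have t01 : 0 < t < 1 by rewrite t0; apply: le_lt_trans ts _; rewrite /s; lra.
  have tm : 0 < t ^+ m by rewrite exprn_gt0.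
  have fM' N : nsum f s N <= M' by apply: le_trans (fM N) _; rewrite lerDl.
  have hM' N : nsum h s N <= M' by apply: le_trans (hM N) _; rewrite lerDr.
  have := peval_cong fh t0 ts fM' hM'.
  rewrite h1 // (pevalE (f0 _ t01)) sub0r normrN normrM (ger0_norm (ltW tm)).
  by rewrite expr_div_n exprS -!mulrA mulrC [leRHS]mulrCA ler_pM2l.
apply/eqP; rewrite -normr_eq0 eq_le normr_ge0 andbT; apply/ler_addgt0Pr => e e0.
rewrite add0r; set L := s ^- m.+1 * (M' + M') in key.
have L0 : 0 <= L.
  by rewrite mulr_ge0 ?invr_ge0 ?exprn_ge0 ?addr_ge0 // ltW.
pose t := Num.min s (e / (L + 1)).
have L1 : 0 < L + 1 by apply: ltr_wpDl.
have t0 : 0 < t by rewrite lt_min s0 divr_gt0.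
have ts : t <= s by rewrite ge_min lexx.
apply: le_trans (key t t0 ts) _.
apply: (@le_trans _ _ (e / (L + 1) * (L + 1))); last by rewrite divfK // gt_eqF.
by apply: ler_pM => //; [exact: ltW|rewrite ge_min lexx orbT|rewrite lerDl].
Qed.

Lemma qpow_imag (b y : R) : qpow b (0 +i* y) = (expR (- (2 * pi * b * y)))%:C.
Proof.
rewrite /qpow; have -> : (2 * pi * b)%:C * 'i * (0 +i* y) = (- (2 * pi * b * y))%:C.
  by simpc.
by rewrite /cexp /= cos0 sin0; simpc.
Qed.

Section Nome.
Variables (y : R).
Hypothesis y0 : 0 < y.
(** The value of q at z = i y. *)
Definition nome := expR (- (2 * pi * y)).
Local Notation t := nome.

Lemma nome01 : 0 < t < 1.
Proof. by rewrite expR_gt0 expR_lt1 oppr_lt0 !mulr_gt0 ?pi_gt0. Qed.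

Lemma q_imag : q (0 +i* y) = t%:C.
Proof. by rewrite /q qpow_imag mulr1. Qed.

Lemma eta_imag : eta (0 +i* y) = (expR (- (2 * pi * 24^-1 * y)) * peval P t)%:C.
Proof.
rewrite /eta qpow_imag rmorphM; congr (_ * _).
apply: cvg_lim; first exact: norm_hausdorff.
have -> : (fun N => \prod_(1 <= n < N.+1) (1 - q (0 +i* y) ^+ n)) =
   (fun N => (\prod_(1 <= n < N.+1) (1 - t ^+ n))%:C).
  apply/funext => N; rewrite rmorph_prod; apply: eq_bigr => n _.
  by rewrite q_imag rmorphB rmorphXn rmorph1.
by apply: cvg_realC; exact: einf_cvg nome01.
Qed.

Lemma disc_sigma3 : disc (sigma3 R).
Proof. by apply: (disc_lamb (k := 3)) => d x; rewrite ger0_norm // exprn_ge0. Qed.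

Lemma disc_E4s : disc (E4s R).
Proof.
apply: discD; first exact: (disc_nat 1).
by apply: discM; [exact: disc_nat|exact: disc_sigma3].
Qed.

Lemma psum1 (f : fps R) (u : R) N : f 0%N = 0 ->
  \sum_(1 <= n < N.+1) f n * u ^+ n = psum f u N.+1.
Proof. by move=> f0; rewrite /psum [RHS]big_ltn // /pterm f0 mul0r add0r. Qed.

Lemma E4_imag : E4 (0 +i* y) = (peval (E4s R) t)%:C.
Proof.
have t01 := nome01; rewrite /E4.
have -> : peval (E4s R) t = 1 + 240 * peval (sigma3 R) t.
  have d3 := disc_sigma3 t01; have dn m : psummable m%:R t := disc_nat m t01.
  rewrite /E4s pevalD; [|exact: (dn 1%N)|].
    rewrite pevalM; [|exact: dn|exact: d3].
    by rewrite (peval_nat 240) (peval_nat 1).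
  by apply: discM => //; [exact: disc_nat|exact: disc_sigma3].
rewrite rmorphD rmorphM rmorph1 rmorph_nat; congr (_ + _ * _).
apply: cvg_lim; first exact: norm_hausdorff.
have -> : (fun N => \sum_(1 <= n < N.+1) (sigma 3 n)%:R * q (0 +i* y) ^+ n) =
   (fun N => (psum (sigma3 R) t N.+1)%:C).
  apply/funext => N; rewrite -psum1 // rmorph_sum big_nat [RHS]big_nat.
  apply: eq_bigr => n /andP[n0 _]; rewrite q_imag rmorphM rmorphXn; congr (_ * _).
  rewrite lambE // /sigma natr_sum rmorph_sum; apply: eq_bigr => d _.
  by rewrite rmorphXn rmorph_nat natrX.
apply: cvg_realC; rewrite cvg_shiftS; apply: peval_cvg; exact: disc_sigma3.
Qed.
End Nome.

Lemma nome3 y : nome (3 * y) = nome y ^+ 3.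
Proof. by rewrite /nome -expRM_natl; congr expR; ring. Qed.

Lemma imag3 y : 3 * (0 +i* y) = 0 +i* (3 * y) :> R[i].
Proof. by rewrite -[3 in LHS](rmorph_nat (real_complex R)); simpc. Qed.

(** Every t in (0, 1) is a value of q, so that the real and imaginary parts of
    tau are coefficients of power series with known values on (0, 1). *)
Lemma fourier_uniq (F : R[i] -> R[i]) tau (c : fps R) :
    fourier_coefs F tau -> disc c -> c 0%N = 0 ->
    (forall y, 0 < y -> F (0 +i* y) = (peval c (nome y))%:C) ->
  forall n, (0 < n)%N -> tau n = (c n)%:C.
Proof.
move=> Ftau dc c0 Fc.
pose f : fps R := Fps (fun n => if n == 0%N then 0 else complex.Re (tau n)).
pose g : fps R := Fps (fun n => if n == 0%N then 0 else complex.Im (tau n)).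
have every t : 0 < t < 1 -> exists2 y, 0 < y & nome y = t.
  move=> /andP[t0 t1]; have pi0 := pi_gt0 R.
  have pi2 : 0 < 2 * pi :> R by rewrite mulr_gt0.
  exists (- ln t / (2 * pi)); first by rewrite divr_gt0 // oppr_gt0 ln_lt0 // t0.
  by rewrite /nome mulrC divfK ?gt_eqF // opprK lnK.
have tauE t : 0 < t < 1 -> psum f t @ \oo --> peval c t /\ psum g t @ \oo --> (0 : R).
  move=> /every[y y0 <-]; have := Ftau (0 +i* y) y0; rewrite Fc // q_imag => h.
  have E n : tau n * (nome y)%:C ^+ n =
      (complex.Re (tau n) * nome y ^+ n) +i* (complex.Im (tau n) * nome y ^+ n).
    by rewrite -rmorphXn; case: (tau n) => x x'; simpc.
  split; rewrite -(cvg_shiftS _).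
  - have -> : (fun N => psum f (nome y) N.+1) =
        (fun N => complex.Re (\sum_(1 <= n < N.+1) tau n * (nome y)%:C ^+ n)).
      apply/funext => N; rewrite -psum1 // raddf_sum big_nat [RHS]big_nat.
      by apply: eq_bigr => n /andP[n0 _]; rewrite E /= gtn_eqF.
    exact: (cvg_Re h).
  - have -> : (fun N => psum g (nome y) N.+1) =
        (fun N => complex.Im (\sum_(1 <= n < N.+1) tau n * (nome y)%:C ^+ n)).
      apply/funext => N; rewrite -psum1 // raddf_sum big_nat [RHS]big_nat.
      by apply: eq_bigr => n /andP[n0 _]; rewrite E /= gtn_eqF.
    exact: (cvg_Im h).
have g0 : g = 0 by apply: psum_eq0 => t /tauE[].
have fc : f - c = 0.
  apply: psum_eq0 => t t01; have [cf _] := tauE t t01.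
  have -> : psum (f - c) t = (fun N => psum f t N - psum c t N).
    apply/funext => N; rewrite /psum -sumrB; apply: eq_bigr => n _.
    by rewrite /pterm fpsBE mulrBl.
  by rewrite -(subrr (peval c t)); apply: cvgB => //; apply: peval_cvg; exact: dc.
move=> n n0; have := congr1 (fun h : fps R => h n) fc; have := congr1 (fun h : fps R => h n) g0.
rewrite fpsBE fps0E /= (gtn_eqF n0) => gn /eqP; rewrite subr_eq0 => /eqP fn.
by move: gn fn; case: (tau n) => x x' /= -> ->.
Qed.

End ImaginaryAxis.

(** * The cusp forms as polynomials in the cubic series *)

Section CuspForms.
Variable R : realType.
Local Notation a := (cub_a R).
Local Notation B := (cub_B R).
Local Notation C := (cub_C R).
Local Notation P := (einf (1 : R)).
Local Notation P3 := (dilate 3 P).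

Lemma norm_chi3 d : `|(chi3 d)%:~R| <= 1 :> R.
Proof. by rewrite /chi3; case: (3 %| d)%N; case: (3 %| d.-1)%N; rewrite ?mulr0z ?mulrN1z ?normrN ?normr0 ?normr1. Qed.

Lemma disc_a : disc a.
Proof.
apply: discD; first exact: (disc_nat 1).
by apply: discM; [exact: disc_nat|apply: (disc_lamb (k := 0)) => d x; exact: norm_chi3].
Qed.

Lemma disc_B : disc B.
Proof.
apply: discB; first exact: (disc_nat 1).
apply: discM; [exact: disc_nat|apply: (disc_lamb (k := 2)) => d x].
by rewrite normrM [X in _ * X]ger0_norm ?exprn_ge0 // ler_piMl ?exprn_ge0 ?norm_chi3.
Qed.

Lemma disc_C : disc C.
Proof.
apply: (disc_lamb (k := 2)) => d x.
by rewrite normrM [X in _ * X]ger0_norm ?exprn_ge0 // ler_piMl ?exprn_ge0 ?norm_chi3.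
Qed.

Section Values.
Variables (y : R).
Hypothesis y0 : 0 < y.
Local Notation t := (nome y).
Let t01 : 0 < t < 1 := nome01 y0.
Let y30 : 0 < 3 * y. Proof. by rewrite mulr_gt0. Qed.
Let p1 := peval P t.
Let p3 := peval P3 t.
Let p3E : p3 = peval P (nome (3 * y)).
Proof. by rewrite nome3 /p3 peval_dilate //; exact: disc_einf. Qed.
Let p1_neq0 : p1 != 0. Proof. exact: peval_einf_neq0. Qed.
Let p3_neq0 : p3 != 0. Proof. by rewrite p3E; apply: peval_einf_neq0; exact: nome01. Qed.
Let r := expR (- (2 * pi * 24^-1 * y)) : R.
Let r_neq0 : r != 0. Proof. by rewrite gt_eqF // expR_gt0. Qed.
Let r24 : r ^+ 24 = t.
Proof. by rewrite /r /nome -expRM_natl; congr expR; field. Qed.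

Let eta1 : eta (0 +i* y) = (r * p1)%:C.
Proof. exact: eta_imag. Qed.

Let eta3 : eta (3 * (0 +i* y)) = (r ^+ 3 * p3)%:C.
Proof.
rewrite imag3 eta_imag // p3E /r -expRM_natl; congr (_ * _)%:C.
by congr expR; ring.
Qed.

Let X3 (f : fps R) k : disc f -> peval (f ^+ k) t = peval f t ^+ k.
Proof. by move=> df; apply: pevalX => //; exact: df. Qed.
Let M (f g : fps R) : disc f -> disc g -> peval (f * g) t = peval f t * peval g t.
Proof. by move=> df dg; apply: pevalM; [exact: df|exact: dg]. Qed.
Let dP3 : disc P3. Proof. by apply: disc_dilate => //; exact: disc_einf. Qed.
Let dP : disc P. Proof. exact: disc_einf. Qed.

(* The eta quotients: the exponents of r, the 24th root of q, cancel in B and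
   leave r^24 = q in C. *)
Let BE : peval B t = p1 ^+ 9 / p3 ^+ 3.
Proof.
have : peval (B * P3 ^+ 3) t = peval (P ^+ 9) t by rewrite cub_B_prod_real.
rewrite (M disc_B (discX 3 dP3)) !X3 // -/p1 -/p3 => <-.
by rewrite mulfK ?expf_neq0.
Qed.

Let CE : peval C t = t * p3 ^+ 9 / p1 ^+ 3.
Proof.
have : peval (C * P ^+ 3) t = peval (fX R 1 * P3 ^+ 9) t by rewrite cub_C_prod_real.
have d1 : disc (fX R 1) by exact: disc_fX.
rewrite (M disc_C (discX 3 dP)) (M d1 (discX 9 dP3)) !X3 //.
rewrite peval_fX // expr1 -/p1 -/p3 => <-.
by rewrite mulfK ?expf_neq0.
Qed.

Let dE4 := @disc_E4s R.
Let dE43 : disc (dilate 3 (E4s R)). Proof. exact: disc_dilate. Qed.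

Let E43 : E4 (3 * (0 +i* y)) = (peval (dilate 3 (E4s R)) t)%:C.
Proof. by rewrite imag3 E4_imag // nome3 peval_dilate. Qed.

Lemma Delta7_imag : Delta7 (0 +i* y) = (peval (a * C * B) t)%:C.
Proof.
have dac : disc (a * C) by apply: discM; [exact: disc_a|exact: disc_C].
have e : peval (E4s R) t - peval (dilate 3 (E4s R)) t = 240 * peval (a * C) t.
  rewrite -(peval_nat 240 t) -M //; last exact: disc_nat.
  rewrite -E4s_diff_real (pevalD (dE4 t01) (discN dE43 t01)).
  by rewrite (pevalN (dE43 t01)).
rewrite /Delta7 eta1 eta3 E4_imag // E43 (M dac disc_B) BE.
have -> : (240^-1 : R[i]) = (240^-1)%:C by rewrite fmorphV rmorph_nat.
rewrite -rmorphB e -!rmorphXn -fmorphV -!rmorphM; congr (_%:C).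
by field; rewrite r_neq0 p3_neq0.
Qed.

Lemma eta_3_15_imag :
  eta (0 +i* y) ^+ 3 * eta (3 * (0 +i* y)) ^+ 15 = (peval (C ^+ 2 * B) t)%:C.
Proof.
rewrite eta1 eta3 (M (discX 2 disc_C) disc_B) (X3 2 disc_C) BE CE -r24.
rewrite -!rmorphXn -rmorphM; congr (_%:C).
by field; rewrite p1_neq0 p3_neq0.
Qed.

Lemma eta_15_3_imag :
  eta (0 +i* y) ^+ 15 * eta (3 * (0 +i* y)) ^+ 3 = (peval (B ^+ 2 * C) t)%:C.
Proof.
rewrite eta1 eta3 (M (discX 2 disc_B) disc_C) (X3 2 disc_B) BE CE -r24.
rewrite -!rmorphXn -rmorphM; congr (_%:C).
by field; rewrite p1_neq0 p3_neq0.
Qed.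

Let dD : disc (a * C * B).
Proof. by apply: discM disc_B; apply: discM; [exact: disc_a|exact: disc_C]. Qed.

Lemma E4_Delta7_imag :
  E4 (0 +i* y) * Delta7 (0 +i* y) = (peval (E4s R * (a * C * B)) t)%:C.
Proof. by rewrite E4_imag // Delta7_imag (M dE4 dD) rmorphM. Qed.

Lemma E4_3_Delta7_imag : E4 (3 * (0 +i* y)) * Delta7 (0 +i* y) =
  (peval (dilate 3 (E4s R) * (a * C * B)) t)%:C.
Proof. by rewrite E43 Delta7_imag (M dE43 dD) rmorphM. Qed.

End Values.
End CuspForms.

Theorem theorem2p1 (R : realType)
    (tau7 tau9_1 tau9_2 tau11_1 tau11_2 : nat -> R[i])
    (Htau7 : fourier_coefs (@Delta7 R) tau7)
    (Htau9_1 : fourier_coefs (fun z => eta z ^+ 3 * eta (3 * z) ^+ 15) tau9_1)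
    (Htau9_2 : fourier_coefs (fun z => eta z ^+ 15 * eta (3 * z) ^+ 3) tau9_2)
    (Htau11_1 : fourier_coefs (fun z => E4 z * Delta7 z) tau11_1)
    (Htau11_2 : fourier_coefs (fun z => E4 (3 * z) * Delta7 z) tau11_2)
    (n : nat) (n_gt0 : (0 < n)%N) :
  [/\ (nrep 7 n)%:R = 3 / 7 * (rho 6 n)%:~R + 216 / 7 * tau7 n,
      (nrep 9 n)%:R = 27 / 809 * (rho 8 n)%:~R
        + 24 * 1728 / 809 * (27 * tau9_1 n + tau9_2 n)
    & (nrep 11 n)%:R = 3 / 1847 * (rho 10 n)%:~R
        + 81 * 748 / 9235 * (tau11_1 n + 9 * tau11_2 n)].
Proof.
have [w w3] := exists_cube_root R.
pose phi : {rmorphism R -> R[i]} := real_complex R.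
have da := @disc_a R; have dB := @disc_B R; have dC := @disc_C R.
have dE := @disc_E4s R.
have dE3 : disc (dilate 3 (E4s R)) by exact: disc_dilate.
have dD : disc (cub_a R * cub_C R * cub_B R) by apply: discM dB; exact: discM.
have C0 : cub_C R 0%N = 0 by exact: lamb0E.
have D0 : (cub_a R * cub_C R * cub_B R) 0%N = 0 by rewrite !fpsME0 C0 mulr0 mul0r.
have e7 : tau7 n = (cub_a R[i] * cub_C R[i] * cub_B R[i]) n.
  rewrite (fourier_uniq Htau7 dD D0 (@Delta7_imag R) n_gt0).
  by rewrite -[LHS](fmapE phi) !fmapM fmap_cub_a fmap_cub_B fmap_cub_C.
have e9_1 : tau9_1 n = (cub_C R[i] ^+ 2 * cub_B R[i]) n.
  rewrite (fourier_uniq Htau9_1 _ _ (@eta_3_15_imag R) n_gt0).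
  - by rewrite -[LHS](fmapE phi) fmapM fmapX fmap_cub_B fmap_cub_C.
  - by apply: discM => //; exact: discX.
  - by rewrite fpsME0 fpsXE0 C0 expr0n mul0r.
have e9_2 : tau9_2 n = (cub_B R[i] ^+ 2 * cub_C R[i]) n.
  rewrite (fourier_uniq Htau9_2 _ _ (@eta_15_3_imag R) n_gt0).
  - by rewrite -[LHS](fmapE phi) fmapM fmapX fmap_cub_B fmap_cub_C.
  - by apply: discM => //; exact: discX.
  - by rewrite fpsME0 C0 mulr0.
have e11_1 : tau11_1 n = (E4s R[i] * (cub_a R[i] * cub_C R[i] * cub_B R[i])) n.
  rewrite (fourier_uniq Htau11_1 _ _ (@E4_Delta7_imag R) n_gt0).
  - by rewrite -[LHS](fmapE phi) !fmapM fmap_E4s fmap_cub_a fmap_cub_B fmap_cub_C.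
  - exact: discM.
  - by rewrite fpsME0 D0 mulr0.
have e11_2 : tau11_2 n = (dilate 3 (E4s R[i]) * (cub_a R[i] * cub_C R[i] * cub_B R[i])) n.
  rewrite (fourier_uniq Htau11_2 _ _ (@E4_3_Delta7_imag R) n_gt0).
  - rewrite -[LHS](fmapE phi) !fmapM fmap_dilate fmap_E4s fmap_cub_a fmap_cub_B.
    by rewrite fmap_cub_C.
  - exact: discM.
  - by rewrite fpsME0 D0 mulr0.
have div (c x z : R[i]) : c != 0 -> c * x = z -> x = z / c.
  by move=> c0 <-; rewrite mulrC mulKf.
rewrite !(nrepE R[i]) (hexagonal_lambert w3) !(rhoE _ _ n_gt0).
rewrite e7 e9_1 e9_2 e11_1 e11_2.
rewrite -[6./2]/3%N -[8./2]/4%N -[10./2]/5%N.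
split.
- rewrite (div 7 _ _ _ (cub_a7_coef w3 n_gt0)) ?pnatr_eq0 //.
  move: (eis_chi' R[i] 6 n) (eis_chi R[i] 6 n) (fcoef _ n) => x1 x2 x3.
  by field.
- rewrite (div 809 _ _ _ (cub_a9_coef w3 n_gt0)) ?pnatr_eq0 //.
  move: (eis_chi' R[i] 8 n) (eis_chi R[i] 8 n) (fcoef _ n) (fcoef _ n) => x1 x2 x3 x4.
  by field.
- rewrite (div 9235 _ _ _ (cub_a11_coef w3 n_gt0)) ?pnatr_eq0 //.
  move: (eis_chi' R[i] 10 n) (eis_chi R[i] 10 n) (fcoef _ n) (fcoef _ n) => x1 x2 x3 x4.
  by field.
Qed.
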